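(* Let $\rho\in\mathbb R$, let $(\Lambda,\Gamma)$, $\Gamma=(f,b,\sigma)$, be coefficients satisfying assumptions (A1) and (A2) of the context, and assume that $\ln(4L_1^2)<-\ln(6L_2^2)$ and $\ln(4L_1^2)<\rho<-\ln(6L_2^2)$, where $L_1,L_2$ are the constants in (A1). Then the forward-backward stochastic difference equation FBS$\triangle$E $(\Lambda,\Gamma)$ $$x_{k+1}=b(k,\theta_k)+\sigma(k,\theta_k)w_k,\qquad y_k=-f(k+1,\theta_k),\quad k\in\mathbb T_\infty,\qquad x_0=\Lambda(y_0),$$ where $\theta_k=(x_k,y'_{k+1},z'_{k+1})$, $y'_{k+1}=\mathbb E[y_{k+1}|\mathcal F_{k-1}]$, $z'_{k+1}=\mathbb E[y_{k+1}w_k|\mathcal F_{k-1}]$, admits a unique solution $(x(\cdot),y(\cdot))\in N^{2,\rho}(\mathbb T_\infty;\mathbb R^{2n})$. Moreover, $$\|x(\cdot)\|_\rho^2+\|y(\cdot)\|_\rho^2\le K\,\mathbb E[\mathrm I],$$ where $$\mathrm I=\sum_{k=0}^\infty e^{-\rho k}|b(k,0,0,0)|^2+\sum_{k=0}^\infty e^{-\rho k}|\sigma(k,0,0,0)|^2+\sum_{k=0}^\infty e^{-\rho(k+1)}|f(k+1,0,0,0)|^2+|\Lambda(0)|^2$$ and $K$ is a positive constant depending only on the Lipschitz constants, $\mu$, $\nu$ and the bounds of all $A(\cdot),B(\cdot),C(\cdot),M$. Furthermore, if $(\bar\Lambda,\bar\Gamma)$, $\bar\Gamma=(\bar f,\bar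 b,\bar\sigma)$, is another set of coefficients satisfying (A1) and (A2), and $(\bar x(\cdot),\bar y(\cdot))\in N^{2,\rho}(\mathbb T_\infty;\mathbb R^{2n})$ is a solution of FBS$\triangle$E $(\bar\Lambda,\bar\Gamma)$, then $$\|x(\cdot)-\bar x(\cdot)\|_\rho^2+\|y(\cdot)-\bar y(\cdot)\|_\rho^2\le K\,\mathbb E[\widehat{\mathrm I}],$$ where, with $\bar\theta_k=(\bar x_k,\mathbb E[\bar y_{k+1}|\mathcal F_{k-1}],\mathbb E[\bar y_{k+1}w_k|\mathcal F_{k-1}])$, $$\widehat{\mathrm I}=\sum_{k=0}^\infty e^{-\rho k}|b(k,\bar\theta_k)-\bar b(k,\bar\theta_k)|^2+\sum_{k=0}^\infty e^{-\rho k}|\sigma(k,\bar\theta_k)-\bar\sigma(k,\bar\theta_k)|^2+\sum_{k=0}^\infty e^{-\rho(k+1)}|f(k+1,\bar\theta_k)-\bar f(k+1,\bar\theta_k)|^2+|\Lambda(\bar y_0)-\bar\Lambda(\bar y_0)|^2 ,$$ and the constant $K$ is the same as in the first estimate.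
   Context: $\mathbb T_\infty=\{0,1,2,\dots\}$. $(\Omega,\mathcal F,\mathbb F,\mathbb P)$ is a complete filtered probability space carrying a real-valued martingale difference sequence $\{w_k\}_{k\in\mathbb T_\infty}$; $\mathcal F_k$ is the $\sigma$-algebra generated by $x_0,w_0,\dots,w_k$ for $k\ge 0$, $\mathcal F_{-1}=\{\emptyset,\Omega\}$ (so $x_0$, being $\mathcal F_{-1}$-measurable, is deterministic), and $\mathbb E[w_{k+1}|\mathcal F_k]=0$, $\mathbb E[w_{k+1}^2|\mathcal F_k]=1$ for all $k\ge -1$. $L^{2,\rho}_{\mathbb F}(\mathbb T_\infty;\mathbb R^n)$ is the set of $\mathbb R^n$-valued processes $g=(g_0,g_1,\dots)$ with $g_k$ $\mathcal F_{k-1}$-measurable for every $k$ and $\|g(\cdot)\|_\rho^2:=\mathbb E\sum_{k=0}^\infty e^{-\rho k}|g_k|^2<\infty$. $N^{2,\rho}(\mathbb T_\infty;\mathbb R^{2n})=L^{2,\rho}_{\mathbb F}(\mathbb T_\infty;\mathbb R^n)^2$. $L^\infty_{\mathbb F}(\mathbb T_\infty;\mathbb R^{m\times n})$ is the set of essentially bounded (uniformly in $k,\omega$) matrix-valued processes $h$ with $h_k$ $\mathcal F_{k-1}$-measurable. A solution of the FBS$\triangle$E is a pair in $N^{2,\rho}(\mathbb T_\infty;\mathbb R^{2n})$ satisfying the equations almost surely for every $k\in\mathbb T_\infty$. Coefficients: $\Lambda:\mathbb R^n\to\mathbb R^n$ and random mappings $b(k,\theta),\sigma(k,\theta),f(k+1,\theta)\in\mathbb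 R^n$ for $k\in\mathbb T_\infty$, $\theta=(x,y',z')\in\mathbb R^{3n}$; $\Gamma(k,\theta)=(f(k+1,\theta),b(k,\theta),\sigma(k,\theta))$. (A1): (i) $\Lambda(y)$ is deterministic for every $y$; $\Gamma(k,\theta)$ is $\mathcal F_{k-1}$-measurable for every $\theta\in\mathbb R^{3n}$, $k\in\mathbb T_\infty$; and $\mathbb E\sum_{k=0}^\infty e^{-\rho k}\big(|f(k+1,0,0,0)|^2+|b(k,0,0,0)|^2+|\sigma(k,0,0,0)|^2\big)<\infty$. (ii) There are constants $L,L_1,\dots,L_7>0$ such that for all $k$ and all arguments $|\Lambda(y)-\Lambda(\bar y)|\le L|y-\bar y|$, $|b(k,x,y',z')-b(k,\bar x,\bar y',\bar z')|\le L_1|x-\bar x|+L_3|y'-\bar y'|+L_4|z'-\bar z'|$, $|\sigma(k,x,y',z')-\sigma(k,\bar x,\bar y',\bar z')|\le L_1|x-\bar x|+L_5|y'-\bar y'|+L_6|z'-\bar z'|$, $|f(k+1,x,y',z')-f(k+1,\bar x,\bar y',\bar z')|\le L_7|x-\bar x|+L_2(|y'-\bar y'|+|z'-\bar z'|)$. These constants are called the Lipschitz constants. (A2) (domination-monotonicity): there exist constants $\mu,\nu\ge 0$, a matrix $M\in\mathbb R^{m\times n}$ and processes $A(\cdot),B(\cdot),C(\cdot)\in L^\infty_{\mathbb F}(\mathbb T_\infty;\mathbb R^{m\times n})$ such that: (i) either $\mu>0$ and $\nu=0$ (Case 1), or $\mu=0$ and $\nu>0$ (Case 2). (ii) For all $k$,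 almost all $\omega$ and all arguments, writing $\widehat x=x-\bar x$, $\widehat y=y-\bar y$, $\widehat y'=y'-\bar y'$, $\widehat z'=z'-\bar z'$: $|\Lambda(y)-\Lambda(\bar y)|\le\frac1\mu|M\widehat y|$; $|f(k+1,x,y',z')-f(k+1,\bar x,y',z')|\le\frac1\nu|A_k\widehat x|$; $|h(k,x,y',z')-h(k,x,\bar y',\bar z')|\le\frac1\mu|B_k\widehat y'+C_k\widehat z'|$ for $h=b,\sigma$; where a constraint involving $\frac1\mu$ (resp. $\frac1\nu$) is void when $\mu=0$ (resp. $\nu=0$). (iii) For all $k$, almost all $\omega$, all $\theta=(x,y',z'),\bar\theta=(\bar x,\bar y',\bar z')\in\mathbb R^{3n}$ and $y,\bar y\in\mathbb R^n$: $\langle\Lambda(y)-\Lambda(\bar y),\widehat y\rangle\le-\mu|M\widehat y|^2$ and $\langle f(k+1,\theta)-f(k+1,\bar\theta),\widehat x\rangle+e^{-\rho}\langle b(k,\theta)-b(k,\bar\theta),\widehat y'\rangle+e^{-\rho}\langle\sigma(k,\theta)-\sigma(k,\bar\theta),\widehat z'\rangle\le-\nu|A_k\widehat x|^2-\mu|B_k\widehat y'+C_k\widehat z'|^2$. *)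

(* Defs.v *)
From HB Require Import structures.
From mathcomp Require Export all_boot all_order all_algebra.
From mathcomp Require Export all_classical all_reals all_analysis.

Set Implicit Arguments.
Unset Strict Implicit.
Unset Printing Implicit Defensive.

Export Order.TTheory GRing.Theory Num.Def Num.Theory.
Export numFieldNormedType.Exports.

Global Open Scope classical_set_scope.
Global Open Scope ring_scope.

(* The norm [`|_|] carried by the library on matrices is the sup norm. The
   inner product below is tr(A^T B), so that on column vectors [inner] and
   [enorm] are the Euclidean inner product and norm, and on matrices [enorm]
   is the Frobenius norm. *)
Definition inner (R : realType) (m n : nat) (A B : 'M[R]_(m, n)) : R :=
  \sum_i \sum_j A i j * B i j.

Definition enorm (R : realType) (m n : nat) (A : 'M[R]_(m, n)) : R :=
  Num.sqrt (inner A A).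

Section Probability.
Context {d : measure_display} {T : measurableType d} {R : realType}.
Variable P : probability T R.

(* [G] is meant to be a sub-sigma-algebra of the measurable sets; [Y] is a
   version of E[X | G]. *)
Definition is_cond_exp (G : set (set T)) (X Y : T -> R) : Prop :=
  [/\ P.-integrable setT (EFin \o X),
      measurable_fun [set: g_sigma_algebraType G] Y,
      P.-integrable setT (EFin \o Y) &
      forall A, G A -> (\int[P]_(o in A) (Y o)%:E = \int[P]_(o in A) (X o)%:E)%E].

(* A chosen version of E[X | G]; the default value is only reached when [X] is
   not integrable. *)
Definition cond_exp (G : set (set T)) (X : T -> R) : T -> R :=
  xget (cst 0) [set Y | is_cond_exp G X Y].

Definition cond_expv (n : nat) (G : set (set T)) (X : T -> 'cV[R]_n) :
    T -> 'cV[R]_n :=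
  fun o => \col_i cond_exp G (fun o' => X o' i 0) o.

Variable w : nat -> T -> R.

(* F_{k-1}, the sigma-algebra generated by w_0, ..., w_{k-1}; it is trivial for
   k = 0. The initial state x_0, which is F_{-1}-measurable hence constant,
   contributes nothing to it. *)
Definition past (k : nat) : set (set T) :=
  g_sigma_preimage (fun i : 'I_k => w i).

Definition past_measurable (m n : nat) (k : nat) (g : T -> 'M[R]_(m, n)) :
    Prop :=
  forall i j, measurable_fun [set: g_sigma_algebraType (past k)]
    (fun o => g o i j).

Definition normalized_martingale_difference : Prop :=
  forall k, [/\ measurable_fun setT (w k),
    is_cond_exp (past k) (w k) (cst 0) &
    is_cond_exp (past k) (fun o => w k o ^+ 2) (cst 1)].

Definition rho_norm2 (rho : R) (n : nat) (g : nat -> T -> 'cV[R]_n) : \bar R :=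
  (\int[P]_o \sum_(0 <= k <oo) (expR (- (rho * k%:R)) * enorm (g k o) ^+ 2)%:E)%E.

Definition L2rho (rho : R) (n : nat) (g : nat -> T -> 'cV[R]_n) : Prop :=
  (forall k, past_measurable k (g k)) /\ (rho_norm2 rho g < +oo)%E.

Definition Linf_bounded (m n : nat) (h : nat -> T -> 'M[R]_(m, n)) (c : R) :
    Prop :=
  forall k, past_measurable k (h k) /\ {ae P, forall o, enorm (h k o) <= c}.

End Probability.

(* [f_of Phi k.+1] is f(k+1, .), which is F_{k-1}-measurable; [f_of Phi 0] is
   never used. The arguments after the time index are x, y', z' and the
   outcome. *)
Record coefficients (R : realType) (T : Type) (n : nat) := Coefficients {
  Lambda_of : 'cV[R]_n -> 'cV[R]_n ;
  f_of : nat -> 'cV[R]_n -> 'cV[R]_n -> 'cV[R]_n -> T -> 'cV[R]_n ;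
  b_of : nat -> 'cV[R]_n -> 'cV[R]_n -> 'cV[R]_n -> T -> 'cV[R]_n ;
  sigma_of : nat -> 'cV[R]_n -> 'cV[R]_n -> 'cV[R]_n -> T -> 'cV[R]_n }.

Record lipschitz_constants (R : realType) := LipschitzConstants {
  lip : R ; lip1 : R ; lip2 : R ; lip3 : R ;
  lip4 : R ; lip5 : R ; lip6 : R ; lip7 : R }.

Definition lipschitz_constants_pos (R : realType) (l : lipschitz_constants R) :
    Prop :=
  [/\ 0 < lip l, 0 < lip1 l, 0 < lip2 l & 0 < lip3 l] /\
  [/\ 0 < lip4 l, 0 < lip5 l, 0 < lip6 l & 0 < lip7 l].

Section Assumptions.
Context {d : measure_display} {T : measurableType d} {R : realType}.
Variables (P : probability T R) (w : nat -> T -> R).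
Variables (n : nat) (Phi : coefficients R T n).

Local Notation Lambda := (Lambda_of Phi).
Local Notation f := (f_of Phi).
Local Notation b := (b_of Phi).
Local Notation sigma := (sigma_of Phi).

Definition A1_measurable : Prop :=
  forall k x y' z',
    [/\ past_measurable w k (f k.+1 x y' z'),
        past_measurable w k (b k x y' z') &
        past_measurable w k (sigma k x y' z')].

Definition A1_integrable (rho : R) : Prop :=
  (\int[P]_o \sum_(0 <= k <oo)
     (expR (- (rho * k%:R)) *
       (enorm (f k.+1 0 0 0 o) ^+ 2 + enorm (b k 0 0 0 o) ^+ 2
        + enorm (sigma k 0 0 0 o) ^+ 2))%:E < +oo)%E.

Definition A1_lipschitz (l : lipschitz_constants R) : Prop :=
  (forall y yb, enorm (Lambda y - Lambda yb) <= lip l * enorm (y - yb)) /\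
  (forall k, {ae P, forall o, forall x y' z' xb yb' zb',
    [/\ enorm (b k x y' z' o - b k xb yb' zb' o) <=
          lip1 l * enorm (x - xb) + lip3 l * enorm (y' - yb')
          + lip4 l * enorm (z' - zb'),
        enorm (sigma k x y' z' o - sigma k xb yb' zb' o) <=
          lip1 l * enorm (x - xb) + lip5 l * enorm (y' - yb')
          + lip6 l * enorm (z' - zb') &
        enorm (f k.+1 x y' z' o - f k.+1 xb yb' zb' o) <=
          lip7 l * enorm (x - xb)
          + lip2 l * (enorm (y' - yb') + enorm (z' - zb'))]}).

Definition A1 (rho : R) (l : lipschitz_constants R) : Prop :=
  [/\ A1_measurable, A1_integrable rho, lipschitz_constants_pos l &
      A1_lipschitz l].

Variables (m : nat) (mu nu : R) (M : 'M[R]_(m, n)).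
Variables (A B C : nat -> T -> 'M[R]_(m, n)).

Definition A2_cases : Prop := (0 < mu /\ nu = 0) \/ (mu = 0 /\ 0 < nu).

Definition A2_domination : Prop :=
  [/\ 0 < mu -> forall y yb,
        enorm (Lambda y - Lambda yb) <= mu^-1 * enorm (M *m (y - yb)),
      0 < nu -> forall k, {ae P, forall o, forall x xb y' z',
        enorm (f k.+1 x y' z' o - f k.+1 xb y' z' o) <=
          nu^-1 * enorm (A k o *m (x - xb))} &
      0 < mu -> forall k, {ae P, forall o, forall x y' z' yb' zb',
        enorm (b k x y' z' o - b k x yb' zb' o) <=
          mu^-1 * enorm (B k o *m (y' - yb') + C k o *m (z' - zb')) /\
        enorm (sigma k x y' z' o - sigma k x yb' zb' o) <=
          mu^-1 * enorm (B k o *m (y' - yb') + C k o *m (z' - zb'))}].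

Definition A2_monotonicity (rho : R) : Prop :=
  (forall y yb,
    inner (Lambda y - Lambda yb) (y - yb) <=
      - (mu * enorm (M *m (y - yb)) ^+ 2)) /\
  (forall k, {ae P, forall o, forall x y' z' xb yb' zb',
    inner (f k.+1 x y' z' o - f k.+1 xb yb' zb' o) (x - xb)
    + expR (- rho) * inner (b k x y' z' o - b k xb yb' zb' o) (y' - yb')
    + expR (- rho) * inner (sigma k x y' z' o - sigma k xb yb' zb' o) (z' - zb')
    <= - (nu * enorm (A k o *m (x - xb)) ^+ 2)
       - mu * enorm (B k o *m (y' - yb') + C k o *m (z' - zb')) ^+ 2}).

(* [cA], [cB], [cC] are essential bounds of A, B, C, and [cM] is a bound
   of M. *)
Definition A2 (rho cA cB cC cM : R) : Prop :=
  [/\ A2_cases,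
      [/\ Linf_bounded P w A cA, Linf_bounded P w B cB, Linf_bounded P w C cC
        & enorm M <= cM],
      A2_domination & A2_monotonicity rho].

End Assumptions.

Section Equation.
Context {d : measure_display} {T : measurableType d} {R : realType}.
Variables (P : probability T R) (w : nat -> T -> R) (n : nat).

Definition y_pred (y : nat -> T -> 'cV[R]_n) (k : nat) : T -> 'cV[R]_n :=
  cond_expv P (past w k) (y k.+1).

Definition z_pred (y : nat -> T -> 'cV[R]_n) (k : nat) : T -> 'cV[R]_n :=
  cond_expv P (past w k) (fun o => w k o *: y k.+1 o).

Definition at_theta (g : 'cV[R]_n -> 'cV[R]_n -> 'cV[R]_n -> T -> 'cV[R]_n)
    (x y : nat -> T -> 'cV[R]_n) (k : nat) (o : T) : 'cV[R]_n :=
  g (x k o) (y_pred y k o) (z_pred y k o) o.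

Definition is_solution (rho : R) (Phi : coefficients R T n)
    (x y : nat -> T -> 'cV[R]_n) : Prop :=
  [/\ L2rho P w rho x, L2rho P w rho y,
      {ae P, forall o, x 0%N o = Lambda_of Phi (y 0%N o)} &
      forall k, {ae P, forall o,
        x k.+1 o = at_theta (b_of Phi k) x y k o
                   + w k o *: at_theta (sigma_of Phi k) x y k o /\
        y k o = - at_theta (f_of Phi k.+1) x y k o}].

(* E of the sum of the weighted squares of the data gb, gs, gf (attached to b,
   sigma, f respectively) and of |gL|^2. *)
Definition data_size (rho : R) (gb gs gf : nat -> T -> 'cV[R]_n)
    (gL : T -> 'cV[R]_n) : \bar R :=
  (\int[P]_o
    (\sum_(0 <= k <oo) (expR (- (rho * k%:R)) * enorm (gb k o) ^+ 2)%:E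
     + \sum_(0 <= k <oo) (expR (- (rho * k%:R)) * enorm (gs k o) ^+ 2)%:E
     + \sum_(0 <= k <oo) (expR (- (rho * k.+1%:R)) * enorm (gf k o) ^+ 2)%:E
     + (enorm (gL o) ^+ 2)%:E))%E.

Definition data_size0 (rho : R) (Phi : coefficients R T n) : \bar R :=
  data_size rho (fun k => b_of Phi k 0 0 0) (fun k => sigma_of Phi k 0 0 0)
    (fun k => f_of Phi k.+1 0 0 0) (fun=> Lambda_of Phi 0).

Definition data_gap (rho : R) (Phi Phib : coefficients R T n)
    (xb yb : nat -> T -> 'cV[R]_n) : \bar R :=
  data_size rho
    (fun k o => at_theta (b_of Phi k) xb yb k o
                - at_theta (b_of Phib k) xb yb k o)
    (fun k o => at_theta (sigma_of Phi k) xb yb k o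
                - at_theta (sigma_of Phib k) xb yb k o)
    (fun k o => at_theta (f_of Phi k.+1) xb yb k o
                - at_theta (f_of Phib k.+1) xb yb k o)
    (fun o => Lambda_of Phi (yb 0%N o) - Lambda_of Phib (yb 0%N o)).

End Equation.

(* Main.v *)
From HB Require Import structures.
From mathcomp Require Import finmap.
Require Import Defs.
From mathcomp Require Import measurable_realfun ring lra.

Set Implicit Arguments.
Unset Strict Implicit.
Unset Printing Implicit Defensive.

(** The system is an equation in one Hilbert space, the space of adapted
    processes with the weighted inner product
    [<g, h> = sum_k e^(-rho k) E (g_k . h_k)], in which both unknowns live.

    Given processes [x] and [y], let [F x y] be the process
    [f (k+1, theta_k)], and let [G x y] be the process that starts from
    [Lambda (y_0)] and continues with [b (k, theta_k) + sigma (k, theta_k) w_k].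
    A solution is a pair with [x = G x y] and [y = - F x y], that is, a common
    zero of the two residuals [x - G x y] and [y + F x y]. Three facts hold.

    - Since the noise is centred and normalized given the past, the forward map
      is isometric up to the weight, while the predictors [y'] and [z'] of [y]
      are coefficients of an orthogonal projection and satisfy a Bessel
      inequality. The two bounds on [rho] therefore make [G] a contraction in
      [x] and [F] a contraction in [y], both with squared ratio [1/2].
    - The forward map is adjoint to prediction ([forward_pairing]): pairing it
      with [y] pairs [Lambda] with [y_0], [b] with [y'] and [sigma] with [z'].
      Summing the monotonicity condition thus bounds
      [<dF, dx> + <dG, dy>] from above by zero, where [d] stands for the
      difference between two pairs.
    - By the domination condition, the term subtracted in the monotonicity
      condition is at least a multiple of [|G x yb - G x y|^2] in the first case
      and of [|F xb y - F x y|^2] in the second ([system_monotone]).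

    Writing [r1] and [r2] for the residuals, consider the map
    [Psi = (e1 r1 - r2, r1 + e2 r2)]. Pairing its increment with [(dx, dy)], the
    terms without a weight add up to [- <dF, dx> - <dG, dy>], which is
    nonnegative and controls the increment of [G] in [y] (or of [F] in [x]). In
    [<r1, dx>] and [<r2, dy>] the contraction property leaves a multiple of
    [|dx|^2] and [|dy|^2], up to the increments of [G] in [y] and of [F] in [x].
    The controlled increment is absorbed by the extra term; the other one is at
    most [L |dx|^2] (or [L |dy|^2]), and is absorbed when its weight is small
    enough. So [Psi] is strongly monotone and Lipschitz
    ([weighted_strong_monotonicity]), and the Richardson iteration
    [z - t Psi z] converges to a zero of [Psi], hence of both residuals
    ([monotone_pair_solution]). Strong monotonicity also bounds the distance
    between two pairs by their residuals ([monotone_pair_stability]), which gives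
    uniqueness, and both estimates: at the origin, and at a solution of another
    system, the residuals are exactly the data in the right-hand sides.

    The constants do not depend on [rho], because the two bounds on [rho] confine
    [e^rho] to an interval given by [L1] and [L2]. *)

(** * Subspaces with an inner product *)

Lemma subrBACA (V : zmodType) (a b c d : V) : (a - b) - (c - d) = (a - c) - (b - d).
Proof. by rewrite !opprB addrACA [RHS]addrACA; congr (_ + _); exact: addrC. Qed.

(** Processes are functions on the sample space, on which an inner product is
    only positive semidefinite and only defined on a subset [H]; hence the
    relativized axioms, and limits that are not unique. Completeness is asked for
    geometrically Cauchy sequences because such sequences of random variables
    converge almost surely as a whole, without passing to a subsequence. *)
Record hilbert_form (R : realType) (V : lmodType R) (H : V -> Prop)
    (ip : V -> V -> R) : Prop := HilbertForm {
  hilbert_mem0 : H 0 ;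
  hilbert_memP : forall a u v, H u -> H v -> H (a *: u + v) ;
  ip_sym : forall u v, H u -> H v -> ip u v = ip v u ;
  ip_linear : forall a u v t, H u -> H v -> H t ->
    ip (a *: u + v) t = a * ip u t + ip v t ;
  ip_ge0 : forall u, H u -> 0 <= ip u u ;
  hilbert_complete : forall (u_ : nat -> V) (C r : R), 0 <= r < 1 ->
    (forall j, H (u_ j)) ->
    (forall j m, (j <= m)%N ->
       ip (u_ j - u_ m) (u_ j - u_ m) <= C * r ^+ j) ->
    exists2 v, H v &
      exists C', forall j, ip (u_ j - v) (u_ j - v) <= C' * r ^+ j }.

Section HilbertForm.
Context {R : realType} {V : lmodType R} {H : V -> Prop} {ip : V -> V -> R}.
Hypothesis hH : hilbert_form H ip.
Local Notation N u := (ip u u).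

Lemma hilbert_memD u v : H u -> H v -> H (u + v).
Proof. by move=> Hu Hv; rewrite -[u]scale1r; exact: hilbert_memP hH _ _ _ Hu Hv. Qed.

Lemma hilbert_memZ a u : H u -> H (a *: u).
Proof.
by move=> Hu; rewrite -[_ *: _]addr0; apply: (hilbert_memP hH) => //; exact: (hilbert_mem0 hH).
Qed.

Lemma hilbert_memN u : H u -> H (- u).
Proof. by move=> Hu; rewrite -scaleN1r; exact: hilbert_memZ. Qed.

Lemma hilbert_memB u v : H u -> H v -> H (u - v).
Proof. by move=> Hu Hv; apply: hilbert_memD => //; exact: hilbert_memN. Qed.

Lemma ipDl u v t : H u -> H v -> H t -> ip (u + v) t = ip u t + ip v t.
Proof.
by move=> Hu Hv Ht; rewrite -{1}[u]scale1r (ip_linear hH) // mul1r.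
Qed.

Lemma ipZl a u t : H u -> H t -> ip (a *: u) t = a * ip u t.
Proof.
move=> Hu Ht; have H0 := hilbert_mem0 hH.
have ip0 : ip 0 t = 0.
  have := ipDl H0 H0 Ht; rewrite addr0 => h; lra.
by rewrite -[_ *: _]addr0 (ip_linear hH) // ip0 addr0.
Qed.

Lemma ipNl u t : H u -> H t -> ip (- u) t = - ip u t.
Proof. by move=> Hu Ht; rewrite -scaleN1r ipZl // mulN1r. Qed.

Lemma ipBl u v t : H u -> H v -> H t -> ip (u - v) t = ip u t - ip v t.
Proof. by move=> Hu Hv Ht; rewrite ipDl ?ipNl //; exact: hilbert_memN. Qed.

Lemma ipBr u v t : H u -> H v -> H t -> ip t (u - v) = ip t u - ip t v.
Proof.
move=> Hu Hv Ht; rewrite (ip_sym hH) ?ipBl ?(ip_sym hH Ht) //.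
exact: hilbert_memB.
Qed.

Lemma ipZr a u t : H u -> H t -> ip t (a *: u) = a * ip t u.
Proof.
move=> Hu Ht; rewrite (ip_sym hH) ?ipZl ?(ip_sym hH Ht) //.
exact: hilbert_memZ.
Qed.

Lemma ipDr u v t : H u -> H v -> H t -> ip t (u + v) = ip t u + ip t v.
Proof.
move=> Hu Hv Ht; rewrite (ip_sym hH) ?ipDl ?(ip_sym hH Ht) //.
exact: hilbert_memD.
Qed.

Lemma normD_expand u v : H u -> H v -> N (u + v) = N u + 2 * ip u v + N v.
Proof.
move=> Hu Hv; rewrite ipDl ?ipDr //; last exact: hilbert_memD.
by rewrite (ip_sym hH Hv Hu); ring.
Qed.

Lemma normB_expand u v : H u -> H v -> N (u - v) = N u - 2 * ip u v + N v.
Proof.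
move=> Hu Hv; rewrite ipBl ?ipBr //; last exact: hilbert_memB.
by rewrite (ip_sym hH Hv Hu); ring.
Qed.

Lemma normZ a u : H u -> N (a *: u) = a ^+ 2 * N u.
Proof. by move=> Hu; rewrite ipZl ?ipZr //; [ring|exact: hilbert_memZ]. Qed.

Lemma normN u : H u -> N (- u) = N u.
Proof. by move=> Hu; rewrite -scaleN1r normZ // sqrrN expr1n mul1r. Qed.

Lemma ip_young s u v : 0 < s -> H u -> H v ->
  2 * ip u v <= s * N u + s^-1 * N v.
Proof.
move=> s0 Hu Hv.
have := ip_ge0 hH (hilbert_memB (hilbert_memZ s Hu) Hv).
rewrite normB_expand ?normZ ?ipZl //; last exact: hilbert_memZ.
move=> h; rewrite -(ler_pM2l s0) mulrDr !mulrA divff ?gt_eqF //.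
by lra.
Qed.

Lemma normD_young s u v : 0 < s -> H u -> H v ->
  N (u + v) <= (1 + s) * N u + (1 + s^-1) * N v.
Proof.
by move=> s0 Hu Hv; rewrite normD_expand //; have := ip_young s0 Hu Hv; lra.
Qed.

Lemma normD_le2 u v : H u -> H v -> N (u + v) <= 2 * N u + 2 * N v.
Proof. by move=> Hu Hv; have := normD_young ltr01 Hu Hv; rewrite invr1; lra. Qed.

Lemma normB_le2 u v : H u -> H v -> N (u - v) <= 2 * N u + 2 * N v.
Proof.
move=> Hu Hv; have := normD_le2 Hu (hilbert_memN Hv).
by rewrite (normN Hv).
Qed.

Lemma norm_subC u v : H u -> H v -> N (u - v) = N (v - u).
Proof. by move=> Hu Hv; rewrite -(normN (hilbert_memB Hu Hv)) opprB. Qed.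

(** Telescoping a geometric bound without square roots: Young's inequality
    with weight [s] costs a factor [1 + s] at each step, which is affordable as
    long as [(1 + s) r < 1]; [s = (1 - r) / 2] will do. *)
Lemma geometric_cauchy (u_ : nat -> V) (C r : R) : 0 <= r < 1 -> 0 <= C ->
  (forall j, H (u_ j)) ->
  (forall j, N (u_ j.+1 - u_ j) <= C * r ^+ j) ->
  exists C', forall j m, (j <= m)%N -> N (u_ j - u_ m) <= C' * r ^+ j.
Proof.
move=> /andP[r0 r1] C0 Hu hd.
pose s := (1 - r) / 2; pose K := (1 + s^-1) / s.
have s0 : 0 < s by rewrite /s; lra.
have K0 : 0 <= K by rewrite /K divr_ge0 ?addr_ge0 ?invr_ge0 // ltW.
exists (C * K) => j m /subnKC <-; move: (m - j)%N => k {m}.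
elim: k j => [|k IH] j.
  rewrite addn0 subrr; have := ipZl 0 (hilbert_mem0 hH) (hilbert_mem0 hH).
  rewrite scale0r mul0r => ->; apply: mulr_ge0; last exact: exprn_ge0.
  exact: mulr_ge0.
have -> : u_ j - u_ (j + k.+1)%N
    = (u_ j.+1 - u_ (j.+1 + k)%N) + (u_ j - u_ j.+1).
  by rewrite addSnnS [RHS]addrC subrKA.
apply: le_trans (normD_young s0 _ _) _; [exact: hilbert_memB..|].
rewrite (norm_subC (Hu j)) //.
have h1 := IH j.+1; have h2 := hd j; rewrite exprS in h1.
have rj0 : 0 <= C * r ^+ j by rewrite mulr_ge0 ?exprn_ge0.
have Ks : K * s = 1 + s^-1 by rewrite /K divfK ?gt_eqF.
have sV : 0 < s^-1 by rewrite invr_gt0.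
apply: (@le_trans _ _ ((1 + s) * (C * K * (r * r ^+ j)) + K * s * (C * r ^+ j))).
  by rewrite Ks; apply: lerD; apply: ler_wpM2l => //; lra.
have -> : (1 + s) * (C * K * (r * r ^+ j)) + K * s * (C * r ^+ j)
   = (C * r ^+ j) * K * ((1 + s) * r + s) by ring.
have -> : C * K * r ^+ j = (C * r ^+ j) * K * 1 by ring.
apply: ler_wpM2l; first exact: mulr_ge0.
by rewrite /s; nra.
Qed.

(** Richardson iteration: for small [t], [z - t Psi z] contracts, because
    expanding the square gives [N (z - t Psi z) <= (1 - 2 t kappa + t^2 B) N z]
    on differences; [t = kappa / B'] with [B' >= B] makes the factor
    [1 - kappa^2 / B'] or less, and the summand [kappa^2] in [B'] keeps it nonnegative. *)
Lemma strongly_monotone_zero (Psi : V -> V) (kappa B : R) : 0 < kappa -> 0 <= B ->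
  (forall u, H u -> H (Psi u)) ->
  (forall u v, H u -> H v -> N (Psi u - Psi v) <= B * N (u - v)) ->
  (forall u v, H u -> H v ->
     kappa * N (u - v) <= ip (Psi u - Psi v) (u - v)) ->
  exists2 z, H z & N (Psi z) = 0.
Proof.
move=> k0 B0 HPsi lipPsi monPsi.
pose B' := B + kappa ^+ 2; have kk0 : 0 < kappa ^+ 2 by rewrite exprn_gt0.
have B'0 : 0 < B' by rewrite /B'; lra.
pose t := kappa / B'; have t0 : 0 < t by rewrite /t divr_gt0.
have tB : t * B' = kappa by rewrite /t divfK ?gt_eqF.
pose r := 1 - t * kappa.
have tk : 0 < t * kappa <= 1.
  rewrite mulr_gt0 //= /t mulrAC -expr2 ler_pdivrMr // mul1r /B'; lra.
have r01 : 0 <= r < 1 by rewrite /r; lra.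
pose z_ := fix z_ j := if j is j'.+1 then z_ j' - t *: Psi (z_ j') else 0.
have Hz j : H (z_ j).
  elim: j => [|j IH] /=; first exact: (hilbert_mem0 hH).
  by apply: hilbert_memB => //; apply: hilbert_memZ; exact: HPsi.
have step u v : H u -> H v ->
    N ((u - t *: Psi u) - (v - t *: Psi v)) <= r * N (u - v).
  move=> Hu Hv.
  have HP := hilbert_memB (HPsi _ Hu) (HPsi _ Hv); have Huv := hilbert_memB Hu Hv.
  have -> : (u - t *: Psi u) - (v - t *: Psi v) = (u - v) - t *: (Psi u - Psi v).
    by rewrite scalerBr subrBACA.
  rewrite normB_expand ?normZ ?ipZr //; last exact: hilbert_memZ.
  rewrite (ip_sym hH Huv HP).
  have h1 := lipPsi _ _ Hu Hv; have h2 := monPsi _ _ Hu Hv.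
  have n0 := ip_ge0 hH Huv.
  have h3 : t ^+ 2 * N (Psi u - Psi v) <= t * kappa * N (u - v).
    have -> : t * kappa * N (u - v) = t ^+ 2 * (B' * N (u - v)) by rewrite -tB; ring.
    apply: ler_wpM2l; first exact: sqr_ge0.
    apply: (le_trans h1); apply: ler_wpM2r => //; rewrite /B'; lra.
  have h4 : t * (kappa * N (u - v)) <= t * ip (Psi u - Psi v) (u - v).
    by apply: ler_wpM2l => //; exact: ltW.
  rewrite /r; lra.
have hd j : N (z_ j.+1 - z_ j) <= N (z_ 1%N - z_ 0%N) * r ^+ j.
  elim: j => [|j IH]; first by rewrite expr0 mulr1.
  apply: (le_trans (step _ _ (Hz j.+1) (Hz j))).
  rewrite exprS mulrCA; apply: ler_wpM2l => //; by case/andP: r01.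
have c0 : 0 <= N (z_ 1%N - z_ 0%N) by apply: (ip_ge0 hH); exact: hilbert_memB.
have [C' hC'] := geometric_cauchy r01 c0 Hz hd.
have [z HZ [C'' hz]] := hilbert_complete hH r01 Hz hC'.
exists z => //; have HPz := HPsi _ HZ.
apply/eqP; rewrite eq_le (ip_ge0 hH HPz) andbT.
set D := 2 * B * C'' + 2 * t ^- 2 * N (z_ 1%N - z_ 0%N).
suff bnd j : N (Psi z) <= D * r ^+ j.
  have lim0 : (fun j => D * r ^+ j) @ \oo --> D * (0 : R).
    apply: cvgM; first exact: cvg_cst.
    by apply: cvg_expr; case/andP: r01 => r0 r1; rewrite ger0_norm.
  rewrite mulr0 in lim0; rewrite -(cvg_lim _ lim0) //.
  by apply: limr_ge; [apply/cvg_ex; exists 0|apply: nearW].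
have Hj := Hz j; have HPj := HPsi _ Hj.
have -> : Psi z = Psi (z_ j) - (Psi (z_ j) - Psi z) by rewrite opprB addrC subrK.
apply: le_trans (normB_le2 HPj (hilbert_memB HPj HPz)) _.
have h1 := lipPsi _ _ Hj HZ; have h2 := hz j; have h3 := hd j.
have e : N (z_ j.+1 - z_ j) = t ^+ 2 * N (Psi (z_ j)).
  by rewrite /= addrAC subrr add0r normN ?normZ //; exact: hilbert_memZ.
rewrite e in h3.
have h4 : N (Psi (z_ j)) <= t ^- 2 * (N (z_ 1%N - z_ 0%N) * r ^+ j).
  by rewrite ler_pdivlMl // exprn_gt0.
have h5 : B * N (z_ j - z) <= B * (C'' * r ^+ j) by apply: ler_wpM2l.
rewrite /D; lra.
Qed.
End HilbertForm.

(** * Monotone pairs *)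

Lemma hilbert_form_prod (R : realType) (V : lmodType R) (H : V -> Prop)
    (ip : V -> V -> R) : hilbert_form H ip ->
  hilbert_form (fun z : V * V => H z.1 /\ H z.2)
    (fun z z' => ip z.1 z'.1 + ip z.2 z'.2).
Proof.
move=> hH; split.
- by split; exact: (hilbert_mem0 hH).
- by move=> a u v [Hu1 Hu2] [Hv1 Hv2]; split; exact: (hilbert_memP hH).
- by move=> u v [Hu1 Hu2] [Hv1 Hv2]; congr (_ + _); exact: (ip_sym hH).
- move=> a u v t [Hu1 Hu2] [Hv1 Hv2] [Ht1 Ht2].
  by rewrite !(ip_linear hH) //; ring.
- by move=> u [Hu1 Hu2]; apply: addr_ge0; exact: (ip_ge0 hH).
- move=> u_ C r r01 Hu hC.
  have H1 j : H (u_ j).1 by case: (Hu j).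
  have H2 j : H (u_ j).2 by case: (Hu j).
  have ge0 u v : H u -> H v -> 0 <= ip (u - v) (u - v).
    by move=> hu hv; apply: (ip_ge0 hH); exact: (hilbert_memB hH).
  have [|v1 Hv1 [C1 h1]] := hilbert_complete hH (u_ := fun j => (u_ j).1) (C := C) r01 H1.
    by move=> j m jm; apply: le_trans (hC _ _ jm); rewrite lerDl; exact: ge0.
  have [|v2 Hv2 [C2 h2]] := hilbert_complete hH (u_ := fun j => (u_ j).2) (C := C) r01 H2.
    by move=> j m jm; apply: le_trans (hC _ _ jm); rewrite lerDr; exact: ge0.
  exists (v1, v2) => //; exists (C1 + C2) => j; rewrite mulrDl.
  by apply: lerD; [exact: h1|exact: h2].
Qed.

Section MonotonePair.
Context {R : realType} {V : lmodType R} {H : V -> Prop} {ip : V -> V -> R}.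
Hypothesis hH : hilbert_form H ip.
Local Notation N u := (ip u u).
Variables (c L : R) (G F : V -> V -> V).
Hypotheses (c0 : 0 < c) (L0 : 0 <= L).

(** The unknowns solve [x = G x y] and [y = - F x y]. The alternative in the
    monotonicity axiom reflects the two cases of the domination condition: the
    inequality controls the increments either of [G] in [y] or of [F] in [x]. *)
Record monotone_pair : Prop := MonotonePair {
  pair_memG : forall x y, H x -> H y -> H (G x y) ;
  pair_memF : forall x y, H x -> H y -> H (F x y) ;
  pair_contrG : forall x xb y, H x -> H xb -> H y ->
    N (G x y - G xb y) <= 2^-1 * N (x - xb) ;
  pair_contrF : forall x y yb, H x -> H y -> H yb ->
    N (F x y - F x yb) <= 2^-1 * N (y - yb) ;
  pair_lipG : forall x y yb, H x -> H y -> H yb ->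
    N (G x y - G x yb) <= L * N (y - yb) ;
  pair_lipF : forall x xb y, H x -> H xb -> H y ->
    N (F x y - F xb y) <= L * N (x - xb) ;
  pair_monotone :
    (forall x y xb yb, H x -> H y -> H xb -> H yb ->
      ip (F x y - F xb yb) (x - xb) + ip (G x y - G xb yb) (y - yb)
        <= - (c * N (G x yb - G x y))) \/
    (forall x y xb yb, H x -> H y -> H xb -> H yb ->
      ip (F x y - F xb yb) (x - xb) + ip (G x y - G xb yb) (y - yb)
        <= - (c * N (F xb y - F x y))) }.

Hypothesis hGF : monotone_pair.

(** The weights of the two residuals: the big one goes to the residual whose
    error term is controlled by monotonicity, which leaves room for [2 * (c / 2)]
    times the error; the small one goes to the residual whose error term is
    only Lipschitz. *)
Definition big_weight : R := c / 2.
Definition small_weight : R := big_weight / (32 * (L + 1)).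
Definition monotone_modulus : R := small_weight / 8.
Definition stability_constant : R :=
  4 * (big_weight ^+ 2 + 1) / monotone_modulus ^+ 2.

Lemma big_weight_gt0 : 0 < big_weight.
Proof. by rewrite divr_gt0. Qed.

Lemma small_weight_gt0 : 0 < small_weight.
Proof. by rewrite divr_gt0 ?big_weight_gt0 // mulr_gt0 // ltr_wpDl. Qed.

Lemma small_weightE : small_weight * (32 * (L + 1)) = big_weight.
Proof. by rewrite divfK // gt_eqF // mulr_gt0 // ltr_wpDl. Qed.

Lemma small_weight_le : small_weight <= big_weight.
Proof.
have s0 := ltW small_weight_gt0; rewrite -small_weightE.
have L1 : 1 <= 32 * (L + 1) by have := L0; lra.
by rewrite ler_peMr.
Qed.

Lemma monotone_modulus_gt0 : 0 < monotone_modulus.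
Proof. by rewrite divr_gt0 ?small_weight_gt0. Qed.

Lemma stability_constant_gt0 : 0 < stability_constant.
Proof.
rewrite divr_gt0 ?exprn_gt0 ?monotone_modulus_gt0 // mulr_gt0 //.
by rewrite ltr_wpDl ?sqr_ge0.
Qed.

(** Young's inequality with weight [1] on [s] costs [3/4] of [N v], and with weight
    [4] on [s'] another [1/8]. *)
Lemma self_pairing_lower (s s' : V) (v : V) (D : R) : H v -> H s -> H s' ->
  N s <= 2^-1 * N v -> N s' <= D ->
  8^-1 * N v - 2 * D <= ip (v - (s + s')) v.
Proof.
move=> Hv Hs Hs' h h'.
rewrite (ipBl hH) ?(ipDl hH) //; last exact: (hilbert_memD hH).
have h1 := ip_young hH ltr01 Hs Hv; rewrite invr1 in h1.
have h2 := ip_young hH (ltr0Sn R 3) Hs' Hv; lra.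
Qed.

Definition residual1 (x y : V) : V := x - G x y.
Definition residual2 (x y : V) : V := y + F x y.

Lemma residual1_mem x y : H x -> H y -> H (residual1 x y).
Proof. by move=> Hx Hy; apply: (hilbert_memB hH) => //; exact: pair_memG. Qed.

Lemma residual2_mem x y : H x -> H y -> H (residual2 x y).
Proof. by move=> Hx Hy; apply: (hilbert_memD hH) => //; exact: pair_memF. Qed.

Section Differences.
Variables (x y xb yb : V).
Hypotheses (Hx : H x) (Hy : H y) (Hxb : H xb) (Hyb : H yb).
Local Notation r1 := (residual1 x y - residual1 xb yb).
Local Notation r2 := (residual2 x y - residual2 xb yb).
Local Notation dG := (G x y - G xb yb).
Local Notation dF := (F x y - F xb yb).

Let HG := pair_memG hGF.
Let HF := pair_memF hGF.
Let Hdx : H (x - xb). Proof. exact: (hilbert_memB hH). Qed.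
Let Hdy : H (y - yb). Proof. exact: (hilbert_memB hH). Qed.
Let HdG : H dG. Proof. by apply: (hilbert_memB hH); exact: HG. Qed.
Let HdF : H dF. Proof. by apply: (hilbert_memB hH); exact: HF. Qed.

Lemma residual1E : r1 = (x - xb) - dG.
Proof. exact: subrBACA. Qed.

Lemma residual2E : r2 = (y - yb) + dF.
Proof. by rewrite /residual2 opprD addrACA. Qed.

Lemma residual1_pairing D : N (G x yb - G x y) <= D ->
  8^-1 * N (x - xb) - 2 * D <= ip r1 (x - xb).
Proof.
move=> hD; have -> : r1 = (x - xb) - ((G x yb - G xb yb) + (G x y - G x yb)).
  by rewrite residual1E addrC [X in _ = X]addrC; congr (- _ + _); rewrite [RHS]addrC subrKA.
have ? := HG Hx Hy; have ? := HG Hx Hyb; have ? := HG Hxb Hyb.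
apply: self_pairing_lower => //; try exact: (hilbert_memB hH).
- exact: pair_contrG.
- by rewrite (norm_subC hH).
Qed.

Lemma residual2_pairing D : N (F xb y - F x y) <= D ->
  8^-1 * N (y - yb) - 2 * D <= ip r2 (y - yb).
Proof.
move=> hD; have -> : r2 = (y - yb) - ((F xb yb - F xb y) + (F xb y - F x y)).
  by rewrite residual2E subrKA opprB.
have ? := HF Hx Hy; have ? := HF Hxb Hy; have ? := HF Hxb Hyb.
apply: self_pairing_lower => //; try exact: (hilbert_memB hH).
by rewrite (norm_subC hH) //; exact: pair_contrF.
Qed.

(** The pairings of [x - xb] with [y - yb] cancel by symmetry, so that the cross terms
    reduce to the quantity controlled by monotonicity. *)
Lemma residual_cross :
  ip r1 (y - yb) - ip r2 (x - xb) = - (ip dF (x - xb) + ip dG (y - yb)).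
Proof.
rewrite residual1E residual2E (ipBl hH Hdx HdG Hdy) (ipDl hH Hdy HdF Hdx).
by rewrite (ip_sym hH Hdx Hdy); ring.
Qed.

Lemma residual1_lip : N r1 <= (4 + 4 * L) * (N (x - xb) + N (y - yb)).
Proof.
have gx := ip_ge0 hH Hdx; have gy := ip_ge0 hH Hdy.
have h := normB_le2 hH Hdx HdG; rewrite -residual1E in h.
have ? := HG Hx Hy; have ? := HG Hx Hyb; have ? := HG Hxb Hyb.
have := normD_le2 hH (u := G x yb - G xb yb) (v := G x y - G x yb).
rewrite [X in N X]addrC subrKA => /(_ _ _) h'.
have {}h' := h' (hilbert_memB hH _ _) (hilbert_memB hH _ _).
have {}h' : N dG <= 2 * N (G x yb - G xb yb) + 2 * N (G x y - G x yb) by exact: h'.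
have h1 := pair_contrG hGF Hx Hxb Hyb; have h2 := pair_lipG hGF Hx Hy Hyb.
have : 0 <= L * N (x - xb) by exact: mulr_ge0.
lra.
Qed.

Lemma residual2_lip : N r2 <= (4 + 4 * L) * (N (x - xb) + N (y - yb)).
Proof.
have gx := ip_ge0 hH Hdx; have gy := ip_ge0 hH Hdy.
have h := normD_le2 hH Hdy HdF; rewrite -residual2E in h.
have ? := HF Hx Hy; have ? := HF Hxb Hy; have ? := HF Hxb Hyb.
have := normD_le2 hH (u := F x y - F xb y) (v := F xb y - F xb yb).
rewrite subrKA => h'.
have {}h' : N dF <= 2 * N (F x y - F xb y) + 2 * N (F xb y - F xb yb).
  by apply: h'; exact: (hilbert_memB hH).
have h1 := pair_contrF hGF Hxb Hy Hyb; have h2 := pair_lipF hGF Hx Hxb Hy.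
have : 0 <= L * N (y - yb) by exact: mulr_ge0.
lra.
Qed.
End Differences.

(** The error of the residual with the big weight is absorbed by the monotonicity
    term, and that of the other one, at most [2 L] times the square already
    gained by the first, by the ratio of the weights. Which residual gets which
    weight depends on the alternative, hence the existential. *)
Lemma weighted_strong_monotonicity :
  exists2 e : R * R, 0 < e.1 <= big_weight /\ 0 < e.2 <= big_weight &
  forall x y xb yb, H x -> H y -> H xb -> H yb ->
    monotone_modulus * (N (x - xb) + N (y - yb)) <=
    ip (e.1 *: (residual1 x y - residual1 xb yb)
        - (residual2 x y - residual2 xb yb)) (x - xb)
    + ip ((residual1 x y - residual1 xb yb)
          + e.2 *: (residual2 x y - residual2 xb yb)) (y - yb).
Proof.
have s0 := small_weight_gt0; have sb := small_weight_le; have b0 := big_weight_gt0.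
have sE := small_weightE; have bc : big_weight * 2 = c by rewrite /big_weight divfK.
rewrite /monotone_modulus; move: big_weight small_weight s0 sb b0 sE bc => b s s0 sb b0 sE bc.
have expand e x y xb yb : H x -> H y -> H xb -> H yb ->
    ip (e.1 *: (residual1 x y - residual1 xb yb)
        - (residual2 x y - residual2 xb yb)) (x - xb)
    + ip ((residual1 x y - residual1 xb yb)
          + e.2 *: (residual2 x y - residual2 xb yb)) (y - yb)
    = e.1 * ip (residual1 x y - residual1 xb yb) (x - xb)
      + e.2 * ip (residual2 x y - residual2 xb yb) (y - yb)
      - (ip (F x y - F xb yb) (x - xb) + ip (G x y - G xb yb) (y - yb)).
  move=> Hx Hy Hxb Hyb.
  have Hr1 := hilbert_memB hH (residual1_mem Hx Hy) (residual1_mem Hxb Hyb).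
  have Hr2 := hilbert_memB hH (residual2_mem Hx Hy) (residual2_mem Hxb Hyb).
  have Hdx := hilbert_memB hH Hx Hxb; have Hdy := hilbert_memB hH Hy Hyb.
  rewrite (ipBl hH (hilbert_memZ hH e.1 Hr1) Hr2 Hdx).
  rewrite (ipDl hH Hr1 (hilbert_memZ hH e.2 Hr2) Hdy) !(ipZl hH) //.
  by have := residual_cross Hx Hy Hxb Hyb; lra.
case: (pair_monotone hGF) => mono.
- exists (b, s) => /=; first by split; rewrite ?lexx ?b0 ?s0.
  move=> x y xb yb Hx Hy Hxb Hyb; rewrite (expand (_, _)) //=.
  have h := mono _ _ _ _ Hx Hy Hxb Hyb.
  have h1 := residual1_pairing Hx Hy Hxb Hyb (lexx _).
  have h2 := residual2_pairing Hx Hy Hxb Hyb (le_trans (pair_lipF hGF Hxb Hx Hy) (lexx _)).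
  rewrite (norm_subC hH Hxb Hx) in h2.
  set Nx := N (x - xb) in h1 h2 *; set Ny := N (y - yb) in h2 *.
  set D := N (G x yb - G x y) in h h1.
  have gx : 0 <= Nx by apply: (ip_ge0 hH); exact: (hilbert_memB hH).
  have gy : 0 <= Ny by apply: (ip_ge0 hH); exact: (hilbert_memB hH).
  have {}h1 := ler_wpM2l (ltW b0) h1; have {}h2 := ler_wpM2l (ltW s0) h2.
  have bcD : b * 2 * D = c * D by rewrite bc.
  have sNx : s * (32 * (L + 1)) * Nx = b * Nx by rewrite sE.
  have := mulr_ge0 (ltW s0) gx; have := mulr_ge0 (ltW s0) (mulr_ge0 L0 gx).
  lra.
- exists (s, b) => /=; first by split; rewrite ?lexx ?b0 ?s0.
  move=> x y xb yb Hx Hy Hxb Hyb; rewrite (expand (_, _)) //=.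
  have h := mono _ _ _ _ Hx Hy Hxb Hyb.
  have h2 := residual2_pairing Hx Hy Hxb Hyb (lexx _).
  have h1 := residual1_pairing Hx Hy Hxb Hyb (le_trans (pair_lipG hGF Hx Hyb Hy) (lexx _)).
  rewrite (norm_subC hH Hyb Hy) in h1.
  set Nx := N (x - xb) in h1 *; set Ny := N (y - yb) in h1 h2 *.
  set D := N (F xb y - F x y) in h h2.
  have gx : 0 <= Nx by apply: (ip_ge0 hH); exact: (hilbert_memB hH).
  have gy : 0 <= Ny by apply: (ip_ge0 hH); exact: (hilbert_memB hH).
  have {}h2 := ler_wpM2l (ltW b0) h2; have {}h1 := ler_wpM2l (ltW s0) h1.
  have bcD : b * 2 * D = c * D by rewrite bc.
  have sNy : s * (32 * (L + 1)) * Ny = b * Ny by rewrite sE.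
  have := mulr_ge0 (ltW s0) gy; have := mulr_ge0 (ltW s0) (mulr_ge0 L0 gy).
  lra.
Qed.

(** Strong monotonicity bounds the squared distance by a pairing with
    combinations of the residuals, and Young's inequality with weight
    [monotone_modulus^-1] absorbs half of it. *)
Theorem monotone_pair_stability x y xb yb : H x -> H y -> H xb -> H yb ->
  N (x - xb) + N (y - yb) <= stability_constant *
    (N (residual1 x y - residual1 xb yb) + N (residual2 x y - residual2 xb yb)).
Proof.
move=> Hx Hy Hxb Hyb.
have [[e1 e2] /= [/andP[e10 e1b] /andP[e20 e2b]] mono] := weighted_strong_monotonicity.
have {mono} := mono _ _ _ _ Hx Hy Hxb Hyb.
have Hr1 := hilbert_memB hH (residual1_mem Hx Hy) (residual1_mem Hxb Hyb).
have Hr2 := hilbert_memB hH (residual2_mem Hx Hy) (residual2_mem Hxb Hyb).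
set r1 := residual1 x y - _ in Hr1 *; set r2 := residual2 x y - _ in Hr2 *.
have Hdx := hilbert_memB hH Hx Hxb; have Hdy := hilbert_memB hH Hy Hyb.
have k0 := monotone_modulus_gt0; set k := monotone_modulus in k0 *.
have He1 := hilbert_memZ hH e1 Hr1; have He2 := hilbert_memZ hH e2 Hr2.
have kV : 0 < k^-1 by rewrite invr_gt0.
have h1 := ip_young hH kV (hilbert_memB hH He1 Hr2) Hdx.
have h2 := ip_young hH kV (hilbert_memD hH Hr1 He2) Hdy.
have h3 := normB_le2 hH He1 Hr2; have h4 := normD_le2 hH Hr1 He2.
rewrite (normZ hH) // in h3; rewrite (normZ hH) // in h4.
rewrite invrK in h1 h2 => h.
have g1 := ip_ge0 hH Hr1; have g2 := ip_ge0 hH Hr2.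
have q1 : e1 ^+ 2 * N r1 <= big_weight ^+ 2 * N r1.
  by apply: ler_wpM2r => //; rewrite lerXn2r // nnegrE ltW // big_weight_gt0.
have q2 : e2 ^+ 2 * N r2 <= big_weight ^+ 2 * N r2.
  by apply: ler_wpM2r => //; rewrite lerXn2r // nnegrE ltW // big_weight_gt0.
set S := N (x - xb) + N (y - yb) in h *.
have {}h : k * S <= k^-1 * (2 * (big_weight ^+ 2 + 1) * (N r1 + N r2) * 2 ).
  have h5 : k^-1 * (N (e1 *: r1 - r2) + N (r1 + e2 *: r2)) <=
      k^-1 * (2 * (big_weight ^+ 2 + 1) * (N r1 + N r2)).
    by apply: ler_wpM2l; [exact: ltW|lra].
  have : 0 <= k^-1 * (2 * (big_weight ^+ 2 + 1) * (N r1 + N r2)).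
    apply: mulr_ge0; first exact: ltW.
    by apply: mulr_ge0; [rewrite mulr_ge0 // addr_ge0 // sqr_ge0|exact: addr_ge0].
  rewrite /S in h *; lra.
rewrite -(ler_pM2l k0) (le_trans h) // le_eqVlt; apply/orP; left; apply/eqP.
by rewrite /stability_constant -/k; field; rewrite gt_eqF.
Qed.

(** A zero of the combination [(e1 r1 - r2, r1 + e2 r2)] is a zero of both
    residuals: adding [e2] times the first squared norm to [e1] times the second
    eliminates [<r1, r2>] and leaves positive multiples of [N r1] and [N r2]. *)
Theorem monotone_pair_solution :
  exists x y, [/\ H x, H y, N (residual1 x y) = 0 & N (residual2 x y) = 0].
Proof.
have [[e1 e2] /= [/andP[e10 e1b] /andP[e20 e2b]] mono] := weighted_strong_monotonicity.
pose Psi (z : V * V) := (e1 *: residual1 z.1 z.2 - residual2 z.1 z.2,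
                         residual1 z.1 z.2 + e2 *: residual2 z.1 z.2).
have hP := hilbert_form_prod hH.
have dPsi u v : Psi u - Psi v =
   (e1 *: (residual1 u.1 u.2 - residual1 v.1 v.2) - (residual2 u.1 u.2 - residual2 v.1 v.2),
    (residual1 u.1 u.2 - residual1 v.1 v.2) + e2 *: (residual2 u.1 u.2 - residual2 v.1 v.2)).
  rewrite /Psi; congr (_, _); rewrite /=.
    by rewrite (scalerBr e1 (residual1 u.1 u.2)) subrBACA.
  by rewrite (scalerBr e2 (residual2 u.1 u.2)) opprD addrACA.
have [|||||z [Hz1 Hz2] hz] := strongly_monotone_zero hP (Psi := Psi) (kappa := monotone_modulus)
    (B := 4 * (big_weight ^+ 2 + 1) * (8 + 8 * L)).
- exact: monotone_modulus_gt0.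
- by rewrite mulr_ge0 // ?mulr_ge0 // addr_ge0 // ?sqr_ge0 // mulr_ge0.
- move=> [x y] /= [Hx Hy]; have ? := residual1_mem Hx Hy; have ? := residual2_mem Hx Hy.
  by split; [apply: (hilbert_memB hH)|apply: (hilbert_memD hH)] => //; exact: (hilbert_memZ hH).
- move=> u v; rewrite dPsi; case: u v => [x y] [xb yb] /= [Hx Hy] [Hxb Hyb].
  have Hr1 := hilbert_memB hH (residual1_mem Hx Hy) (residual1_mem Hxb Hyb).
  have Hr2 := hilbert_memB hH (residual2_mem Hx Hy) (residual2_mem Hxb Hyb).
  have l1 := residual1_lip Hx Hy Hxb Hyb; have l2 := residual2_lip Hx Hy Hxb Hyb.
  set r1 := residual1 x y - _ in Hr1 l1 *; set r2 := residual2 x y - _ in Hr2 l2 *.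
  have He1 := hilbert_memZ hH e1 Hr1; have He2 := hilbert_memZ hH e2 Hr2.
  have h3 := normB_le2 hH He1 Hr2; have h4 := normD_le2 hH Hr1 He2.
  rewrite (normZ hH) // in h3; rewrite (normZ hH) // in h4.
  have g1 := ip_ge0 hH Hr1; have g2 := ip_ge0 hH Hr2.
  have q1 : e1 ^+ 2 * N r1 <= big_weight ^+ 2 * N r1.
    by apply: ler_wpM2r => //; rewrite lerXn2r // nnegrE ltW // big_weight_gt0.
  have q2 : e2 ^+ 2 * N r2 <= big_weight ^+ 2 * N r2.
    by apply: ler_wpM2r => //; rewrite lerXn2r // nnegrE ltW // big_weight_gt0.
  apply: (@le_trans _ _ (2 * (big_weight ^+ 2 + 1) * (N r1 + N r2))); first lra.
  have -> : 4 * (big_weight ^+ 2 + 1) * (8 + 8 * L) * (N (x - xb) + N (y - yb))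
     = 2 * (big_weight ^+ 2 + 1) * (2 * ((8 + 8 * L) * (N (x - xb) + N (y - yb)))) by ring.
  apply: ler_wpM2l; first by rewrite mulr_ge0 // addr_ge0 // sqr_ge0.
  have : 0 <= (4 + 4 * L) * (N (x - xb) + N (y - yb)) by exact: le_trans l1.
  lra.
- move=> u v; rewrite dPsi; case: u v => [x y] [xb yb] /= [Hx Hy] [Hxb Hyb]; exact: mono.
exists z.1, z.2; move: hz; rewrite /Psi /=.
have Hr1 := residual1_mem Hz1 Hz2; have Hr2 := residual2_mem Hz1 Hz2.
set r1 := residual1 _ _ in Hr1 *; set r2 := residual2 _ _ in Hr2 *.
have He1 := hilbert_memZ hH e1 Hr1; have He2 := hilbert_memZ hH e2 Hr2.
have ga := ip_ge0 hH (hilbert_memB hH He1 Hr2); have gb := ip_ge0 hH (hilbert_memD hH Hr1 He2).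
move=> /eqP; rewrite paddr_eq0 // => /andP[/eqP a0 /eqP b0'].
rewrite (normB_expand hH) // in a0; rewrite (normD_expand hH) // in b0'.
rewrite !(normZ hH) ?(ipZl hH) // in a0; rewrite !(normZ hH) ?(ipZr hH) // in b0'.
have g1 := ip_ge0 hH Hr1; have g2 := ip_ge0 hH Hr2.
have key : e2 * (e1 ^+ 2 * N r1 + N r2) + e1 * (N r1 + e2 ^+ 2 * N r2) = 0.
  have -> : e2 * (e1 ^+ 2 * N r1 + N r2) + e1 * (N r1 + e2 ^+ 2 * N r2)
     = e2 * (e1 ^+ 2 * N r1 - 2 * (e1 * ip r1 r2) + N r2)
       + e1 * (N r1 + 2 * (e2 * ip r1 r2) + e2 ^+ 2 * N r2) by ring.
  by rewrite a0 b0' !mulr0 addr0.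
have p1 : 0 <= e2 * (e1 ^+ 2 * N r1) := mulr_ge0 (ltW e20) (mulr_ge0 (sqr_ge0 _) g1).
have p2 : 0 <= e1 * (e2 ^+ 2 * N r2) := mulr_ge0 (ltW e10) (mulr_ge0 (sqr_ge0 _) g2).
have p3 : 0 <= e2 * N r2 := mulr_ge0 (ltW e20) g2.
have p4 : 0 <= e1 * N r1 := mulr_ge0 (ltW e10) g1.
split => //.
- have /eqP : e1 * N r1 = 0 by lra.
  by rewrite mulf_eq0 gt_eqF //= => /eqP.
- have /eqP : e2 * N r2 = 0 by lra.
  by rewrite mulf_eq0 gt_eqF //= => /eqP.
Qed.
End MonotonePair.

(** * Conditional expectations *)

Section ConditionalExpectation.
Local Open Scope charge_scope.
Import HBNNSimple.
Context {d : measure_display} {T : measurableType d} {R : realType}.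
Variables (P : probability T R) (G : set (set T)).
Hypotheses (sigG : sigma_algebra setT G) (subG : G `<=` measurable).
Local Notation TG := (g_sigma_algebraType G).
Local Notation meas f := (measurable_fun [set: TG] f).

Lemma sub_measurableE : (measurable : set (set TG)) = G.
Proof. by rewrite /measurable /= sigma_algebra_id. Qed.

Lemma sub_measurableP (A : set T) : measurable (A : set TG) -> G A.
Proof. by rewrite sub_measurableE. Qed.

Lemma measurable_sub d' (U : measurableType d') (f : T -> U) :
  meas f -> measurable_fun setT f.
Proof.
move=> mf _ B mB; rewrite setTI; apply: subG; rewrite -sub_measurableE.
by have := mf measurableT B mB; rewrite setTI.
Qed.

Lemma measurable_coarsen : measurable_fun [set: T] (id : T -> TG).
Proof.
by move=> _ B mB; rewrite setTI; apply: subG; rewrite -sub_measurableE.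
Qed.

(** The identity, as a measurable map onto the space with the smaller
    sigma-algebra: pushing measures forward along it restricts them. *)
Definition coarsen : {mfun T >-> TG} :=
  HB.pack (id : T -> TG) (isMeasurableFun.Build _ _ _ _ _ measurable_coarsen).

Definition coarse_prob : probability TG R := distribution P coarsen.

(** The conditional expectation is the Radon-Nikodym derivative, on the smaller
    sigma-algebra, of the charge with density [X]. *)
Lemma cond_exp_exists (X : T -> R) : P.-integrable setT (EFin \o X) ->
  exists Y, is_cond_exp P G X Y.
Proof.
move=> iX.
pose nu_ : {charge set TG -> \bar R} := pushforward (induced_charge iX) coarsen.
pose nu := nu_ measurable_coarsen.
have dom : nu `<< coarse_prob.
  apply: dominates_pushforward; first exact: measurable_coarsen.
  apply/null_content_dominatesP => A mA A0.
  apply: null_set_integral => //.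
  exact/measurable_funTS/(measurable_int _ iX).
pose Y : T -> \bar R := Radon_Nikodym nu coarse_prob.
have iY : coarse_prob.-integrable setT Y := Radon_Nikodym_integrable dom.
have mY : meas Y := measurable_int _ iY.
have finY (o : TG) : Y o \is a fin_num := Radon_Nikodym_fin_num o dom.
have EY : EFin \o (fine \o Y) = Y.
  by apply/funext => o /=; rewrite fineK.
have mY' : measurable_fun [set: T] Y := measurable_sub mY.
have iY' : P.-integrable [set: T] Y.
  apply/integrableP; split => //.
  case/integrableP : iY => _; rewrite /coarse_prob ge0_integral_distribution //.
  exact: measurableT_comp.
exists (fine \o Y); split => //; rewrite ?EY //.
- by apply/measurable_EFinP; rewrite EY.
- move=> A GA; have mA : measurable (A : set TG) by rewrite sub_measurableE.
  transitivity (\int[coarse_prob]_(o in A) Y o)%E.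
    rewrite integral_pushforward //; first by apply: eq_integral => o _; rewrite /= fineK.
    by apply: integrableS iY' => //; exact: subG.
  by rewrite -Radon_Nikodym_integral.
Qed.

Lemma cond_expP (X : T -> R) : P.-integrable setT (EFin \o X) ->
  is_cond_exp P G X (cond_exp P G X).
Proof.
by move=> /cond_exp_exists [Y hY]; apply: (xgetPex (cst 0)); exists Y.
Qed.

Lemma is_cond_expB (X X' Y Y' : T -> R) : is_cond_exp P G X Y ->
  is_cond_exp P G X' Y' -> is_cond_exp P G (X \- X') (Y \- Y').
Proof.
move=> [iX mY iY h] [iX' mY' iY' h']; split.
- by apply: eq_integrable (integrableB measurableT iX iX').
- exact: measurable_funB.
- by apply: eq_integrable (integrableB measurableT iY iY').
- move=> A GA; have mA := subG GA.
  under eq_integral do rewrite /= EFinB.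
  under [RHS]eq_integral do rewrite /= EFinB.
  have iS Z : P.-integrable setT (EFin \o Z) -> P.-integrable A (fun o => (Z o)%:E).
    by move=> iZ; exact: (integrableS measurableT mA (@subsetT _ A) iZ).
  rewrite (integralB _ (iS _ iY) (iS _ iY')) // (integralB _ (iS _ iX) (iS _ iX')) //.
  by rewrite h ?h'.
Qed.

Lemma nnsfun_integralE (h : {nnsfun TG >-> R}) (X : T -> R) :
  P.-integrable setT (EFin \o X) ->
  (\int[P]_o (h o * X o)%:E =
   \sum_(r <- fset_set (range h)) r%:E * \int[P]_(o in h @^-1` [set r]) (X o)%:E)%E.
Proof.
move=> iX; under eq_integral => o _.
  rewrite (fimfunE h o) fsbig_finite //= mulr_suml -sumEFin; over.
have mA r : d.-measurable (h @^-1` [set r]).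
  by apply/subG/sub_measurableP; exact: measurable_sfunP.
have ii r : P.-integrable setT (fun o => (X o * \1_(h @^-1` [set r]) o)%:E).
  have /(integrable_mkcond _ (mA r)) : P.-integrable (h @^-1` [set r]) (EFin \o X).
    exact: integrableS iX.
  by rewrite epatch_indic; apply: eq_integrable => // o _.
rewrite integral_sum //.
- apply: eq_bigr => r _.
  under eq_integral do rewrite -mulrA EFinM.
  rewrite integralZl //; last first.
    by apply: eq_integrable (ii r) => // o _; rewrite mulrC.
  congr (_ * _)%E; rewrite [RHS]integral_mkcond epatch_indic.
  by apply: eq_integral => o _; rewrite /= mulrC EFinM.
- move=> r; under eq_fun do rewrite -mulrA EFinM.
  apply: integrableZl => //.
  by apply: eq_integrable (ii r) => // o _; rewrite mulrC.
Qed.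

Lemma is_cond_exp_nnsfun (h : {nnsfun TG >-> R}) (X Y : T -> R) :
  is_cond_exp P G X Y ->
  (\int[P]_o (h o * X o)%:E = \int[P]_o (h o * Y o)%:E)%E.
Proof.
move=> [iX mY iY hXY]; rewrite !nnsfun_integralE //.
apply: eq_bigr => r _; congr (_ * _)%E; rewrite hXY //.
by apply: sub_measurableP; exact: measurable_sfunP.
Qed.

(** For nonnegative variables the weight [phi] need not make the product
    integrable: this is what shows that a product with the noise is
    square-integrable. *)
Lemma is_cond_exp_pull_ge0 (X Y phi : T -> R) : is_cond_exp P G X Y ->
  meas phi -> (forall o, 0 <= phi o) -> (forall o, 0 <= X o) ->
  (forall o, 0 <= Y o) ->
  (\int[P]_o (phi o * X o)%:E = \int[P]_o (phi o * Y o)%:E)%E.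
Proof.
move=> cXY mphi phi0 X0 Y0; case: (cXY) => iX mY iY _.
have mphi' : measurable_fun [set: TG] (EFin \o phi) by exact/measurable_EFinP.
pose h := nnsfun_approx measurableT mphi'.
have mh n : measurable_fun [set: T] (h n) by apply: measurable_sub.
have ndh m n o : (m <= n)%N -> h m o <= h n o.
  by move=> mn; have /lefP/(_ o) := nd_nnsfun_approx measurableT mphi' mn.
suff lim_h (Z : T -> R) : measurable_fun setT Z -> (forall o, 0 <= Z o) ->
    (\int[P]_o (phi o * Z o)%:E =
     limn (fun n => \int[P]_o (h n o * Z o)%:E))%E.
  rewrite (lim_h X) //; last exact/measurable_EFinP/(measurable_int _ iX).
  rewrite (lim_h Y) //; last exact: measurable_sub.
  by under eq_fun do rewrite (is_cond_exp_nnsfun _ cXY).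
move=> mZ Z0; rewrite -monotone_convergence //.
- apply: eq_integral => o _; apply/esym/cvg_lim => //.
  under eq_fun do rewrite EFinM; rewrite EFinM; apply: cvgeZr => //.
  by apply: (cvg_nnsfun_approx measurableT mphi') => // x _ /=; rewrite lee_fin.
- by move=> n; apply/measurable_EFinP; exact: measurable_funM.
- by move=> n o _; rewrite lee_fin mulr_ge0.
- move=> o _ m n mn; rewrite lee_fin ler_wpM2r //.
  exact: ndh.
Qed.

Lemma is_cond_exp_pull_pos (X Y phi : T -> R) : is_cond_exp P G X Y ->
  meas phi -> (forall o, 0 <= phi o) ->
  P.-integrable setT (fun o => (phi o * X o)%:E) ->
  P.-integrable setT (fun o => (phi o * Y o)%:E) ->
  (\int[P]_o (phi o * X o)%:E = \int[P]_o (phi o * Y o)%:E)%E.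
Proof.
move=> cXY mphi phi0 ipX ipY; case: (cXY) => iX mY iY _.
have mphi' : measurable_fun [set: TG] (EFin \o phi) by exact/measurable_EFinP.
pose h := nnsfun_approx measurableT mphi'.
have mh n : measurable_fun [set: T] (h n) by apply: measurable_sub.
have ndh m n o : (m <= n)%N -> h m o <= h n o.
  by move=> mn; have /lefP/(_ o) := nd_nnsfun_approx measurableT mphi' mn.
have cvgh o : (EFin \o h ^~ o) @ \oo --> (phi o)%:E.
  by apply: (cvg_nnsfun_approx measurableT mphi') => // x _ /=; rewrite lee_fin.
have hle n o : h n o <= phi o.
  rewrite -lee_fin -(cvg_lim _ (cvgh o)) //.
  apply: lime_ge; first by apply/cvg_ex; eexists; exact: cvgh.
  near=> m; rewrite /= lee_fin.
  by apply: ndh; near: m; exists n.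
suff lim_h (Z : T -> R) : measurable_fun setT Z ->
    P.-integrable setT (fun o => (phi o * Z o)%:E) ->
    (fun n => \int[P]_o (h n o * Z o)%:E)%E @ \oo --> (\int[P]_o (phi o * Z o)%:E)%E.
  have mX : measurable_fun setT X by exact/measurable_EFinP/(measurable_int _ iX).
  have lX := lim_h X mX ipX; have lY := lim_h Y (measurable_sub mY) ipY.
  rewrite -(cvg_lim _ lX) // -(cvg_lim _ lY) //.
  by under eq_fun do rewrite (is_cond_exp_nnsfun _ cXY).
move=> mZ iZ.
have [|||||_ _ //] := @dominated_convergence _ _ _ P setT measurableT
  (fun n o => (h n o * Z o)%:E) (fun o => (phi o * Z o)%:E)
  (fun o => (`|phi o * Z o|)%:E).
- by move=> n; apply/measurable_EFinP; exact: measurable_funM.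
- exact: (measurable_int _ iZ).
- apply: aeW => o _; under eq_fun do rewrite EFinM; rewrite EFinM.
  by apply: cvgeZr => //; exact: cvgh.
- exact: integrable_norm.
- apply: aeW => o n _; rewrite /= lee_fin !normrM ler_wpM2r //.
  by rewrite !ger0_norm.
Unshelve. all: by end_near.
Qed.

Lemma is_cond_exp_pull (X Y phi : T -> R) : is_cond_exp P G X Y ->
  meas phi ->
  P.-integrable setT (fun o => (phi o * X o)%:E) ->
  P.-integrable setT (fun o => (phi o * Y o)%:E) ->
  (\int[P]_o (phi o * X o)%:E = \int[P]_o (phi o * Y o)%:E)%E.
Proof.
move=> cXY mphi ipX ipY; case: (cXY) => iX mY iY _.
have mX : measurable_fun setT X by exact/measurable_EFinP/(measurable_int _ iX).
have mY' := measurable_sub mY; have mphi' := measurable_sub mphi.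
have split_phi (Z : T -> R) : measurable_fun setT Z ->
    P.-integrable setT (fun o => (phi o * Z o)%:E) ->
  [/\ P.-integrable setT (fun o => (phi^\+ o * Z o)%:E),
      P.-integrable setT (fun o => (phi^\- o * Z o)%:E) &
    (\int[P]_o (phi o * Z o)%:E =
     \int[P]_o (phi^\+ o * Z o)%:E - \int[P]_o (phi^\- o * Z o)%:E)%E].
  move=> mZ iZ.
  have ip : P.-integrable setT (fun o => (phi^\+ o * Z o)%:E).
    apply: le_integrable iZ => //.
      by apply/measurable_EFinP/measurable_funM => //; exact: measurable_funrpos.
    move=> o _; rewrite /= lee_fin !normrM ler_wpM2r // /funrpos.
    by case: (leP (phi o) 0) => h; rewrite ?normr0 ?normr_ge0.
  have im : P.-integrable setT (fun o => (phi^\- o * Z o)%:E).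
    apply: le_integrable iZ => //.
      by apply/measurable_EFinP/measurable_funM => //; exact: measurable_funrneg.
    move=> o _; rewrite /= lee_fin !normrM ler_wpM2r // /funrneg.
    by case: (leP (- phi o) 0) => h; rewrite ?normr0 ?normr_ge0 ?normrN.
  split => //; rewrite -integralB //.
  apply: eq_integral => o _; rewrite -EFinB -mulrBl; congr (_ * _)%:E.
  exact: (congr1 (fun f : T -> R => f o) (esym (funrposBneg phi))).
have [iXp iXm ->] := split_phi X mX ipX; have [iYp iYm ->] := split_phi Y mY' ipY.
congr (_ - _)%E; apply: is_cond_exp_pull_pos => //.
- exact: measurable_funrpos.
- exact: measurable_funrneg.
Qed.
End ConditionalExpectation.

(** * Square-integrable random variables *)

Section SquareIntegrable.
Context {d : measure_display} {T : measurableType d} {R : realType}.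
Variable P : probability T R.
Implicit Types X Y Z : T -> R.

Definition integr X : Prop := P.-integrable setT (EFin \o X).
Definition expect X : R := \int[P]_o X o.

Lemma EFin_expect X : integr X -> (\int[P]_o (X o)%:E)%E = (expect X)%:E.
Proof. by move=> iX; rewrite fineK //; exact: integrable_fin_num. Qed.

Lemma integr_measurable X : integr X -> measurable_fun setT X.
Proof. by move=> /(measurable_int _) /measurable_EFinP. Qed.

Lemma integrD X Y : integr X -> integr Y -> integr (fun o => X o + Y o).
Proof. by move=> iX iY; apply: eq_integrable (integrableD measurableT iX iY). Qed.

Lemma integrB X Y : integr X -> integr Y -> integr (fun o => X o - Y o).
Proof. by move=> iX iY; apply: eq_integrable (integrableB measurableT iX iY). Qed.

Lemma integrZ a X : integr X -> integr (fun o => a * X o).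
Proof. by move=> iX; apply: eq_integrable (integrableZl measurableT a iX). Qed.

Lemma integr_sum (I : finType) (F : I -> T -> R) :
  (forall i, integr (F i)) -> integr (fun o => \sum_i F i o).
Proof.
move=> iF; have := @integrable_sum _ _ _ P setT measurableT _ (index_enum I) xpredT
  (fun i => EFin \o F i) (fun i _ => iF i).
apply: eq_integrable => //.
by move=> o _; rewrite /= sumEFin.
Qed.

Lemma le_integr X Y : measurable_fun setT X -> (forall o, `|X o| <= `|Y o|) ->
  integr Y -> integr X.
Proof.
move=> mX XY; apply: le_integrable => //; first exact/measurable_EFinP.
by move=> o _; rewrite /= lee_fin.
Qed.

Lemma expectD X Y : integr X -> integr Y ->
  expect (fun o => X o + Y o) = expect X + expect Y.
Proof. by move=> iX iY; rewrite /expect RintegralD. Qed.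

Lemma expectB X Y : integr X -> integr Y ->
  expect (fun o => X o - Y o) = expect X - expect Y.
Proof. by move=> iX iY; rewrite /expect RintegralB. Qed.

Lemma expectZ a X : integr X -> expect (fun o => a * X o) = a * expect X.
Proof. by move=> iX; rewrite /expect RintegralZl. Qed.

Lemma expect_sum (I : finType) (F : I -> T -> R) :
  (forall i, integr (F i)) ->
  expect (fun o => \sum_i F i o) = \sum_i expect (F i).
Proof.
move=> iF; apply/EFin_inj; rewrite -EFin_expect; last exact: integr_sum.
under eq_integral do rewrite -sumEFin.
rewrite integral_sum // -sumEFin; apply: eq_bigr => i _.
by rewrite -EFin_expect.
Qed.

Lemma expect_ge0 X : (forall o, 0 <= X o) -> 0 <= expect X.
Proof. by move=> X0; apply: Rintegral_ge0. Qed.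

Lemma ae_le_expect X Y : integr X -> integr Y -> {ae P, forall o, X o <= Y o} ->
  expect X <= expect Y.
Proof.
move=> iX iY XY; rewrite -subr_ge0 -expectB // -lee_fin.
have iYX := integrB iY iX; rewrite -EFin_expect //; have m := integr_measurable iYX.
rewrite (ae_eq_integral (fun o => `|Y o - X o|%:E)) //.
- by apply: integral_ge0 => o _; rewrite lee_fin.
- exact/measurable_EFinP.
- exact/measurable_EFinP/measurableT_comp.
- by apply: filterS XY => o h _; rewrite ger0_norm // subr_ge0.
Qed.

Lemma ae_eq_expect X Y : measurable_fun setT X -> measurable_fun setT Y ->
  {ae P, forall o, X o = Y o} -> expect X = expect Y.
Proof.
move=> mX mY XY; rewrite /expect /Rintegral; congr fine; apply: ae_eq_integral => //.
- exact/measurable_EFinP.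
- exact/measurable_EFinP.
- by apply: filterS XY => o h _; rewrite /= h.
Qed.

Definition sqi X : Prop :=
  measurable_fun setT X /\ integr (fun o => X o ^+ 2).

Lemma sqi_mul X Y : sqi X -> sqi Y -> integr (fun o => X o * Y o).
Proof.
move=> [mX iX] [mY iY]; apply: le_integr (integrD iX iY).
  exact: measurable_funM.
move=> o; have : 0 <= X o ^+ 2 + Y o ^+ 2 by rewrite addr_ge0 ?sqr_ge0.
move=> h; rewrite (ger0_norm h) ler_norml.
have := sqr_ge0 (X o + Y o); have := sqr_ge0 (X o - Y o).
have := sqr_ge0 (X o); have := sqr_ge0 (Y o); move=> *; apply/andP; split; nra.
Qed.

Lemma sqi_cst a : sqi (cst a).
Proof.
split; first exact: measurable_cst.
apply: measurable_bounded_integrable => //.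
  by rewrite (le_lt_trans (probability_le1 _ _)) // ltry.
  by rewrite /=; exact: measurable_cst.
exists (a ^+ 2); split; first exact: num_real.
by move=> x h o _; rewrite /= ger0_norm ?sqr_ge0 // ltW.
Qed.

Lemma sqiZ a X : sqi X -> sqi (fun o => a * X o).
Proof.
move=> [mX iX]; split; first exact: measurable_funM.
by apply: eq_integrable (integrZ (a ^+ 2) iX) => // o _; rewrite /= exprMn.
Qed.

Lemma sqiD X Y : sqi X -> sqi Y -> sqi (fun o => X o + Y o).
Proof.
move=> sX sY; have iXY := sqi_mul sX sY; move: sX sY => [mX iX] [mY iY].
split; first exact: measurable_funD.
apply: eq_integrable (integrD (integrD iX iY) (integrZ 2 iXY)) => // o _.
by rewrite /=; congr EFin; ring.
Qed.

Lemma sqiB X Y : sqi X -> sqi Y -> sqi (fun o => X o - Y o).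
Proof.
move=> sX sY; have := sqiD sX (sqiZ (-1) sY).
by under eq_fun do rewrite mulN1r.
Qed.

Lemma sqi_integr X : sqi X -> integr X.
Proof.
move=> sX; have := sqi_mul sX (sqi_cst 1).
by under eq_fun do rewrite mulr1.
Qed.

Lemma le_sqi X Y : measurable_fun setT X -> (forall o, `|X o| <= `|Y o|) ->
  sqi Y -> sqi X.
Proof.
move=> mX XY [mY iY]; split => //; apply: le_integr iY; first exact: measurable_funX.
by move=> o; rewrite !normrX lerXn2r ?nnegrE.
Qed.

Lemma bounded_sqi X M : measurable_fun setT X -> (forall o, `|X o| <= M) -> sqi X.
Proof.
move=> mX XM; apply: le_sqi (sqi_cst M) => // o.
by rewrite (le_trans (XM o)) // ler_norm.
Qed.

End SquareIntegrable.

(** * Conditionally centred noise *)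

Section Noise.
Context {d : measure_display} {T : measurableType d} {R : realType}.
Variables (P : probability T R) (G : set (set T)) (v : T -> R).
Hypotheses (sigG : sigma_algebra setT G) (subG : G `<=` measurable).
Local Notation TG := (g_sigma_algebraType G).
Local Notation gmeas f := (measurable_fun [set: TG] f).
Hypotheses (mv : measurable_fun setT v)
  (cv1 : is_cond_exp P G v (cst 0))
  (cv2 : is_cond_exp P G (fun o => v o ^+ 2) (cst 1)).
Implicit Types X Y : T -> R.

Let gm X : gmeas X -> measurable_fun setT X.
Proof. exact: (measurable_sub sigG subG). Qed.

(** A product of two square-integrable variables is in general only integrable;
    here the factor [v ^+ 2] has conditional expectation [1], so that the second
    moment of the product is that of [X]. *)
Lemma noise_mul_sqi X : gmeas X -> sqi P X -> sqi P (fun o => v o * X o).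
Proof.
move=> mX [mX' iX]; split; first exact: measurable_funM.
have iX' := iX; apply/integrableP; split.
  by apply/measurable_EFinP/measurable_funX/measurable_funM.
case/integrableP : iX => _; apply: le_lt_trans.
under eq_integral => o _ do rewrite /= ger0_norm ?sqr_ge0 // exprMn mulrC.
rewrite (is_cond_exp_pull_ge0 sigG subG cv2) //; [|exact: measurable_funX|by move=> o; exact: sqr_ge0..].
apply: ge0_le_integral => //.
- by move=> o _; rewrite lee_fin mulr1 sqr_ge0.
- by apply/measurable_EFinP/measurable_funM => //; apply: measurable_funX.
- by apply: measurableT_comp => //; apply/measurable_EFinP/measurable_funX.
- by move=> o _; rewrite /= mulr1 lee_fin ler_norm.
Qed.

Lemma noise_norm X : gmeas X -> sqi P X ->
  expect P (fun o => (v o * X o) ^+ 2) = expect P (fun o => X o ^+ 2).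
Proof.
move=> mX [mX' iX]; rewrite /expect /Rintegral; congr fine.
under eq_integral => o _ do rewrite exprMn mulrC.
rewrite (is_cond_exp_pull_ge0 sigG subG cv2) //; [|exact: measurable_funX|by move=> o; exact: sqr_ge0..].
by apply: eq_integral => o _; rewrite /= mulr1.
Qed.

Lemma noise_ortho X Y : gmeas X -> gmeas Y -> sqi P X -> sqi P Y ->
  expect P (fun o => Y o * (v o * X o)) = 0.
Proof.
move=> mX mY sX sY; rewrite /expect /Rintegral.
under eq_integral => o _ do rewrite mulrCA mulrC.
rewrite (is_cond_exp_pull sigG subG cv1).
- by under eq_integral => o _ do rewrite /= mulr0; rewrite integral0.
- exact: measurable_funM.
- apply: eq_integrable (sqi_mul sY (noise_mul_sqi mX sX)) => // o _.
  by rewrite /= mulrCA mulrC.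
- by under eq_fun do rewrite /= mulr0; exact: integrable0.
Qed.

Lemma cond_exp_pull_sqi Y Y' phi : is_cond_exp P G Y Y' -> sqi P Y -> sqi P Y' ->
  gmeas phi -> sqi P phi ->
  expect P (fun o => phi o * Y o) = expect P (fun o => phi o * Y' o).
Proof.
move=> cY sY sY' mphi sphi; rewrite /expect /Rintegral; congr fine.
by apply: (is_cond_exp_pull sigG subG cY) => //; exact: sqi_mul.
Qed.

Lemma cond_exp_pull_noise Y Z' phi :
  is_cond_exp P G (fun o => v o * Y o) Z' -> sqi P Y -> sqi P Z' ->
  gmeas phi -> sqi P phi ->
  expect P (fun o => (v o * phi o) * Y o) = expect P (fun o => phi o * Z' o).
Proof.
move=> cY sY sZ' mphi sphi; rewrite /expect /Rintegral; congr fine.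
under eq_integral => o _ do rewrite -mulrA mulrCA.
apply: (is_cond_exp_pull sigG subG cY) => //; last exact: sqi_mul.
apply: eq_integrable (sqi_mul (noise_mul_sqi mphi sphi) sY) => // o _.
by rewrite /= -mulrA mulrCA.
Qed.

(** Conditionally on [G] the variables [1] and [v] are orthonormal, so that
    [Y' + v Z'] is the projection of [Y] on their span, and expanding the square
    of the difference gives the inequality. As [Y'] and [Z'] are not known to
    be square-integrable beforehand, they are first truncated to the
    [G]-measurable events on which [Y' ^+ 2 + Z' ^+ 2] is bounded. *)
Lemma cond_bessel Y Y' Z' : sqi P Y -> is_cond_exp P G Y Y' ->
  is_cond_exp P G (fun o => v o * Y o) Z' ->
  [/\ sqi P Y', sqi P Z' &
   expect P (fun o => Y' o ^+ 2) + expect P (fun o => Z' o ^+ 2)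
   <= expect P (fun o => Y o ^+ 2)].
Proof.
move=> sY cY cZ.
have mY' : gmeas Y' by case: cY.
have mZ' : gmeas Z' by case: cZ.
have iY' : integr P Y' by case: cY.
have iZ' : integr P Z' by case: cZ.
have ivY : integr P (fun o => v o * Y o) by case: cZ.
pose q o := Y' o ^+ 2 + Z' o ^+ 2.
have mq : gmeas q by apply: measurable_funD; exact: measurable_funX.
have q0 o : 0 <= q o by rewrite addr_ge0 ?sqr_ge0.
pose B m := [set o | q o <= m%:R].
have mB m : measurable (B m : set TG).
  rewrite (_ : B m = setT `&` q @^-1` `]-oo, m%:R]%classic); first exact: mq.
  by rewrite setTI; apply/seteqP; split => o; rewrite /B /= in_itv.
pose Y_ m o := Y' o * \1_(B m) o; pose Z_ m o := Z' o * \1_(B m) o.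
have m1 m : gmeas (\1_(B m) : T -> R) by exact: measurable_indic.
have mY_ m : gmeas (Y_ m) by exact: measurable_funM.
have mZ_ m : gmeas (Z_ m) by exact: measurable_funM.
have bnd m o : Y_ m o ^+ 2 + Z_ m o ^+ 2 <= m%:R.
  rewrite /Y_ /Z_ indicE; case: (boolP (o \in B m)) => [|_].
    by rewrite inE !mulr1.
  by rewrite !mulr0 expr0n addr0 ler0n.
have bndY m o : `|Y_ m o| <= m%:R + 1.
  rewrite ler_norml; have := bnd m o; have := sqr_ge0 (Y_ m o); have := sqr_ge0 (Z_ m o).
  have := ler0n R m; move=> *; apply/andP; split; nra.
have bndZ m o : `|Z_ m o| <= m%:R + 1.
  rewrite ler_norml; have := bnd m o; have := sqr_ge0 (Y_ m o); have := sqr_ge0 (Z_ m o).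
  have := ler0n R m; move=> *; apply/andP; split; nra.
have sY_ m : sqi P (Y_ m) by apply: bounded_sqi (bndY m); exact: gm.
have sZ_ m : sqi P (Z_ m) by apply: bounded_sqi (bndZ m); exact: gm.
have mul_bounded (X : T -> R) (M : R) (phi : T -> R) : integr P X -> measurable_fun setT phi ->
    (forall o, `|phi o| <= M) -> integr P (fun o => phi o * X o).
  move=> iX mphi hM.
  have [M0|M0] := ltP M 0.
    by have := hM point; rewrite leNgt (lt_le_trans M0).
  apply: (le_integr (Y := fun o => M * X o)); last exact: integrZ.
    by apply: measurable_funM => //; exact: integr_measurable iX.
  by move=> o; rewrite !normrM ler_wpM2r // (le_trans (hM o)) // ler_norm.
have ndq m n o : (m <= n)%N -> Y_ m o ^+ 2 + Z_ m o ^+ 2 <= Y_ n o ^+ 2 + Z_ n o ^+ 2.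
  move=> mn; rewrite {1}/Y_ {1}/Z_ indicE; case: (boolP (o \in B m)) => [|_].
    rewrite inE => Bmo; rewrite /Y_ /Z_ indicE mem_set // /B /=.
    by apply: (le_trans Bmo); rewrite ler_nat.
  by rewrite !mulr0 expr0n addr0 addr_ge0 ?sqr_ge0.
have trunc m : expect P (fun o => Y_ m o ^+ 2 + Z_ m o ^+ 2)
    <= expect P (fun o => Y o ^+ 2).
  have svZ := noise_mul_sqi (mZ_ m) (sZ_ m).
  have idem (a : T -> R) o : (a o * \1_(B m) o) * a o = (a o * \1_(B m) o) ^+ 2.
    by rewrite indicE; case: (o \in B m); rewrite ?mulr1 ?mulr0 ?mul0r ?expr0n ?expr2.
  have e1 : expect P (fun o => Y_ m o * Y o) = expect P (fun o => Y_ m o ^+ 2).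
    rewrite /expect /Rintegral; congr fine.
    rewrite (is_cond_exp_pull sigG subG cY) //; last 2 first.
    - exact: sqi_mul.
    - by apply: mul_bounded (bndY m) => //; exact: gm.
    by apply: eq_integral => o _; rewrite idem.
  have e2 : expect P (fun o => (v o * Z_ m o) * Y o) = expect P (fun o => Z_ m o ^+ 2).
    rewrite /expect /Rintegral; congr fine.
    under eq_integral => o _ do rewrite -mulrA mulrCA.
    rewrite (is_cond_exp_pull sigG subG cZ) //; last 2 first.
    - by apply: mul_bounded (bndZ m) => //; exact: gm.
    - by apply: mul_bounded (bndZ m) => //; exact: gm.
    by apply: eq_integral => o _; rewrite idem.
  have iY2 := (sY_ m).2; have iZ2 := (sZ_ m).2; have ivZ2 := svZ.2; have iYY := sY.2.
  have iYY_ := sqi_mul (sY_ m) sY; have ivZY := sqi_mul svZ sY.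
  have iYvZ := sqi_mul (sY_ m) svZ.
  have := expect_ge0 P (X := fun o => (Y_ m o + v o * Z_ m o - Y o) ^+ 2)
    (fun o => sqr_ge0 _).
  have -> : (fun o => (Y_ m o + v o * Z_ m o - Y o) ^+ 2) =
     (fun o => ((Y_ m o ^+ 2 + (v o * Z_ m o) ^+ 2) + Y o ^+ 2)
       - 2 * ((Y_ m o * Y o + (v o * Z_ m o) * Y o) - Y_ m o * (v o * Z_ m o))).
    by apply/funext => o; ring.
  rewrite expectB; [|by do ?[apply: integrD]|by apply: integrZ; apply: integrB => //; apply: integrD].
  rewrite expectZ ?expectB ?expectD ?e1 ?e2 ?(noise_norm (mZ_ m)) ?noise_ortho //; last first.
  - by apply: integrB => //; exact: integrD.
  - exact: integrD.
  - exact: integrD.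
  lra.
have key : (\int[P]_o (q o)%:E <= (expect P (fun o => Y o ^+ 2))%:E)%E.
  have -> : (\int[P]_o (q o)%:E =
      \int[P]_o (limn (fun m => (Y_ m o ^+ 2 + Z_ m o ^+ 2)%:E)))%E.
    apply: eq_integral => o _; apply/esym/cvg_lim => //.
    apply: cvg_near_cst; near=> m; rewrite /Y_ /Z_ indicE mem_set ?mulr1 //=.
    rewrite /B /=; apply: (le_trans (ltW (truncnS_gt (q o)))).
    by rewrite ler_nat; near: m; exact: nbhs_infty_ge.
  rewrite monotone_convergence //.
  - apply: lime_le; last first.
      apply: nearW => m; rewrite EFin_expect ?lee_fin //.
      by apply: integrD; [exact: (sY_ m).2|exact: (sZ_ m).2].
    apply: ereal_nondecreasing_is_cvgn => m n mn.
    apply: ge0_le_integral => //.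
    + by move=> o _; rewrite lee_fin addr_ge0 ?sqr_ge0.
    + apply/measurable_EFinP/measurable_funD; apply: measurable_funX; exact: gm.
    + apply/measurable_EFinP/measurable_funD; apply: measurable_funX; exact: gm.
    + by move=> o _; rewrite lee_fin; exact: ndq.
  - move=> m; apply/measurable_EFinP/measurable_funD; apply: measurable_funX; exact: gm.
  - by move=> m o _; rewrite lee_fin addr_ge0 ?sqr_ge0.
  - by move=> o _ m n mn; rewrite lee_fin; exact: ndq.
have iq : integr P q.
  apply/integrableP; split; first by apply/measurable_EFinP; exact: gm.
  apply: (@le_lt_trans _ _ (\int[P]_o (q o)%:E)%E); last by apply: (le_lt_trans key); rewrite ltry.
  apply: ge0_le_integral => //.
  - by apply: measurableT_comp => //; apply/measurable_EFinP; exact: gm.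
  - by apply/measurable_EFinP; exact: gm.
  - by move=> o _; rewrite lee_fin ger0_norm.
have sY' : sqi P Y'.
  split; first exact: gm.
  apply: le_integr iq; first by apply: measurable_funX; exact: gm.
  by move=> o; rewrite !ger0_norm ?sqr_ge0 // lerDl sqr_ge0.
have sZ' : sqi P Z'.
  split; first exact: gm.
  apply: le_integr iq; first by apply: measurable_funX; exact: gm.
  by move=> o; rewrite !ger0_norm ?sqr_ge0 // lerDr sqr_ge0.
split => //; rewrite -expectD; [|exact: sY'.2|exact: sZ'.2].
by rewrite -lee_fin -EFin_expect.
Unshelve. all: by end_near.
Qed.
End Noise.

(** * Square-integrable random vectors *)

Section Inner.
Context {R : realType} {m n : nat}.
Implicit Types A B C : 'M[R]_(m, n).

Lemma innerC A B : inner A B = inner B A.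
Proof. by apply: eq_bigr => i _; apply: eq_bigr => j _; rewrite mulrC. Qed.

Lemma inner_linear a A B C : inner (a *: A + B) C = a * inner A C + inner B C.
Proof.
rewrite /inner mulr_sumr -big_split; apply: eq_bigr => i _ /=.
by rewrite mulr_sumr -big_split; apply: eq_bigr => j _ /=; rewrite !mxE; ring.
Qed.

Lemma inner0l C : inner 0 C = 0 :> R.
Proof.
by rewrite /inner big1 // => i _; rewrite big1 // => j _; rewrite mxE mul0r.
Qed.

Lemma innerZl a A C : inner (a *: A) C = a * inner A C.
Proof. by rewrite -[_ *: _]addr0 inner_linear inner0l addr0. Qed.

Lemma innerNl A C : inner (- A) C = - inner A C.
Proof. by rewrite -scaleN1r innerZl mulN1r. Qed.

Lemma inner_ge0 A : 0 <= inner A A.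
Proof. by apply: sumr_ge0 => i _; apply: sumr_ge0 => j _; rewrite -expr2 sqr_ge0. Qed.

Lemma enorm_ge0 A : 0 <= enorm A.
Proof. exact: sqrtr_ge0. Qed.

Lemma enorm_sqr A : enorm A ^+ 2 = inner A A.
Proof. by rewrite sqr_sqrtr // inner_ge0. Qed.

Lemma enorm_eq0 A : enorm A = 0 -> A = 0.
Proof.
move=> /(congr1 (fun x => x ^+ 2)); rewrite enorm_sqr expr0n /= => /eqP.
rewrite psumr_eq0 => [/allP h|i _]; last by apply: sumr_ge0 => j _; rewrite -expr2 sqr_ge0.
apply/matrixP => i j; rewrite mxE; have := h i (mem_index_enum _).
rewrite psumr_eq0 => [/allP /(_ j (mem_index_enum _))|k _]; last by rewrite -expr2 sqr_ge0.
by rewrite -expr2 sqrf_eq0 => /eqP.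
Qed.

Lemma enorm_opp A : enorm (- A) = enorm A.
Proof. by rewrite /enorm innerNl innerC innerNl opprK. Qed.

Lemma enorm0 : enorm (0 : 'M[R]_(m, n)) = 0.
Proof. by rewrite /enorm inner0l sqrtr0. Qed.

Lemma entry_le_enorm A i j : `|A i j| <= enorm A.
Proof.
rewrite -ler_sqr ?nnegrE ?enorm_ge0 // enorm_sqr real_normK ?num_real //.
rewrite /inner (bigD1 i) //= (bigD1 j) //= -expr2 -addrA lerDl addr_ge0 //.
  by apply: sumr_ge0 => k _; rewrite -expr2 sqr_ge0.
by apply: sumr_ge0 => k _; apply: sumr_ge0 => l _; rewrite -expr2 sqr_ge0.
Qed.

End Inner.

Lemma inner_colE (R : realType) (n : nat) (u v : 'cV[R]_n) :
  inner u v = \sum_i u i 0 * v i 0.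
Proof. by apply: eq_bigr => i _; rewrite big_ord1. Qed.

Section VectorSquareIntegrable.
Context {d : measure_display} {T : measurableType d} {R : realType} {n : nat}.
Variable P : probability T R.
Implicit Types g h : T -> 'cV[R]_n.

Definition vsqi g : Prop := forall i, sqi P (fun o => g o i 0).
Definition vip g h : R := expect P (fun o => inner (g o) (h o)).

Lemma vip_integr g h : vsqi g -> vsqi h -> integr P (fun o => inner (g o) (h o)).
Proof.
move=> sg sh; under eq_fun do rewrite inner_colE.
by apply: integr_sum => i; apply: sqi_mul; [exact: sg|exact: sh].
Qed.

Lemma vipE g h : vsqi g -> vsqi h ->
  vip g h = \sum_i expect P (fun o => g o i 0 * h o i 0).
Proof.
move=> sg sh; rewrite /vip; under eq_fun do rewrite inner_colE.
by apply: expect_sum => i; apply: sqi_mul; [exact: sg|exact: sh].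
Qed.

Lemma vsqiD g h : vsqi g -> vsqi h -> vsqi (fun o => g o + h o).
Proof.
by move=> sg sh i; under eq_fun do rewrite mxE; apply: sqiD; [exact: sg|exact: sh].
Qed.

Lemma vsqiZ a g : vsqi g -> vsqi (fun o => a *: g o).
Proof. by move=> sg i; under eq_fun do rewrite mxE; apply: sqiZ; exact: sg. Qed.

Lemma vsqiB g h : vsqi g -> vsqi h -> vsqi (fun o => g o - h o).
Proof.
by move=> sg sh i; under eq_fun do rewrite !mxE; apply: sqiB; [exact: sg|exact: sh].
Qed.

Lemma vsqi_cst (u : 'cV[R]_n) : vsqi (cst u).
Proof. by move=> i; exact: sqi_cst. Qed.

Lemma vipC g h : vip g h = vip h g.
Proof. by congr expect; apply/funext => o; rewrite innerC. Qed.

Lemma vip_linear a g g' h : vsqi g -> vsqi g' -> vsqi h ->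
  vip (fun o => a *: g o + g' o) h = a * vip g h + vip g' h.
Proof.
move=> sg sg' sh; have i1 := vip_integr sg sh; have i2 := vip_integr sg' sh.
rewrite -(expectZ _ i1) -expectD //; last exact: integrZ.
by congr expect; apply/funext => o; rewrite inner_linear.
Qed.

Lemma vipDl g g' h : vsqi g -> vsqi g' -> vsqi h ->
  vip (fun o => g o + g' o) h = vip g h + vip g' h.
Proof.
move=> sg sg' sh; rewrite -[vip g h]mul1r -vip_linear //.
by congr expect; apply/funext => o; rewrite scale1r.
Qed.

Lemma vip_ge0 g : 0 <= vip g g.
Proof. by apply: expect_ge0 => o; exact: inner_ge0. Qed.

Lemma vip_eq0 g : vsqi g -> vip g g = 0 -> {ae P, forall o, g o = 0}.
Proof.
move=> sg g0; have ig := vip_integr sg sg.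
have : (\int[P]_o `|(inner (g o) (g o))%:E| = 0)%E.
  under eq_integral => o _ do rewrite gee0_abs ?lee_fin ?inner_ge0 //.
  by rewrite EFin_expect // -/(vip g g) g0.
move/(ae_eq_integral_abs P measurableT (measurable_int _ ig)).
apply: filterS => o /(_ I) /= [h]; apply: enorm_eq0.
by apply/eqP; rewrite -sqrf_eq0 enorm_sqr h.
Qed.

Definition vmeasurable g : Prop := forall i, measurable_fun setT (fun o => g o i 0).

Lemma vmeasurable_inner g h : vmeasurable g -> vmeasurable h ->
  measurable_fun setT (fun o => inner (g o) (h o)).
Proof.
move=> mg mh; under eq_fun do rewrite inner_colE.
by apply: measurable_sum => i; exact: measurable_funM.
Qed.

Lemma vsqi_measurable g : vsqi g -> vmeasurable g.
Proof. by move=> sg i; case: (sg i). Qed.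

Lemma ae_eq_vip g g' h h' : vsqi g -> vsqi g' -> vsqi h -> vsqi h' ->
  {ae P, forall o, g o = h o} -> {ae P, forall o, g' o = h' o} ->
  vip g g' = vip h h'.
Proof.
move=> sg sg' sh sh' e e'; apply: ae_eq_expect.
- by apply: vmeasurable_inner; exact: vsqi_measurable.
- by apply: vmeasurable_inner; exact: vsqi_measurable.
- by apply: filterS2 e e' => o -> ->.
Qed.

Lemma vmeasurable_enorm_sqr g : vmeasurable g ->
  measurable_fun setT (fun o => enorm (g o) ^+ 2).
Proof.
by move=> mg; under eq_fun do rewrite enorm_sqr; exact: vmeasurable_inner.
Qed.

Lemma integral_enorm_sqr g : vsqi g ->
  (\int[P]_o (enorm (g o) ^+ 2)%:E)%E = (vip g g)%:E.
Proof.
move=> sg; under eq_integral do rewrite enorm_sqr.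
by rewrite EFin_expect //; exact: vip_integr.
Qed.

Lemma vsqi_of_finite g : vmeasurable g ->
  (\int[P]_o (enorm (g o) ^+ 2)%:E < +oo)%E -> vsqi g.
Proof.
move=> mg fin i; split => //; apply: (le_integr (Y := fun o => enorm (g o) ^+ 2)).
- exact: measurable_funX.
- move=> o; rewrite !normrX lerXn2r ?nnegrE // (ger0_norm (enorm_ge0 _)).
  exact: entry_le_enorm.
- apply/integrableP; split; first exact/measurable_EFinP/vmeasurable_enorm_sqr.
  by under eq_integral => o _ do rewrite /= ger0_norm ?sqr_ge0 //.
Qed.

End VectorSquareIntegrable.

Section VectorNoise.
Context {d : measure_display} {T : measurableType d} {R : realType} {n : nat}.
Variables (P : probability T R) (G : set (set T)) (v : T -> R).
Hypotheses (sigG : sigma_algebra setT G) (subG : G `<=` measurable).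
Local Notation TG := (g_sigma_algebraType G).
Hypotheses (mv : measurable_fun setT v)
  (cv1 : is_cond_exp P G v (cst 0))
  (cv2 : is_cond_exp P G (fun o => v o ^+ 2) (cst 1)).
Implicit Types b s y : T -> 'cV[R]_n.

Definition vgmeas b : Prop :=
  forall i, measurable_fun [set: TG] (fun o => b o i 0).

Definition is_cond_expv y y' : Prop :=
  forall i, is_cond_exp P G (fun o => y o i 0) (fun o => y' o i 0).

Lemma is_cond_expvB y1 y1' y2 y2' : is_cond_expv y1 y1' -> is_cond_expv y2 y2' ->
  is_cond_expv (fun o => y1 o - y2 o) (fun o => y1' o - y2' o).
Proof.
move=> h1 h2 i; have := is_cond_expB subG (h1 i) (h2 i).
rewrite /GRing.sub_fun /=.
by rewrite [X in is_cond_exp _ _ X](_ : _ = (fun o => (y1 o - y2 o) i 0));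
  [rewrite [X in is_cond_exp _ _ _ X](_ : _ = (fun o => (y1' o - y2' o) i 0)) //|];
  apply/funext => o; rewrite !mxE.
Qed.

Lemma cond_expvP y : vsqi P y -> is_cond_expv y (cond_expv P G y).
Proof.
move=> sy i; have := cond_expP sigG subG (sqi_integr (sy i)).
rewrite [X in is_cond_exp _ _ _ X -> _](_ : _ = (fun o => cond_expv P G y o i 0)) //.
by apply/funext => o; rewrite mxE.
Qed.

Lemma noise_is_sqi : sqi P v.
Proof. by split => //; case: cv2. Qed.

Lemma cond_expv_noiseP y : vsqi P y ->
  forall i, is_cond_exp P G (fun o => v o * y o i 0)
    (fun o => cond_expv P G (fun o => v o *: y o) o i 0).
Proof.
move=> sy i; have := cond_expP sigG subG (sqi_mul noise_is_sqi (sy i)).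
rewrite [X in is_cond_exp _ _ _ X -> _]
  (_ : _ = (fun o => cond_expv P G (fun o => v o *: y o) o i 0)) //.
apply/funext => o; rewrite mxE; congr (cond_exp _ _ _ _).
by apply/funext => o'; rewrite mxE.
Qed.

Lemma vnoise_vsqi s : vgmeas s -> vsqi P s -> vsqi P (fun o => v o *: s o).
Proof.
move=> ms ss i; under eq_fun do rewrite mxE.
exact: (noise_mul_sqi sigG subG mv cv2).
Qed.

Lemma vnoise_norm b s : vgmeas b -> vgmeas s -> vsqi P b -> vsqi P s ->
  vip P (fun o => b o + v o *: s o) (fun o => b o + v o *: s o)
  = vip P b b + vip P s s.
Proof.
move=> mb ms sb ss; have svs := vnoise_vsqi ms ss.
have sbvs := vsqiD sb svs.
rewrite vipDl // ![vip P _ (fun o => b o + _)]vipC !vipDl //.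
rewrite [vip P (fun o => v o *: s o) b]vipC.
have -> : vip P b (fun o => v o *: s o) = 0.
  rewrite vipE // big1 // => i _; under eq_fun do rewrite mxE.
  exact: (noise_ortho sigG subG mv cv1 cv2).
rewrite addr0 add0r; congr (_ + _); rewrite !vipE //; apply: eq_bigr => i _.
rewrite -(noise_norm sigG subG cv2 (ms i) (ss i)).
  by congr expect; apply/funext => o; rewrite !mxE -expr2.
Qed.

Lemma vcond_pull (b s y y' z' : T -> 'cV[R]_n) : vgmeas b -> vgmeas s -> vsqi P b -> vsqi P s ->
  vsqi P y -> vsqi P y' -> vsqi P z' -> is_cond_expv y y' ->
  (forall i, is_cond_exp P G (fun o => v o * y o i 0) (fun o => z' o i 0)) ->
  vip P (fun o => b o + v o *: s o) y = vip P b y' + vip P s z'.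
Proof.
move=> mb ms sb ss sy sy' sz' cy cz; have svs := vnoise_vsqi ms ss.
rewrite vipDl // !vipE //; congr (_ + _); apply: eq_bigr => i _.
  exact: (cond_exp_pull_sqi sigG subG (cy i)).
under eq_fun do rewrite mxE.
exact: (cond_exp_pull_noise sigG subG mv cv2 (cz i)).
Qed.

Lemma vcond_bessel (y y' z' : T -> 'cV[R]_n) : vsqi P y -> is_cond_expv y y' ->
  (forall i, is_cond_exp P G (fun o => v o * y o i 0) (fun o => z' o i 0)) ->
  [/\ vsqi P y', vsqi P z' & vip P y' y' + vip P z' z' <= vip P y y].
Proof.
move=> sy cy cz.
have B i := cond_bessel sigG subG mv cv1 cv2 (sy i) (cy i) (cz i).
have sy' : vsqi P y' by move=> i; case: (B i).
have sz' : vsqi P z' by move=> i; case: (B i).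
split => //; rewrite !vipE // -big_split; apply: ler_sum => i _ /=.
by have [_ _] := B i.
Qed.
End VectorNoise.

(** * Real series *)

Section RealSums.
Context {R : realType}.
Implicit Types u v : nat -> R.

Definition rsummable u : Prop := cvgn (series u).
Definition rsum u : R := limn (series u).

Lemma rsummableD u v : rsummable u -> rsummable v -> rsummable (fun k => u k + v k).
Proof. by move=> su sv; exact: is_cvg_seriesD su sv. Qed.

Lemma rsumD u v : rsummable u -> rsummable v ->
  rsum (fun k => u k + v k) = rsum u + rsum v.
Proof. by move=> su sv; exact: lim_seriesD su sv. Qed.

Lemma rsummableZ a u : rsummable u -> rsummable (fun k => a * u k).
Proof. by move=> su; exact: is_cvg_seriesZ su. Qed.

Lemma rsumZ a u : rsummable u -> rsum (fun k => a * u k) = a * rsum u.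
Proof. by move=> su; exact: lim_seriesZ su. Qed.

Lemma le_rsum u v : rsummable u -> rsummable v -> (forall k, u k <= v k) ->
  rsum u <= rsum v.
Proof. by move=> su sv uv; exact: lim_series_le. Qed.

Lemma rsum0 : rsum (fun=> 0) = 0.
Proof.
rewrite /rsum (_ : series _ = fun=> 0) ?lim_cst //.
by apply/funext => k; rewrite /series /= big1.
Qed.

Lemma rsummable0 : rsummable (fun=> 0).
Proof.
rewrite /rsummable (_ : series _ = fun=> 0); first exact: is_cvg_cst.
by apply/funext => k; rewrite /series /= big1.
Qed.

Lemma rsum_ge0 u : rsummable u -> (forall k, 0 <= u k) -> 0 <= rsum u.
Proof. by move=> su u0; rewrite -rsum0; apply: le_rsum => //; exact: rsummable0. Qed.

Lemma le_rsummable u v : rsummable v -> (forall k, `|u k| <= v k) -> rsummable u.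
Proof.
move=> sv uv; apply: normed_cvg; apply: (series_le_cvg _ _ uv sv) => k; first exact: normr_ge0.
exact: le_trans (normr_ge0 _) (uv k).
Qed.

Lemma partial_le_rsum u K : rsummable u -> (forall k, 0 <= u k) ->
  \sum_(0 <= k < K) u k <= rsum u.
Proof.
move=> su u0; apply: (nondecreasing_cvgn_le _ su).
by apply: nondecreasing_series => i _ _; exact: u0.
Qed.

Lemma term_le_rsum u k : rsummable u -> (forall k, 0 <= u k) -> u k <= rsum u.
Proof.
move=> su u0; apply: le_trans (partial_le_rsum k.+1 su u0).
by rewrite big_nat_recr //= lerDr sumr_ge0.
Qed.

Lemma series_recl u K : series u K.+1 = u 0%N + series (fun k => u k.+1) K.
Proof. by rewrite /series /= big_nat_recl. Qed.

Lemma rsummable_shift u : rsummable u -> rsummable (fun k => u k.+1).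
Proof.
move=> su; have h : [sequence series u n.+1]_n @ \oo --> rsum u by rewrite cvg_shiftS.
apply/cvg_ex; exists (rsum u - u 0%N).
have -> : series (fun k => u k.+1) = (fun K => series u K.+1 - u 0%N).
  by apply/funext => K; rewrite series_recl addrC addKr.
by apply: cvgB; [exact: h|exact: cvg_cst].
Qed.

Lemma cvg_series_unshift u : rsummable (fun k => u k.+1) ->
  series u @ \oo --> u 0%N + rsum (fun k => u k.+1).
Proof.
move=> su; rewrite -cvg_shiftS.
rewrite (_ : [sequence series u n.+1]_n = (fun K => u 0%N + series (fun k => u k.+1) K)).
  by apply: cvgD; [exact: cvg_cst|exact: su].
by apply/funext => K; rewrite /= series_recl.
Qed.

Lemma rsummable_unshift u : rsummable (fun k => u k.+1) -> rsummable u.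
Proof. by move=> su; apply/cvg_ex; eexists; exact: cvg_series_unshift. Qed.

Lemma rsum_recl u : rsummable u -> rsum u = u 0%N + rsum (fun k => u k.+1).
Proof. by move=> /rsummable_shift su; apply/cvg_lim => //; exact: cvg_series_unshift. Qed.

Lemma rsummable_of_finite u : (forall k, 0 <= u k) ->
  (\sum_(0 <= k <oo) (u k)%:E < +oo)%E -> rsummable u.
Proof. by move=> u0; exact: nnseries_is_cvg. Qed.

Lemma EFin_rsum u : rsummable u ->
  (\sum_(0 <= k <oo) (u k)%:E)%E = (rsum u)%:E.
Proof.
move=> su; rewrite -EFin_lim //; congr (limn _); apply/funext => K /=.
by rewrite /series /= sumEFin.
Qed.

Lemma rsummable_geometric a r : 0 <= r < 1 -> rsummable (fun k => a * r ^+ k).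
Proof.
move=> /andP[r0 r1]; apply: is_cvg_geometric_series.
by rewrite ger0_norm.
Qed.

Lemma rsum_combine (u v t : nat -> R) (e : R) : rsummable u -> rsummable v ->
  rsummable t ->
  rsummable (fun k => u k + e * v k + e * t k) /\
  rsum (fun k => u k + e * v k + e * t k) = rsum u + e * (rsum v + rsum t).
Proof.
move=> su sv st; have ev := rsummableZ (a := e) sv; have et := rsummableZ (a := e) st.
have uv := rsummableD su ev; split; first exact: rsummableD uv et.
by rewrite (rsumD uv et) (rsumD su ev) !rsumZ // mulrDr addrA.
Qed.

Lemma cvg_finite_sum (I : Type) (s : seq I) (F : I -> nat -> R) (l : I -> R) :
  (forall i, F i @ \oo --> l i) ->
  (fun m => \sum_(i <- s) F i m) @ \oo --> \sum_(i <- s) l i.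
Proof.
move=> hF; elim: s => [|i s IH].
  by under eq_fun do rewrite big_nil; rewrite big_nil; exact: cvg_cst.
by under eq_fun do rewrite big_cons; rewrite big_cons; exact: cvgD.
Qed.

End RealSums.

(** * Measurable versions *)

Section Versions.
Context {d : measure_display} {T : measurableType d} {R : realType}.
Variables (P : probability T R) (G : set (set T)).
Local Notation TG := (g_sigma_algebraType G).
Local Notation gmeas f := (measurable_fun [set: TG] f).

(** The upper limit is measurable everywhere, unlike the limit, which exists only
    almost surely. *)
Lemma version_of_limit (X_ : nat -> T -> R) (X : T -> R) :
  (forall j, gmeas (X_ j)) -> {ae P, forall o, X_ ^~ o @ \oo --> X o} ->
  exists2 Y : T -> R, gmeas Y & {ae P, forall o, X o = Y o}.
Proof.
move=> mX cX; exists (fun o => fine (limn_esup (fun j => (X_ j o)%:E))).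
  apply: measurableT_comp => //.
  by apply: measurable_fun_limn_esup => j; exact/measurable_EFinP.
apply: filterS cX => o Xo.
have /cvg_limn_einf_sup [_ ->] // : (fun j => (X_ j o)%:E) @ \oo --> (X o)%:E.
by apply: cvg_EFin; [exact: nearW|exact: Xo].
Qed.

Lemma countable_glue (K : countType) (q : T -> K) (F : K -> T -> R) :
  (forall c, measurable (q @^-1` [set c] : set TG)) ->
  (forall c, gmeas (F c)) -> gmeas (fun o => F (q o) o).
Proof.
move=> mq mF _ B mB; rewrite setTI.
have -> : (fun o => F (q o) o) @^-1` B
    = \bigcup_c (q @^-1` [set c] `&` F c @^-1` B).
  by apply/seteqP; split => [t Bt|t [c _ [<-]]] //; exists (q t).
apply: countable_bigcupT_measurable; first exact: countableP.
move=> c; apply: measurableI => //; rewrite -[X in measurable X]setTI; exact: mF.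
Qed.

Section Grid.
Context {n : nat}.
Implicit Types X : T -> 'cV[R]_n.

Definition grid_code (j : nat) (u : 'cV[R]_n) : 'cV[int]_n :=
  \col_i Num.floor (j.+1%:R * u i 0).
Definition grid_point (j : nat) (c : 'cV[int]_n) : 'cV[R]_n :=
  \col_i ((c i 0)%:~R / j.+1%:R).

Lemma measurable_grid_code j X (c : 'cV[int]_n) : vgmeas G X ->
  measurable ((fun o => grid_code j (X o)) @^-1` [set c] : set TG).
Proof.
move=> mX.
have -> : (fun o => grid_code j (X o)) @^-1` [set c] = \bigcap_(i in [set: 'I_n])
   ((fun o => j.+1%:R * X o i 0) @^-1` `[(c i 0)%:~R, (c i 0 + 1)%:~R[%classic).
  apply/seteqP; split => [t /= h i _|t h].
    by rewrite /= in_itv /= -h mxE real_floor_itv ?num_real.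
  rewrite /=; apply/colP => i; rewrite mxE.
  by apply: floor_def; have := h i I; rewrite /= in_itv.
apply: fin_bigcap_measurable => // i _; rewrite -[X in measurable X]setTI.
have m : gmeas (fun o => j.+1%:R * X o i 0).
  by apply: measurable_funM => //; exact: mX.
exact: m.
Qed.

Lemma enorm_le_entries (u : 'cV[R]_n) (e : R) : 0 <= e ->
  (forall i, `|u i 0| <= e) -> enorm u <= n%:R * e.
Proof.
move=> e0 ue; rewrite -ler_sqr ?nnegrE ?enorm_ge0 ?mulr_ge0 // enorm_sqr inner_colE.
apply: (@le_trans _ _ (\sum_(i < n) e ^+ 2)).
  by apply: ler_sum => i _; rewrite -expr2 -real_normK ?num_real // lerXn2r ?nnegrE.
rewrite sumr_const card_ord exprMn -(mulr_natl (e ^+ 2)) ler_wpM2r ?sqr_ge0 //.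
by rewrite -natrX ler_nat; case: (n) => // k; rewrite -[X in (X <= _)%N]expn1 leq_pexp2l.
Qed.

Lemma grid_point_close j (u : 'cV[R]_n) :
  enorm (grid_point j (grid_code j u) - u) <= n%:R / j.+1%:R.
Proof.
apply: enorm_le_entries => // i; rewrite !mxE.
have j0 : (0 : R) < j.+1%:R by rewrite ltr0n.
rewrite -(ler_pM2l j0) -{1}(gtr0_norm j0) -normrM mulrBr mulrCA !divff ?gt_eqF // mulr1.
have := real_floor_itv (num_real (j.+1%:R * u i 0)); rewrite intrD.
by set f := (Num.floor _)%:~R => /andP[h1 h2]; rewrite ler_norml; lra.
Qed.

(** The composition of a random function that is only almost surely continuous
    in its arguments need not be [G]-measurable, but it has a [G]-measurable version:
    on grid-valued arguments it is a countable gluing, and the grid points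
    converge. *)
Lemma composition_version (phi : 'cV[R]_n -> 'cV[R]_n -> 'cV[R]_n -> T -> 'cV[R]_n)
    (c : R) X Y Z :
  (forall x y z, vgmeas G (phi x y z)) ->
  {ae P, forall o, forall x y z xb yb zb,
    enorm (phi x y z o - phi xb yb zb o) <=
      c * (enorm (x - xb) + enorm (y - yb) + enorm (z - zb))} ->
  vgmeas G X -> vgmeas G Y -> vgmeas G Z ->
  exists2 g : T -> 'cV[R]_n, vgmeas G g &
    {ae P, forall o, phi (X o) (Y o) (Z o) o = g o}.
Proof.
move=> mphi lip mX mY mZ.
pose gp j u := grid_point j (grid_code j u).
pose F_ j o := phi (gp j (X o)) (gp j (Y o)) (gp j (Z o)) o.
have mF j i : gmeas (fun o => F_ j o i 0).
  apply: (@countable_glue ('cV[int]_n * 'cV[int]_n * 'cV[int]_n)%type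
    (fun o => (grid_code j (X o), grid_code j (Y o), grid_code j (Z o)))
    (fun cc o => phi (grid_point j cc.1.1) (grid_point j cc.1.2) (grid_point j cc.2) o i 0)).
    move=> [[c1 c2] c3].
    have -> : (fun o => (grid_code j (X o), grid_code j (Y o), grid_code j (Z o)))
        @^-1` [set (c1, c2, c3)]
      = (fun o => grid_code j (X o)) @^-1` [set c1]
        `&` ((fun o => grid_code j (Y o)) @^-1` [set c2]
        `&` (fun o => grid_code j (Z o)) @^-1` [set c3]).
      apply/seteqP; split => [t /= [h1 h2 h3]|t /= [h1 [h2 h3]]]; first by [].
      by rewrite h1 h2 h3.
    by do 2 ?[apply: measurableI]; exact: measurable_grid_code.
  by move=> cc; exact: mphi.
have cvgF i : {ae P, forall o, (fun j => F_ j o i 0) @ \oo --> phi (X o) (Y o) (Z o) o i 0}.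
  apply: filterS lip => o lip.
  pose D := `|c| * (n%:R + n%:R + n%:R).
  have bnd j : `|F_ j o i 0 - phi (X o) (Y o) (Z o) o i 0| <= D * harmonic j.
    have := entry_le_enorm (F_ j o - phi (X o) (Y o) (Z o) o) i 0.
    rewrite !mxE => /le_trans; apply; apply: (le_trans (lip _ _ _ _ _ _)).
    apply: (@le_trans _ _ (`|c| * (n%:R / j.+1%:R + n%:R / j.+1%:R + n%:R / j.+1%:R))).
      apply: (@le_trans _ _ (`|c| * (enorm (gp j (X o) - X o) + enorm (gp j (Y o) - Y o)
         + enorm (gp j (Z o) - Z o)))).
        by rewrite ler_wpM2r ?ler_norm // !addr_ge0 ?enorm_ge0.
      by apply: ler_wpM2l => //; do 2 ?[apply: lerD]; exact: grid_point_close.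
    by rewrite /D /harmonic /= -!mulrDl mulrA.
  apply/cvgrPdist_le => e e0.
  have hD : (fun j => D * harmonic j) @ \oo --> (0 : R).
    by rewrite -(mulr0 D); apply: cvgM; [exact: cvg_cst|exact: cvg_harmonic].
  move/cvgrPdist_le : hD => /(_ e e0); apply: filterS => j.
  rewrite sub0r normrN => h; rewrite distrC; apply: (le_trans (bnd j)).
  exact: le_trans (ler_norm _) h.
have /choice [g hg] i : exists gi : T -> R,
    gmeas gi /\ {ae P, forall o, phi (X o) (Y o) (Z o) o i 0 = gi o}.
  have [gi h1 h2] := version_of_limit (fun j => mF j i) (cvgF i); by exists gi.
exists (fun o => \col_i g i o).
  move=> i; under eq_fun do rewrite mxE; exact: (hg i).1.
have : {ae P, forall o, forall i, phi (X o) (Y o) (Z o) o i 0 = g i o}.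
  apply: filter_forall => i; exact: (hg i).2.
by apply: filterS => o h; apply/colP => i; rewrite mxE h.
Qed.
End Grid.
End Versions.

(** * Almost sure convergence *)

Section AlmostSureConvergence.
Context {d : measure_display} {T : measurableType d} {R : realType}.
Variable P : probability T R.

Lemma measurable_nneseries (f : nat -> T -> R) : (forall j o, 0 <= f j o) ->
  (forall j, measurable_fun setT (f j)) ->
  measurable_fun setT (fun o => \sum_(0 <= j <oo) (f j o)%:E)%E.
Proof.
move=> f0 mf; apply: (@ge0_emeasurable_sum _ _ _ setT (fun j o => (f j o)%:E) xpredT).
  by move=> j o _ _; rewrite lee_fin.
by move=> j _; exact/measurable_EFinP.
Qed.

(** The square-summable increments are traded for absolutely summable ones
    through [|e| <= t^j + e^2 / t^j], with [t] strictly between [r] and [1]. *)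
Lemma geometric_ae_cvg (X_ : nat -> T -> R) (C r : R) : 0 <= r < 1 ->
  (forall j, sqi P (X_ j)) ->
  (forall j, expect P (fun o => (X_ j.+1 o - X_ j o) ^+ 2) <= C * r ^+ j) ->
  {ae P, forall o, cvgn (X_ ^~ o)}.
Proof.
move=> /andP[r0 r1] sX hX.
pose t := (1 + r) / 2; have t0 : 0 < t by rewrite /t; lra.
have t1 : t < 1 by rewrite /t; lra.
have rt : r / t < 1 by rewrite ltr_pdivrMr // mul1r /t; lra.
have rt0 : 0 <= r / t by rewrite divr_ge0 // ltW.
pose e j o := X_ j.+1 o - X_ j o.
have se j : sqi P (e j) by exact: sqiB.
pose f j o := (t ^+ j)^-1 * e j o ^+ 2.
have f0 j o : 0 <= f j o by rewrite mulr_ge0 ?sqr_ge0 // invr_ge0 exprn_ge0 // ltW.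
have if_ j : integr P (f j) by apply: integrZ; case: (se j).
have mf j : measurable_fun setT (fun o => (f j o)%:E).
  exact/measurable_EFinP/(integr_measurable (if_ j)).
have int_fin : (\int[P]_o \sum_(0 <= j <oo) (f j o)%:E < +oo)%E.
  rewrite integral_nneseries //; last by move=> j o _; rewrite lee_fin.
  apply: (@le_lt_trans _ _ (\sum_(0 <= j <oo) (C * (r / t) ^+ j)%:E)%E).
    apply: lee_nneseries => [j _ _|j _]; first by apply: integral_ge0 => o _; rewrite lee_fin.
    rewrite EFin_expect // lee_fin /f expectZ; last by case: (se j).
    have -> : C * (r / t) ^+ j = t ^- j * (C * r ^+ j).
      by rewrite exprMn exprVn; ring.
    by apply: ler_wpM2l; [rewrite invr_ge0 exprn_ge0 // ltW|exact: hX].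
  by rewrite EFin_rsum ?ltry //; apply: rsummable_geometric; rewrite rt0.
have : P.-integrable setT (fun o => \sum_(0 <= j <oo) (f j o)%:E)%E.
  apply/integrableP; split.
    by apply: measurable_nneseries => // j; exact: integr_measurable (if_ j).
  under eq_integral => o _.
    rewrite gee0_abs; last by apply: nneseries_ge0 => j _ _; rewrite lee_fin.
    over.
  exact: int_fin.
move/integrable_ae => /(_ measurableT); apply: filterS => o /(_ I) fo.
have sf : rsummable (f ^~ o).
  apply: rsummable_of_finite => //; rewrite ltey_eq.
  by rewrite fo.
have se' : rsummable (e ^~ o).
  apply: (le_rsummable (v := fun j => 1 * t ^+ j + f j o)).
    by apply: rsummableD => //; apply: rsummable_geometric; rewrite ltW.
  move=> j; rewrite mul1r /f.
  have tj : 0 < t ^+ j by exact: exprn_gt0.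
  set a := t ^+ j in tj *; set b := e j o.
  rewrite -(ler_pM2l tj) mulrDr mulrA divff ?gt_eqF // mul1r -expr2 -[b ^+ 2]real_normK ?num_real //.
  have := sqr_ge0 (a - `|b|); have := normr_ge0 b; nra.
have : cvgn (fun j => X_ 0%N o + series (e ^~ o) j).
  by apply: is_cvgD => //; exact: is_cvg_cst.
rewrite (_ : (fun j => _) = (X_ ^~ o)) //.
by apply/funext => j; rewrite [RHS](eq_sum_telescope (X_ ^~ o) j).
Qed.

(** The bound is only asked along the tail [m >= j], as a Cauchy condition
    provides it. *)
Lemma fatou_ae (f_ : nat -> T -> R) (f : T -> R) (j : nat) (c : \bar R) :
  (forall m, measurable_fun setT (f_ m)) -> measurable_fun setT f ->
  (forall m o, 0 <= f_ m o) -> (forall o, 0 <= f o) ->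
  {ae P, forall o, f_ ^~ o @ \oo --> f o} ->
  (forall m, (j <= m)%N -> (\int[P]_o (f_ m o)%:E <= c)%E) ->
  (\int[P]_o (f o)%:E <= c)%E.
Proof.
move=> mf_ mf f_0 f0 cf hc.
pose g m o := (f_ (m + j)%N o)%:E.
have mg m : measurable_fun setT (g m) by exact/measurable_EFinP.
have -> : (\int[P]_o (f o)%:E = \int[P]_o limn_einf (g ^~ o))%E.
  apply: ae_eq_integral => //; first exact/measurable_EFinP.
    rewrite (_ : (fun o => _) = (fun o => - limn_esup (fun m => - g m o))%E).
      apply: measurableT_comp => //; apply: measurable_fun_limn_esup => m.
      exact: measurableT_comp.
    by apply/funext => o; rewrite -limn_einfN; congr limn_einf; apply/funext => m; rewrite /comp oppeK.
  apply: filterS cf => o fo _.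
  have /cvg_limn_einf_sup [-> _] // : g ^~ o @ \oo --> (f o)%:E.
  apply: cvg_EFin; first exact: nearW.
  by have := fo; rewrite -(cvg_shiftn j).
apply: le_trans (fatou P measurableT mg _) _; first by move=> m o _; rewrite lee_fin.
rewrite limn_einf_lim; apply: lime_le.
  by apply: is_cvg_einfs.
apply: nearW => m; apply: (@le_trans _ _ (\int[P]_o g m o)%E).
  by apply: ereal_inf_lbound; exists m => /=.
by apply: hc; rewrite leq_addl.
Qed.
End AlmostSureConvergence.

(** * The Hilbert space of adapted processes *)

Section Past.
Context {d : measure_display} {T : measurableType d} {R : realType}.
Variables (P : probability T R) (w : nat -> T -> R).

Lemma past_sigma k : sigma_algebra setT (past w k).
Proof. exact: smallest_sigma_algebra. Qed.

Lemma mem_past k j (B : set R) : (j < k)%N -> measurable B ->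
  past w k (w j @^-1` B).
Proof.
move=> jk mB; apply: sub_sigma_algebra.
rewrite (bigD1 (Ordinal jk)) //=; left; exists B => //.
by rewrite setTI.
Qed.

Lemma past_least k (F : set (set T)) : sigma_algebra setT F ->
  (forall j (B : set R), (j < k)%N -> measurable B -> F (w j @^-1` B)) ->
  past w k `<=` F.
Proof.
move=> sF hF; apply: smallest_sub => //.
elim/big_ind : _ => //= [X Y hX hY A [/hX|/hY]|i _ A [B mB <-]] //.
by rewrite setTI; exact: hF.
Qed.

Lemma past_measurable_sets k : (forall j, measurable_fun setT (w j)) ->
  past w k `<=` measurable.
Proof.
move=> mw; apply: past_least; first exact: sigma_algebra_measurable.
by move=> j B _ mB; rewrite -[X in measurable X]setTI; exact: mw.
Qed.

Lemma past_mono k : past w k `<=` past w k.+1.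
Proof.
apply: past_least; first exact: past_sigma.
by move=> j B jk mB; apply: mem_past => //; exact: leqW.
Qed.

Lemma past_measurable_mono k (X : T -> R) :
  measurable_fun [set: g_sigma_algebraType (past w k)] X ->
  measurable_fun [set: g_sigma_algebraType (past w k.+1)] X.
Proof.
move=> mX _ B mB; rewrite setTI (sub_measurableE (past_sigma k.+1)).
apply: (@past_mono k); apply: (sub_measurableP (past_sigma k)).
by have := mX measurableT B mB; rewrite setTI.
Qed.

Lemma noise_past_measurable k :
  measurable_fun [set: g_sigma_algebraType (past w k.+1)] (w k).
Proof.
move=> _ B mB; rewrite setTI (sub_measurableE (past_sigma k.+1)).
exact: mem_past.
Qed.

Lemma vpast_measurableP n k (g : T -> 'cV[R]_n) :
  past_measurable w k g <-> vgmeas (past w k) g.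
Proof.
split => [h i|h i j]; first exact: h.
by rewrite (ord1 j); exact: h.
Qed.

End Past.

Section WeightedSpace.
Context {d : measure_display} {T : measurableType d} {R : realType} {n : nat}.
Variables (P : probability T R) (w : nat -> T -> R) (rho : R).
Hypothesis mw : forall k, measurable_fun setT (w k).
Local Notation process := (nat -> T -> 'cV[R]_n).
Implicit Types g h : process.

Let subP k : past w k `<=` measurable. Proof. exact: past_measurable_sets. Qed.

Definition weight k : R := expR (- (rho * k%:R)).

Lemma weight_gt0 k : 0 < weight k.
Proof. exact: expR_gt0. Qed.

Lemma weight0 : weight 0 = 1.
Proof. by rewrite /weight mulr0 oppr0 expR0. Qed.

Lemma weightS k : weight k.+1 = expR (- rho) * weight k.
Proof. by rewrite /weight -expRD -natr1; congr expR; ring. Qed.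

Definition energy g k : R := weight k * vip P (g k) (g k).
Definition pairing g h k : R := weight k * vip P (g k) (h k).
Definition ipr g h : R := rsum (pairing g h).

Lemma energy_ge0 g k : 0 <= energy g k.
Proof. by rewrite mulr_ge0 ?vip_ge0 // ltW // weight_gt0. Qed.

Lemma past_vmeasurable k (f : T -> 'cV[R]_n) : vgmeas (past w k) f -> vmeasurable f.
Proof. by move=> mf i; apply: (measurable_sub (past_sigma w k)) => //; exact: mf. Qed.

Lemma rho_norm2_sum g : (forall k, vmeasurable (g k)) ->
  rho_norm2 P rho g =
  (\sum_(0 <= k <oo) (weight k)%:E * \int[P]_o (enorm (g k o) ^+ 2)%:E)%E.
Proof.
move=> mg; rewrite /rho_norm2 integral_nneseries //.
- apply: eq_eseriesr => k _; under eq_integral do rewrite EFinM.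
  rewrite ge0_integralZl_EFin //.
  + by move=> o _; rewrite lee_fin sqr_ge0.
  + exact/measurable_EFinP/vmeasurable_enorm_sqr.
- move=> k; apply/measurable_EFinP/measurable_funM => //.
  exact: vmeasurable_enorm_sqr.
- by move=> k o _; rewrite lee_fin mulr_ge0 ?sqr_ge0 // expR_ge0.
Qed.

Lemma rho_norm2_energy g : (forall k, vsqi P (g k)) ->
  rho_norm2 P rho g = (\sum_(0 <= k <oo) (energy g k)%:E)%E.
Proof.
move=> sg; rewrite rho_norm2_sum => [|k]; last exact: vsqi_measurable (sg k).
by apply: eq_eseriesr => k _; rewrite integral_enorm_sqr // -EFinM.
Qed.

Definition H2 g : Prop :=
  [/\ forall k, vgmeas (past w k) (g k), forall k, vsqi P (g k) & rsummable (energy g)].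

Lemma L2rhoP g : L2rho P w rho g <-> H2 g.
Proof.
split => [[mg fin]|[mg sg sum]].
- have mg' k : vgmeas (past w k) (g k) by exact/vpast_measurableP.
  have vg k : vmeasurable (g k) by exact: past_vmeasurable.
  have I0 k : (0 <= \int[P]_o (enorm (g k o) ^+ 2)%:E)%E.
    by apply: integral_ge0 => o _; rewrite lee_fin sqr_ge0.
  have sg k : vsqi P (g k).
    apply: vsqi_of_finite => //; rewrite ltNge; apply/negP; rewrite leye_eq => /eqP Iy.
    move: fin; rewrite rho_norm2_sum // (@nneseriesD1 _ _ k) //; last first.
      by move=> j _; rewrite mule_ge0 ?I0 // lee_fin ltW // weight_gt0.
    rewrite Iy gt0_muley ?lte_fin ?weight_gt0 // addye // -ltNye.
    apply: (lt_le_trans ltNy0); apply: nneseries_ge0 => j _ _.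
    by rewrite mule_ge0 ?I0 // lee_fin ltW // weight_gt0.
  split => //; apply: rsummable_of_finite; first exact: energy_ge0.
  by rewrite -rho_norm2_energy.
- split; first by move=> k; exact/vpast_measurableP.
  by rewrite rho_norm2_energy // EFin_rsum // ltry.
Qed.

Lemma rho_norm2E g : H2 g -> rho_norm2 P rho g = (ipr g g)%:E.
Proof. by move=> [_ sg sum]; rewrite rho_norm2_energy // EFin_rsum. Qed.

Lemma vip_square a (f f' : T -> 'cV[R]_n) : vsqi P f -> vsqi P f' ->
  vip P (fun o => a *: f o + f' o) (fun o => a *: f o + f' o)
  = a ^+ 2 * vip P f f + 2 * a * vip P f f' + vip P f' f'.
Proof.
move=> sf sf'; have sff := vsqiD (vsqiZ a sf) sf'.
rewrite vip_linear // ![vip P _ (fun o => a *: f o + f' o)]vipC !vip_linear //.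
by rewrite [vip P f' f]vipC; ring.
Qed.

Lemma pairing_le g h k : vsqi P (g k) -> vsqi P (h k) ->
  `|pairing g h k| <= energy g k + energy h k.
Proof.
move=> sg sh; rewrite /pairing normrM gtr0_norm ?weight_gt0 // -mulrDr.
apply: ler_wpM2l; first exact/ltW/weight_gt0.
have key a : a ^+ 2 = 1 -> - (2 * a * vip P (g k) (h k)) <= vip P (g k) (g k) + vip P (h k) (h k).
  move=> a2; have := vip_ge0 P (fun o => a *: g k o + h k o).
  by rewrite vip_square // a2; lra.
have h1 := key 1 (expr1n _ _); have h2 := key (-1) (etrans (sqrrN 1) (expr1n _ _)).
have := vip_ge0 P (g k); have := vip_ge0 P (h k).
rewrite ler_norml; lra.
Qed.

Lemma pairing_summable g h : H2 g -> H2 h -> rsummable (pairing g h).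
Proof.
move=> [_ sg eg] [_ sh eh]; apply: (le_rsummable (v := fun k => energy g k + energy h k)).
  exact: rsummableD.
by move=> k; exact: pairing_le.
Qed.

Lemma H2_lin a g h : H2 g -> H2 h -> H2 (a *: g + h).
Proof.
move=> Hg Hh; have sgh := pairing_summable Hg Hh.
move: Hg Hh => [mg sg eg] [mh sh eh]; split.
- move=> k i.
  have -> : (fun o => (a *: g + h) k o i 0) = (fun o => a * g k o i 0 + h k o i 0).
    by apply/funext => o; rewrite [LHS](_ : _ = (a *: g k o + h k o) i 0) // !mxE.
  by apply: measurable_funD; [apply: measurable_funM => //; exact: mg|exact: mh].
- by move=> k; exact: vsqiD (vsqiZ a (sg k)) (sh k).
- have e k : energy (a *: g + h) k = a ^+ 2 * energy g k + 2 * a * pairing g h k + energy h k.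
    rewrite /energy /pairing; have sk := vsqiD (vsqiZ a (sg k)) (sh k).
    rewrite [vip P _ _](_ : _ = vip P (fun o => a *: g k o + h k o) (fun o => a *: g k o + h k o)) //.
    by rewrite vip_square //; ring.
  rewrite (_ : energy _ = fun k => (a ^+ 2 * energy g k + 2 * a * pairing g h k) + energy h k);
    last exact/funext.
  by apply: rsummableD => //; apply: rsummableD; apply: rsummableZ.
Qed.

Lemma H2_0 : H2 0.
Proof.
split.
- move=> k i; exact: measurable_cst.
- by move=> k; exact: vsqi_cst.
- rewrite (_ : energy 0 = fun=> 0); first exact: rsummable0.
  apply/funext => k; rewrite /energy /vip; under [X in expect _ X]eq_fun do rewrite inner0l.
  by rewrite /expect Rintegral_cst // mul0r mulr0.
Qed.

Lemma H2B g h : H2 g -> H2 h -> H2 (g - h).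
Proof.
move=> Hg Hh; have := H2_lin (-1) Hh Hg.
by rewrite scaleN1r addrC.
Qed.

Lemma ipr_sym g h : ipr g h = ipr h g.
Proof. by congr rsum; apply/funext => k; rewrite /pairing vipC. Qed.

Lemma ipr_linear a g g' h : H2 g -> H2 g' -> H2 h ->
  ipr (a *: g + g') h = a * ipr g h + ipr g' h.
Proof.
move=> Hg Hg' Hh; have s1 := pairing_summable Hg Hh; have s2 := pairing_summable Hg' Hh.
rewrite /ipr -rsumZ // -rsumD //; last exact: rsummableZ.
move: Hg Hg' Hh => [_ sg _] [_ sg' _] [_ sh _].
congr rsum; apply/funext => k; rewrite /pairing.
by rewrite [vip P _ _](_ : _ = vip P (fun o => a *: g k o + g' k o) (h k)) // vip_linear //; ring.
Qed.

Lemma ipr_ge0 g : H2 g -> 0 <= ipr g g.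
Proof. by move=> [_ _ eg]; apply: rsum_ge0 => // k; exact: energy_ge0. Qed.

Lemma energy_le_ipr g k : H2 g -> energy g k <= ipr g g.
Proof. by move=> [_ _ eg]; apply: term_le_rsum => // j; exact: energy_ge0. Qed.

(** Each entry converges almost surely along the whole sequence, and Fatou's
    lemma carries the Cauchy bound over to the limit. *)
Lemma H2_complete (u_ : nat -> process) (C r : R) : 0 <= r < 1 ->
  (forall j, H2 (u_ j)) ->
  (forall j m, (j <= m)%N -> ipr (u_ j - u_ m) (u_ j - u_ m) <= C * r ^+ j) ->
  exists2 v, H2 v & forall j, ipr (u_ j - v) (u_ j - v) <= C * r ^+ j.
Proof.
move=> r01 Hu hu.
have su j k : vsqi P (u_ j k) by case: (Hu j).
have mu j k : vgmeas (past w k) (u_ j k) by case: (Hu j).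
have Hd j m := H2B (Hu j) (Hu m).
have sd j m k : vsqi P ((u_ j - u_ m) k) by case: (Hd j m).
have incr k i j : expect P (fun o => (u_ j.+1 k o i 0 - u_ j k o i 0) ^+ 2)
    <= C / weight k * r ^+ j.
  have h1 := energy_le_ipr k (Hd j j.+1); have h2 := hu j j.+1 (leqnSn _).
  rewrite mulrAC ler_pdivlMr ?weight_gt0 // mulrC.
  apply: le_trans (le_trans h1 h2); rewrite /energy.
  apply: ler_wpM2l; first exact/ltW/weight_gt0.
  rewrite vipE // (bigD1 i) //= -[leLHS]addr0; apply: lerD.
    rewrite le_eqVlt; apply/orP; left; apply/eqP; congr expect; apply/funext => o.
    rewrite [(u_ j - u_ j.+1) k o](_ : _ = u_ j k o - u_ j.+1 k o) // !mxE.
    by rewrite -expr2 -sqrrN opprB.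
  by apply: sumr_ge0 => l _; apply: expect_ge0 => o; rewrite -expr2 sqr_ge0.
have cvgu k i : {ae P, forall o, cvgn (fun j => u_ j k o i 0)}.
  by apply: (geometric_ae_cvg (X_ := fun j o => u_ j k o i 0) r01 (fun j => su j k i)); exact: incr.
have /choice [v hv] (ki : nat * 'I_n) : exists v : T -> R,
    measurable_fun [set: g_sigma_algebraType (past w ki.1)] v /\
    {ae P, forall o, (fun j => u_ j ki.1 o ki.2 0) @ \oo --> v o}.
  case: ki => k i /=.
  have [v mv ev] := version_of_limit (P := P) (X := fun o => limn (fun j => u_ j k o i 0))
     (fun j => mu j k i) (cvgu k i).
  exists v; split => //; apply: filterS2 (cvgu k i) ev => o; move=> h <-; exact: h.
pose V : process := fun k o => \col_i v (k, i) o.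
have mV k : vgmeas (past w k) (V k).
  by move=> i; under eq_fun do rewrite mxE; exact: (hv (k, i)).1.
have vV k : vmeasurable (V k) by exact: past_vmeasurable.
have vu j k : vmeasurable (u_ j k) by exact: past_vmeasurable.
have cV : {ae P, forall o, forall k i, (fun j => u_ j k o i 0) @ \oo --> V k o i 0}.
  apply: ae_foralln => k; apply: filter_forall => i.
  by apply: filterS (hv (k, i)).2 => o; rewrite mxE.
have mB (a b : T -> 'cV[R]_n) : vmeasurable a -> vmeasurable b -> vmeasurable (fun o => a o - b o).
  by move=> ma mb i; under eq_fun do rewrite !mxE; exact: measurable_funB.
have mterm (a b : process) k : vmeasurable (a k) -> vmeasurable (b k) ->
    measurable_fun setT (fun o => weight k * enorm (a k o - b k o) ^+ 2).
  by move=> ma mb; apply: measurable_funM => //; apply: vmeasurable_enorm_sqr; exact: mB.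
have t0 (a : 'cV[R]_n) k : 0 <= weight k * enorm a ^+ 2.
  by rewrite mulr_ge0 ?sqr_ge0 // ltW // weight_gt0.
have Ipart j m K : (j <= m)%N ->
    (\int[P]_o (\sum_(0 <= k < K) weight k * enorm (u_ j k o - u_ m k o) ^+ 2)%:E
      <= (C * r ^+ j)%:E)%E.
  move=> jm; under eq_integral do rewrite -sumEFin.
  rewrite ge0_integral_sum //; last first.
  - by move=> k o _; rewrite lee_fin.
  - by move=> k; apply/measurable_EFinP; exact: mterm.
  apply: (@le_trans _ _ (\sum_(0 <= k < K) energy (u_ j - u_ m) k)%:E).
    rewrite -sumEFin le_eqVlt; apply/orP; left; apply/eqP; apply: eq_bigr => k _.
    under eq_integral do rewrite EFinM.
    rewrite ge0_integralZl_EFin //.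
    + by rewrite (integral_enorm_sqr (sd j m k)) -EFinM.
    + by move=> o _; rewrite lee_fin sqr_ge0.
    + by apply/measurable_EFinP/vmeasurable_enorm_sqr; exact: mB.
    + exact/ltW/weight_gt0.
  rewrite lee_fin (le_trans _ (hu j m jm)) //; apply: partial_le_rsum.
    by case: (Hd j m).
  exact: energy_ge0.
have bound j : (rho_norm2 P rho (u_ j - V)%R <= (C * r ^+ j)%:E)%E.
  rewrite rho_norm2_sum; last by move=> k; exact: mB.
  apply: lime_le.
    apply: is_cvg_nneseries => k _ _.
    apply: mule_ge0; first by rewrite lee_fin ltW // weight_gt0.
    by apply: integral_ge0 => o _; rewrite lee_fin sqr_ge0.
  apply: nearW => K.
  have -> : (\sum_(0 <= k < K) (weight k)%:E * \int[P]_o (enorm ((u_ j - V)%R k o) ^+ 2)%:E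
     = \int[P]_o (\sum_(0 <= k < K) weight k * enorm (u_ j k o - V k o) ^+ 2)%:E)%E.
    under [RHS]eq_integral do rewrite -sumEFin.
    rewrite ge0_integral_sum //; last first.
    - by move=> k o _; rewrite lee_fin.
    - by move=> k; apply/measurable_EFinP; exact: mterm.
    apply: eq_bigr => k _; under [RHS]eq_integral do rewrite EFinM.
    rewrite ge0_integralZl_EFin //.
    + by move=> o _; rewrite lee_fin sqr_ge0.
    + by apply/measurable_EFinP/vmeasurable_enorm_sqr; exact: mB.
    + exact/ltW/weight_gt0.
  apply: (fatou_ae (j := j)
     (f_ := fun m o => \sum_(0 <= k < K) weight k * enorm (u_ j k o - u_ m k o) ^+ 2)).
  - by move=> m; apply: measurable_sum => k; exact: mterm.
  - by apply: measurable_sum => k; exact: mterm.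
  - by move=> m o; apply: sumr_ge0.
  - by move=> o; apply: sumr_ge0.
  - apply: filterS cV => o co.
    apply: (cvg_finite_sum (F := fun k m => weight k * enorm (u_ j k o - u_ m k o) ^+ 2)) => k.
    apply: cvgM; first exact: cvg_cst.
    rewrite enorm_sqr inner_colE.
    under eq_fun do rewrite enorm_sqr inner_colE.
    apply: (cvg_finite_sum (F := fun i m => (u_ j k o - u_ m k o) i 0 * (u_ j k o - u_ m k o) i 0)) => i.
    have eB (a b : 'cV[R]_n) : (a - b) i 0 = a i 0 - b i 0 by rewrite !mxE.
    rewrite eB; under eq_fun do rewrite eB.
    by apply: cvgM; (apply: cvgB; [exact: cvg_cst|exact: co]).
  - by move=> m jm; exact: Ipart.
have HdV j : H2 (u_ j - V).
  apply/L2rhoP; split; last by apply: le_lt_trans (bound j) _; rewrite ltry.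
  move=> k; apply/vpast_measurableP => i.
  have -> : (fun o => (u_ j - V) k o i 0) = (fun o => u_ j k o i 0 - v (k, i) o).
    by apply/funext => o; rewrite [LHS](_ : _ = (u_ j k o - V k o) i 0) // !mxE.
  by apply: measurable_funB; [exact: mu|exact: (hv (k, i)).1].
exists V.
  have -> : V = u_ 0%N - (u_ 0%N - V) by rewrite opprB addrC subrK.
  exact: H2B.
by move=> j; rewrite -lee_fin -rho_norm2E.
Qed.

Theorem H2_hilbert : hilbert_form H2 ipr.
Proof.
split.
- exact: H2_0.
- exact: H2_lin.
- by move=> u v _ _; exact: ipr_sym.
- exact: ipr_linear.
- exact: ipr_ge0.
- move=> u_ C r r01 Hu hu; have [v Hv hv] := H2_complete r01 Hu hu.
  by exists v => //; exists C.
Qed.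

Lemma ipr_eq0 g : H2 g -> ipr g g = 0 -> forall k, {ae P, forall o, g k o = 0}.
Proof.
move=> Hg g0 k; case: (Hg) => _ sg _; apply: vip_eq0 => //.
have := energy_le_ipr k Hg; rewrite g0 => h.
have := energy_ge0 g k; rewrite /energy in h * => h'.
have /eqP : weight k * vip P (g k) (g k) = 0 by lra.
by rewrite mulf_eq0 gt_eqF ?weight_gt0 //= => /eqP.
Qed.
End WeightedSpace.

(** * The forward map and its adjoint *)

Section Forward.
Context {d : measure_display} {T : measurableType d} {R : realType} {n : nat}.
Variables (P : probability T R) (w : nat -> T -> R) (rho : R).
Hypothesis nw : normalized_martingale_difference P w.
Local Notation process := (nat -> T -> 'cV[R]_n).
Local Notation H := (H2 P w rho).
Local Notation ip := (ipr P rho).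
Local Notation N g := (ip g g).
Implicit Types x y b s g h : process.

Lemma noise_measurable k : measurable_fun setT (w k).
Proof. by case: (nw k). Qed.

Let mw := noise_measurable.
Let sigP k : sigma_algebra setT (past w k) := past_sigma w k.
Let subP k : past w k `<=` measurable := past_measurable_sets mw.
Let cw1 k : is_cond_exp P (past w k) (w k) (cst 0). Proof. by case: (nw k). Qed.
Let cw2 k : is_cond_exp P (past w k) (fun o => w k o ^+ 2) (cst 1).
Proof. by case: (nw k). Qed.

Definition forward (a : T -> 'cV[R]_n) b s : process :=
  fun k o => if k is j.+1 then b j o + w j o *: s j o else a o.

Lemma forwardB a a' b b' s s' : forward a b s - forward a' b' s'
  = forward (fun o => a o - a' o) (b - b') (s - s').
Proof.
apply/funext => -[|k]; apply/funext => o //=.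
transitivity ((b k o + w k o *: s k o) - (b' k o + w k o *: s' k o)) => //.
by rewrite opprD addrACA -scalerBr.
Qed.

Lemma forward_energy a b s k : H b -> H s ->
  energy P rho (forward a b s) k.+1
  = expR (- rho) * (energy P rho b k + energy P rho s k).
Proof.
move=> [mb sb _] [ms ss _]; rewrite /energy /= weightS.
by rewrite (vnoise_norm (@sigP k) (@subP k) (mw k) (cw1 k) (cw2 k)) //; ring.
Qed.

Lemma forward_mem a b s : vgmeas (past w 0) a -> vsqi P a -> H b -> H s ->
  H (forward a b s).
Proof.
move=> ma sa Hb Hs; have [mb sb eb] := Hb; have [ms ss es] := Hs; split.
- case=> [|k] //= i.
  rewrite (_ : (fun o => _) = (fun o => b k o i 0 + w k o * s k o i 0)); last first.
    by apply/funext => o; rewrite !mxE.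
  apply: measurable_funD; first exact: (past_measurable_mono (mb k i)).
  apply: measurable_funM; first exact: noise_past_measurable.
  exact: (past_measurable_mono (ms k i)).
- case=> [|k] //=; apply: vsqiD => //.
  exact: (vnoise_vsqi (@sigP k) (@subP k) (mw k) (cw2 k)).
- apply: rsummable_unshift.
  rewrite (_ : (fun k => _) = (fun k => expR (- rho) * (energy P rho b k + energy P rho s k))).
    by apply: rsummableZ; exact: rsummableD.
  by apply/funext => k; exact: forward_energy.
Qed.

(** The noise is orthogonal to the past and of unit variance, so the squares add
    up; the delay of one step gives the factor [expR (- rho)]. *)
Lemma forward_norm a b s : vgmeas (past w 0) a -> vsqi P a -> H b -> H s ->
  N (forward a b s) = vip P a a + expR (- rho) * (N b + N s).
Proof.
move=> ma sa Hb Hs; have [_ _ e] := forward_mem ma sa Hb Hs.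
rewrite /ipr [LHS]rsum_recl //; congr (_ + _); first by rewrite /pairing weight0 mul1r.
have [_ _ eb] := Hb; have [_ _ es] := Hs.
rewrite -(rsumD eb es) -(rsumZ _ (rsummableD eb es)).
by congr rsum; apply/funext => k; exact: forward_energy.
Qed.

(** A relation rather than a pair of functions: chosen versions of conditional
    expectations are only almost surely linear in [y], while differences of
    predictors of [y1] and [y2] are predictors of [y1 - y2]. *)
Definition predictors (y y' z' : process) : Prop := forall k,
  is_cond_expv P (past w k) (y k.+1) (y' k) /\
  (forall i, is_cond_exp P (past w k) (fun o => w k o * y k.+1 o i 0)
     (fun o => z' k o i 0)).

Lemma predictorsB y1 y1' z1' y2 y2' z2' : predictors y1 y1' z1' ->
  predictors y2 y2' z2' -> predictors (y1 - y2) (y1' - y2') (z1' - z2').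
Proof.
move=> h1 h2 k; have [c1 n1] := h1 k; have [c2 n2] := h2 k.
split; first exact: (is_cond_expvB (@subP k) c1 c2).
move=> i; have := is_cond_expB (@subP k) (n1 i) (n2 i).
rewrite [X in is_cond_exp _ _ X _ -> _]
  (_ : _ = (fun o => w k o * (y1 - y2) k.+1 o i 0)); last first.
  apply/funext => o; rewrite [RHS](_ : _ = w k o * (y1 k.+1 o - y2 k.+1 o) i 0) //.
  by rewrite !mxE mulrBr.
rewrite [X in is_cond_exp _ _ _ X -> _](_ : _ = (fun o => (z1' - z2') k o i 0)) //.
apply/funext => o; rewrite [RHS](_ : _ = (z1' k o - z2' k o) i 0) //.
by rewrite !mxE.
Qed.

Lemma predictors_pred y : H y -> predictors y (y_pred P w y) (z_pred P w y).
Proof.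
move=> [_ sy _] k; split; first exact: (cond_expvP (@sigP k) (@subP k)).
exact: (cond_expv_noiseP (@sigP k) (@subP k) (mw k) (cw2 k)).
Qed.

(** The predictors at time [k] come from [y] at time [k + 1], whence the factor
    [expR rho]. *)
Lemma predictors_bessel y y' z' : H y -> predictors y y' z' ->
  [/\ H y', H z' & N y' + N z' <= expR rho * N y].
Proof.
move=> [my sy ey] hp.
have B k : [/\ vsqi P (y' k), vsqi P (z' k) &
    vip P (y' k) (y' k) + vip P (z' k) (z' k) <= vip P (y k.+1) (y k.+1)].
  have [c1 c2] := hp k.
  exact: (vcond_bessel (@sigP k) (@subP k) (mw k) (cw1 k) (cw2 k) (sy k.+1) c1 c2).
have eyS : rsummable (fun k => expR rho * energy P rho y k.+1).
  by apply: rsummableZ; exact: rsummable_shift.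
have le k : energy P rho y' k + energy P rho z' k <= expR rho * energy P rho y k.+1.
  have [_ _ h] := B k; rewrite /energy weightS !mulrA -expRD subrr expR0 mul1r -mulrDr.
  by apply: ler_wpM2l => //; exact/ltW/weight_gt0.
have Hy' : H y'.
  split; [|by move=> k; case: (B k)|].
    by move=> k i; have [c1 _] := hp k; case: (c1 i).
  apply: (le_rsummable eyS) => k; rewrite ger0_norm ?energy_ge0 //.
  by apply: le_trans (le k); rewrite lerDl energy_ge0.
have Hz' : H z'.
  split; [|by move=> k; case: (B k)|].
    by move=> k i; have [_ c2] := hp k; case: (c2 i).
  apply: (le_rsummable eyS) => k; rewrite ger0_norm ?energy_ge0 //.
  by apply: le_trans (le k); rewrite lerDr energy_ge0.
split => //; have [_ _ ey'] := Hy'; have [_ _ ez'] := Hz'.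
rewrite /ipr -(rsumD ey' ez') (_ : rsum (pairing P rho y y) = rsum (energy P rho y)) //.
rewrite [leRHS](_ : _ = expR rho * energy P rho y 0%N +
    rsum (fun k => expR rho * energy P rho y k.+1)); last first.
  rewrite rsumZ; last exact: rsummable_shift.
  by rewrite -mulrDr -rsum_recl.
rewrite -[leLHS]add0r; apply: lerD; first by rewrite mulr_ge0 ?expR_ge0 ?energy_ge0.
exact: (le_rsum (rsummableD ey' ez') eyS le).
Qed.

(** Summation by parts: pairing with a forward process moves the shift and the
    noise onto the other factor, where they become the two predictors. *)
Lemma forward_pairing a b s y y' z' : vgmeas (past w 0) a -> vsqi P a -> H b ->
  H s -> H y -> predictors y y' z' ->
  ip (forward a b s) y
  = vip P a (y 0%N) + expR (- rho) * (ip b y' + ip s z').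
Proof.
move=> ma sa Hb Hs Hy hp; have [Hy' Hz' _] := predictors_bessel Hy hp.
have Hf := forward_mem ma sa Hb Hs.
rewrite /ipr [LHS]rsum_recl; last exact: (pairing_summable Hf Hy).
congr (_ + _); first by rewrite /pairing weight0 mul1r.
have s1 := pairing_summable Hb Hy'; have s2 := pairing_summable Hs Hz'.
rewrite -(rsumD s1 s2) -(rsumZ _ (rsummableD s1 s2)).
congr rsum; apply/funext => k; rewrite /pairing weightS /=.
have [mb sb _] := Hb; have [ms ss _] := Hs; have [_ sy _] := Hy.
have [_ sy' _] := Hy'; have [_ sz' _] := Hz'; have [c1 c2] := hp k.
by rewrite (vcond_pull (@sigP k) (@subP k) (mw k) (cw2 k) _ _ _ _ (sy k.+1)
  (sy' k) (sz' k) c1 c2) //; ring.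
Qed.

(** * Comparison of processes *)

Lemma ip_ae_eq0 g : (forall k, vsqi P (g k)) -> (forall k, {ae P, forall o, g k o = 0}) -> N g = 0.
Proof.
move=> sg g0; rewrite /ipr -[RHS](@rsum0 R); congr rsum; apply/funext => k.
rewrite /pairing (_ : vip _ _ _ = 0) ?mulr0 //.
have s0 : vsqi P (cst 0 : T -> 'cV[R]_n) by exact: vsqi_cst.
rewrite (ae_eq_vip (h := cst 0) (h' := cst 0) (sg k) (sg k)) //.
rewrite /vip; under [X in expect _ X]eq_fun do rewrite inner0l.
by rewrite /expect Rintegral_cst // mul0r.
Qed.

Lemma ip_ae_eq g h : (forall k, vsqi P (g k)) -> (forall k, vsqi P (h k)) ->
  (forall k, {ae P, forall o, g k o = h k o}) -> N g = N h.
Proof.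
move=> sg sh gh; rewrite /ipr; congr rsum; apply/funext => k.
by rewrite /pairing (ae_eq_vip (sg k) (sg k) (sh k) (sh k) (gh k) (gh k)).
Qed.

Lemma ae_lipschitz1 (D X : T -> 'cV[R]_n) (al : R) : vsqi P D -> vsqi P X ->
  {ae P, forall o, enorm (D o) <= al * enorm (X o)} ->
  vip P D D <= al ^+ 2 * vip P X X.
Proof.
move=> sD sX h; rewrite -(expectZ _ (vip_integr sX sX)).
apply: ae_le_expect; [exact: vip_integr|by apply: integrZ; exact: vip_integr|].
apply: filterS h => o h; rewrite -!enorm_sqr -exprMn.
by have := enorm_ge0 (D o); nra.
Qed.

Lemma ae_lipschitz2 (D X Y : T -> 'cV[R]_n) (al be : R) : vsqi P D -> vsqi P X ->
  vsqi P Y -> 0 <= al -> 0 <= be ->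
  {ae P, forall o, enorm (D o) <= al * enorm (X o) + be * enorm (Y o)} ->
  vip P D D <= 2 * al ^+ 2 * vip P X X + 2 * be ^+ 2 * vip P Y Y.
Proof.
move=> sD sX sY al0 be0 h.
have iX := vip_integr sX sX; have iY := vip_integr sY sY.
rewrite -(expectZ _ iX) -(expectZ _ iY) -expectD; try exact: integrZ.
apply: ae_le_expect; [exact: vip_integr|by apply: integrD; exact: integrZ|].
apply: filterS h => o h; rewrite -!enorm_sqr.
have := enorm_ge0 (D o); have := mulr_ge0 al0 (enorm_ge0 (X o)).
have := mulr_ge0 be0 (enorm_ge0 (Y o)); move: h.
rewrite -[2 * al ^+ 2 * _]mulrA -[2 * be ^+ 2 * _]mulrA -!exprMn.
set a := al * _; set b := be * _; have := sqr_ge0 (a - b); nra.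
Qed.

Lemma ae_lipschitz3 (D X Y Z : T -> 'cV[R]_n) (al be ga : R) : vmeasurable D ->
  vsqi P X -> vsqi P Y -> vsqi P Z -> 0 <= al -> 0 <= be -> 0 <= ga ->
  {ae P, forall o, enorm (D o) <= al * enorm (X o) + be * enorm (Y o) + ga * enorm (Z o)} ->
  vsqi P D /\ vip P D D <=
    3 * al ^+ 2 * vip P X X + 3 * be ^+ 2 * vip P Y Y + 3 * ga ^+ 2 * vip P Z Z.
Proof.
move=> mD sX sY sZ al0 be0 ga0 h.
have iX := vip_integr sX sX; have iY := vip_integr sY sY; have iZ := vip_integr sZ sZ.
pose M o := 3 * al ^+ 2 * inner (X o) (X o) + 3 * be ^+ 2 * inner (Y o) (Y o)
            + 3 * ga ^+ 2 * inner (Z o) (Z o).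
have iM : integr P M by apply: integrD; [apply: integrD|]; exact: integrZ.
have DM : {ae P, forall o, enorm (D o) ^+ 2 <= M o}.
  apply: filterS h => o h; rewrite /M -!enorm_sqr.
  have := enorm_ge0 (D o); have := mulr_ge0 al0 (enorm_ge0 (X o)).
  have := mulr_ge0 be0 (enorm_ge0 (Y o)); have := mulr_ge0 ga0 (enorm_ge0 (Z o)); move: h.
  rewrite -[3 * al ^+ 2 * _]mulrA -[3 * be ^+ 2 * _]mulrA -[3 * ga ^+ 2 * _]mulrA -!exprMn.
  set a := al * _; set b := be * _; set c := ga * _.
  have := sqr_ge0 (a - b); have := sqr_ge0 (a - c); have := sqr_ge0 (b - c); nra.
have M0 o : 0 <= M o.
  by rewrite /M !addr_ge0 // mulr_ge0 ?inner_ge0 // mulr_ge0 // sqr_ge0.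
have sD : vsqi P D.
  apply: vsqi_of_finite => //; apply: (@le_lt_trans _ _ (\int[P]_o (M o)%:E)%E); last first.
    by rewrite EFin_expect // ltry.
  apply: ae_ge0_le_integral => //.
  - by move=> o _; rewrite lee_fin sqr_ge0.
  - exact/measurable_EFinP/vmeasurable_enorm_sqr.
  - by move=> o _; rewrite lee_fin.
  - exact/measurable_EFinP/(integr_measurable iM).
  - by apply: filterS DM => o ? _; rewrite lee_fin.
split => //.
rewrite -(expectZ _ iX) -(expectZ _ iY) -(expectZ _ iZ) -!expectD; try exact: integrZ; last first.
  by apply: integrD; exact: integrZ.
apply: ae_le_expect => //; first exact: vip_integr.
by apply: filterS DM => o; rewrite enorm_sqr.
Qed.

End Forward.

(** * Size of the data *)

Section DataSize.
Context {d : measure_display} {T : measurableType d} {R : realType} {n : nat}.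
Variables (P : probability T R) (w : nat -> T -> R) (rho : R).
Hypothesis mw : forall k, measurable_fun setT (w k).
Local Notation process := (nat -> T -> 'cV[R]_n).
Local Notation H := (H2 P w rho).
Local Notation N g := (ipr P rho g g).

Let msq (g : process) : H g -> forall k, measurable_fun setT
  (fun o => expR (- (rho * k%:R)) * enorm (g k o) ^+ 2).
Proof.
move=> [_ sg _] k; apply: measurable_funM => //.
exact/vmeasurable_enorm_sqr/(vsqi_measurable (sg k)).
Qed.

Let esum0 (g : process) o :
  (0 <= \sum_(0 <= k <oo) (expR (- (rho * k%:R)) * enorm (g k o) ^+ 2)%:E)%E.
Proof.
by apply: nneseries_ge0 => k _ _; rewrite lee_fin mulr_ge0 ?expR_ge0 ?sqr_ge0.
Qed.

Let mesum (g : process) : H g -> measurable_fun setT (fun o =>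
  \sum_(0 <= k <oo) (expR (- (rho * k%:R)) * enorm (g k o) ^+ 2)%:E)%E.
Proof.
move=> Hg; apply: measurable_nneseries; last exact: msq.
by move=> k o; rewrite mulr_ge0 ?expR_ge0 ?sqr_ge0.
Qed.

(** The data may fail to be measurable on a null set, so completeness of the
    probability is what makes the integral additive. *)
Lemma data_sizeE (gb gs gf b s f : process) (gL a : T -> 'cV[R]_n) :
  measure_is_complete P -> H b -> H s -> H f -> vsqi P a ->
  (forall k, {ae P, forall o, gb k o = b k o}) ->
  (forall k, {ae P, forall o, gs k o = s k o}) ->
  (forall k, {ae P, forall o, gf k o = f k o}) ->
  {ae P, forall o, gL o = a o} ->
  data_size P rho gb gs gf gL = (N b + N s + expR (- rho) * N f + vip P a a)%:E.
Proof.
move=> complP Hb Hs Hf sa eb es ef eL.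
have wS o k : (expR (- (rho * k.+1%:R)) * enorm (f k o) ^+ 2)%:E
    = ((expR (- rho))%:E * (expR (- (rho * k%:R)) * enorm (f k o) ^+ 2)%:E)%E.
  by rewrite -EFinM [in RHS]mulrA -(weightS rho k).
pose Sum (g : process) o :=
  (\sum_(0 <= k <oo) (expR (- (rho * k%:R)) * enorm (g k o) ^+ 2)%:E)%E.
pose I o := (Sum b o + Sum s o + (expR (- rho))%:E * Sum f o + (enorm (a o) ^+ 2)%:E)%E.
have ma : measurable_fun setT (fun o => (enorm (a o) ^+ 2)%:E).
  exact/measurable_EFinP/vmeasurable_enorm_sqr/vsqi_measurable.
have mI : measurable_fun setT I.
  apply: emeasurable_funD => //; apply: emeasurable_funD; last first.
    by apply: measurable_funeM; exact: mesum.
  by apply: emeasurable_funD; exact: mesum.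
have I0 o : (0 <= I o)%E.
  by rewrite /I !adde_ge0 ?esum0 ?mule_ge0 ?esum0 ?lee_fin ?expR_ge0 ?sqr_ge0.
have eI : {ae P, forall o, I o =
    (\sum_(0 <= k <oo) (expR (- (rho * k%:R)) * enorm (gb k o) ^+ 2)%:E
     + \sum_(0 <= k <oo) (expR (- (rho * k%:R)) * enorm (gs k o) ^+ 2)%:E
     + \sum_(0 <= k <oo) (expR (- (rho * k.+1%:R)) * enorm (gf k o) ^+ 2)%:E
     + (enorm (gL o) ^+ 2)%:E)%E}.
  have := ae_foralln eb; apply: filterS3 (ae_foralln es) (filterI (ae_foralln ef) eL).
  move=> o hs [hf hL] hb; rewrite /I hL /Sum; congr (_ + _ + _ + _)%E.
  - by apply: eq_eseriesr => k _; rewrite hb.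
  - by apply: eq_eseriesr => k _; rewrite hs.
  - rewrite -nneseriesZl; last first.
      by move=> k _; rewrite lee_fin mulr_ge0 ?expR_ge0 ?sqr_ge0.
    by apply: eq_eseriesr => k _; rewrite -wS hf.
rewrite /data_size -(@ge0_ae_eq_integral _ _ _ P setT I) //; first last.
- by apply: filterS eI => o h _.
- move=> o _; apply: adde_ge0; last by rewrite lee_fin sqr_ge0.
  apply: adde_ge0; first by apply: adde_ge0; exact: esum0.
  by apply: nneseries_ge0 => k _ _; rewrite lee_fin mulr_ge0 ?expR_ge0 ?sqr_ge0.
- by apply: (ae_measurable_fun complP) mI; apply: filterS eI => o h _.
have Sum0 g o : (0 <= Sum g o)%E by exact: esum0.
have mSum g : H g -> measurable_fun setT (Sum g) by exact: mesum.
have ISum g : H g -> (\int[P]_o Sum g o = (N g)%:E)%E.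
  by move=> Hg; rewrite -(rho_norm2E Hg).
have intD (f1 f2 : T -> \bar R) : measurable_fun setT f1 -> measurable_fun setT f2 ->
    (forall o, 0 <= f1 o)%E -> (forall o, 0 <= f2 o)%E ->
    (\int[P]_o (f1 o + f2 o) = \int[P]_o f1 o + \int[P]_o f2 o)%E.
  by move=> m1 m2 p1 p2; apply: ge0_integralD.
have m2 := emeasurable_funD (mSum _ Hb) (mSum _ Hs).
have m3 : measurable_fun setT (fun o => (expR (- rho))%:E * Sum f o)%E.
  by apply: measurable_funeM; exact: mSum.
have p2 o : (0 <= Sum b o + Sum s o)%E by rewrite adde_ge0 ?Sum0.
have p3 o : (0 <= (expR (- rho))%:E * Sum f o)%E.
  by rewrite mule_ge0 ?Sum0 ?lee_fin ?expR_ge0.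
rewrite (intD _ _ (emeasurable_funD m2 m3) ma) => [|o|o]; first last.
- by rewrite lee_fin sqr_ge0.
- by rewrite adde_ge0.
rewrite (intD _ _ m2 m3) // (intD _ _ (mSum _ Hb) (mSum _ Hs)) //.
rewrite integral_enorm_sqr // ge0_integralZl_EFin ?expR_ge0 //; last exact: mSum.
by rewrite !ISum.
Qed.
End DataSize.

(** * The operators of the system *)

Section Operators.
Context {d : measure_display} {T : measurableType d} {R : realType} {n : nat}.
Variables (P : probability T R) (w : nat -> T -> R) (rho : R).
Hypothesis nw : normalized_martingale_difference P w.
Local Notation process := (nat -> T -> 'cV[R]_n).
Local Notation H := (H2 P w rho).
Local Notation ip := (ipr P rho).
Local Notation N g := (ip g g).
Implicit Types x y b s g h : process.

Let mw := noise_measurable nw.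
Let sigP k : sigma_algebra setT (past w k) := past_sigma w k.
Let subP k : past w k `<=` measurable := past_measurable_sets mw.

(** As the Lipschitz condition holds only almost surely, a coefficient evaluated along
    adapted processes need not be adapted; this picks an adapted process equal
    to it almost surely. *)
Definition past_version k (f : T -> 'cV[R]_n) : T -> 'cV[R]_n :=
  xget (cst 0) [set g | vgmeas (past w k) g /\ {ae P, forall o, f o = g o}].

Lemma past_versionP k f :
  (exists2 g, vgmeas (past w k) g & {ae P, forall o, f o = g o}) ->
  vgmeas (past w k) (past_version k f) /\
  {ae P, forall o, f o = past_version k f o}.
Proof.
move=> [g mg fg].
pose A := [set g | vgmeas (past w k) g /\ {ae P, forall o, f o = g o}].
by have : A (xget (cst 0) A) by apply: xgetPex; exists g.
Qed.

(** The version exists by approximation of the arguments, and its square-summability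
    follows from comparison with the coefficient at the origin. *)
Lemma coefficient_version
    (phi : nat -> 'cV[R]_n -> 'cV[R]_n -> 'cV[R]_n -> T -> 'cV[R]_n)
    (al be ga : R) (X Y Z : process) :
  0 <= al -> 0 <= be -> 0 <= ga ->
  (forall k u v t, vgmeas (past w k) (phi k u v t)) ->
  (forall k, {ae P, forall o, forall u v t ub vb tb,
    enorm (phi k u v t o - phi k ub vb tb o) <=
      al * enorm (u - ub) + be * enorm (v - vb) + ga * enorm (t - tb)}) ->
  H (fun k => phi k 0 0 0) -> H X -> H Y -> H Z ->
  H (fun k => past_version k (fun o => phi k (X k o) (Y k o) (Z k o) o)) /\
  forall k, {ae P, forall o, phi k (X k o) (Y k o) (Z k o) o =
    past_version k (fun o => phi k (X k o) (Y k o) (Z k o) o) o}.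
Proof.
move=> al0 be0 ga0 mphi lip H0 HX HY HZ.
set g := fun k => past_version k _.
have gP k : vgmeas (past w k) (g k) /\
    {ae P, forall o, phi k (X k o) (Y k o) (Z k o) o = g k o}.
  have [mX _ _] := HX; have [mY _ _] := HY; have [mZ _ _] := HZ.
  apply: past_versionP.
  apply: (composition_version (P := P) (c := al + be + ga) (mphi k) _ (mX k) (mY k) (mZ k)).
  apply: filterS (lip k) => o h u v t ub vb tb; apply: (le_trans (h u v t ub vb tb)).
  have := enorm_ge0 (u - ub); have := enorm_ge0 (v - vb); have := enorm_ge0 (t - tb).
  have := mulr_ge0 al0 (enorm_ge0 (v - vb)); have := mulr_ge0 al0 (enorm_ge0 (t - tb)).
  have := mulr_ge0 be0 (enorm_ge0 (u - ub)); have := mulr_ge0 be0 (enorm_ge0 (t - tb)).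
  have := mulr_ge0 ga0 (enorm_ge0 (u - ub)); have := mulr_ge0 ga0 (enorm_ge0 (v - vb)).
  lra.
split; last by move=> k; case: (gP k).
have [m0 s0 e0] := H0; have [_ sX eX] := HX; have [_ sY eY] := HY; have [_ sZ eZ] := HZ.
pose D k o := g k o - phi k 0 0 0 o.
have mD k : vgmeas (past w k) (D k).
  move=> i; under eq_fun do rewrite /D !mxE.
  by apply: measurable_funB; [exact: (gP k).1|exact: m0].
have Dle k : vsqi P (D k) /\ vip P (D k) (D k) <= 3 * al ^+ 2 * vip P (X k) (X k)
    + 3 * be ^+ 2 * vip P (Y k) (Y k) + 3 * ga ^+ 2 * vip P (Z k) (Z k).
  apply: ae_lipschitz3 => //.
    by move=> i; apply: (measurable_sub (@sigP k) (@subP k)); exact: mD.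
  apply: filterS2 (lip k) (gP k).2 => o h e.
  by have := h (X k o) (Y k o) (Z k o) 0 0 0; rewrite !subr0 /D -e.
have HD : H D.
  split; [exact: mD|by move=> k; case: (Dle k)|].
  apply: (le_rsummable (v := fun k => 3 * al ^+ 2 * energy P rho X k
    + 3 * be ^+ 2 * energy P rho Y k + 3 * ga ^+ 2 * energy P rho Z k)).
    by apply: rsummableD; [apply: rsummableD|]; exact: rsummableZ.
  move=> k; rewrite ger0_norm ?energy_ge0 // /energy.
  have [_ h] := Dle k; have := ler_wpM2l (ltW (weight_gt0 rho k)) h.
  by congr (_ <= _); ring.
have -> : g = 1 *: D + (fun k => phi k 0 0 0).
  apply/funext => k; apply/funext => o; rewrite [RHS](_ : _ = 1 *: D k o + phi k 0 0 0 o) //.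
  by rewrite scale1r subrK.
exact: H2_lin.
Qed.

Section OneSystem.
Variables (Phi : coefficients R T n) (l : lipschitz_constants R).
Hypothesis hA1 : A1 P w Phi rho l.

Let hlip := let: And4 _ _ _ h := hA1 in h.
Let hmeas := let: And4 h _ _ _ := hA1 in h.

Lemma lip_gt0 : [/\ 0 < lip l, 0 < lip1 l, 0 < lip2 l & 0 < lip3 l] /\
  [/\ 0 < lip4 l, 0 < lip5 l, 0 < lip6 l & 0 < lip7 l].
Proof. by case: hA1. Qed.

Definition b_along x y : process :=
  fun k => past_version k (at_theta P w (b_of Phi k) x y k).
Definition sigma_along x y : process :=
  fun k => past_version k (at_theta P w (sigma_of Phi k) x y k).
Definition f_along x y : process :=
  fun k => past_version k (at_theta P w (f_of Phi k.+1) x y k).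
Definition initial_along y : T -> 'cV[R]_n :=
  past_version 0 (fun o => Lambda_of Phi (y 0%N o)).
Definition state_map x y : process :=
  forward w (initial_along y) (b_along x y) (sigma_along x y).

Lemma origin_data : [/\ H (fun k => b_of Phi k 0 0 0),
  H (fun k => sigma_of Phi k 0 0 0) & H (fun k => f_of Phi k.+1 0 0 0)].
Proof.
have fin := let: And4 _ h _ _ := hA1 in h.
have sub (g : process) : (forall k, vgmeas (past w k) (g k)) ->
    (forall k o, enorm (g k o) ^+ 2 <= enorm (f_of Phi k.+1 0 0 0 o) ^+ 2 +
       enorm (b_of Phi k 0 0 0 o) ^+ 2 + enorm (sigma_of Phi k 0 0 0 o) ^+ 2) -> H g.
  move=> mg hg; apply/(L2rhoP P rho mw); split; first by move=> k; exact/vpast_measurableP.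
  have vm k (f : T -> 'cV[R]_n) : vgmeas (past w k) f -> vmeasurable f.
    exact: (past_vmeasurable mw).
  apply: le_lt_trans fin; apply: ge0_le_integral => //.
  - by move=> o _; apply: nneseries_ge0 => k _ _; rewrite lee_fin mulr_ge0 ?expR_ge0 ?sqr_ge0.
  - apply: measurable_nneseries => k.
      by move=> o; rewrite mulr_ge0 ?expR_ge0 ?sqr_ge0.
    by apply: measurable_funM => //; exact/vmeasurable_enorm_sqr/(vm k).
  - apply: measurable_nneseries => k.
      by move=> o; rewrite mulr_ge0 ?expR_ge0 ?addr_ge0 ?sqr_ge0.
    have [m1 m2 m3] := hmeas k 0 0 0.
    apply: measurable_funM => //; apply: measurable_funD; [apply: measurable_funD|];
      apply/vmeasurable_enorm_sqr/(vm k); exact/vpast_measurableP.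
  - move=> o _; apply: lee_nneseries => [k _ _|k _].
      by rewrite lee_fin mulr_ge0 ?expR_ge0 ?sqr_ge0.
    by rewrite lee_fin; apply: ler_wpM2l; [exact: expR_ge0|exact: hg].
split; apply: sub => k.
- by have [_ m _] := hmeas k 0 0 0; exact/vpast_measurableP.
- by move=> o; have := sqr_ge0 (enorm (f_of Phi k.+1 0 0 0 o));
    have := sqr_ge0 (enorm (sigma_of Phi k 0 0 0 o)); lra.
- by have [_ _ m] := hmeas k 0 0 0; exact/vpast_measurableP.
- by move=> o; have := sqr_ge0 (enorm (f_of Phi k.+1 0 0 0 o));
    have := sqr_ge0 (enorm (b_of Phi k 0 0 0 o)); lra.
- by have [m _ _] := hmeas k 0 0 0; exact/vpast_measurableP.
- by move=> o; have := sqr_ge0 (enorm (b_of Phi k 0 0 0 o));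
    have := sqr_ge0 (enorm (sigma_of Phi k 0 0 0 o)); lra.
Qed.

Lemma pred_mem y : H y -> H (y_pred P w y) /\ H (z_pred P w y).
Proof.
by move=> Hy; have [] := predictors_bessel nw Hy (predictors_pred nw Hy).
Qed.

Section Along.
Variables (x y : process).
Hypotheses (Hx : H x) (Hy : H y).

Lemma b_alongP : H (b_along x y) /\
  forall k, {ae P, forall o, at_theta P w (b_of Phi k) x y k o = b_along x y k o}.
Proof.
have [Hy' Hz'] := pred_mem Hy; have [H0 _ _] := origin_data.
have [[_ l1 _ l3] [l4 _ _ _]] := lip_gt0.
apply: (coefficient_version (phi := b_of Phi) (ltW l1) (ltW l3) (ltW l4)) => //.
  by move=> k u v z; have [_ m _] := hmeas k u v z; exact/vpast_measurableP.
by move=> k; apply: filterS (hlip.2 k) => o h u v z ub vb zb; case: (h u v z ub vb zb).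
Qed.

Lemma sigma_alongP : H (sigma_along x y) /\
  forall k, {ae P, forall o, at_theta P w (sigma_of Phi k) x y k o = sigma_along x y k o}.
Proof.
have [Hy' Hz'] := pred_mem Hy; have [_ H0 _] := origin_data.
have [[_ l1 _ _] [_ l5 l6 _]] := lip_gt0.
apply: (coefficient_version (phi := sigma_of Phi) (ltW l1) (ltW l5) (ltW l6)) => //.
  by move=> k u v z; have [_ _ m] := hmeas k u v z; exact/vpast_measurableP.
by move=> k; apply: filterS (hlip.2 k) => o h u v z ub vb zb; case: (h u v z ub vb zb).
Qed.

Lemma f_alongP : H (f_along x y) /\
  forall k, {ae P, forall o, at_theta P w (f_of Phi k.+1) x y k o = f_along x y k o}.
Proof.
have [Hy' Hz'] := pred_mem Hy; have [_ _ H0] := origin_data.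
have [[_ _ l2 _] [_ _ _ l7]] := lip_gt0.
apply: (coefficient_version (phi := fun k => f_of Phi k.+1) (ltW l7) (ltW l2) (ltW l2)) => //.
  by move=> k u v z; have [m _ _] := hmeas k u v z; exact/vpast_measurableP.
move=> k; apply: filterS (hlip.2 k) => o h u v z ub vb zb.
by have [_ _] := h u v z ub vb zb; rewrite mulrDr addrA.
Qed.

Lemma initial_alongP : [/\ vgmeas (past w 0) (initial_along y),
  vsqi P (initial_along y) &
  {ae P, forall o, Lambda_of Phi (y 0%N o) = initial_along y o}].
Proof.
have [my sy _] := Hy; have [[l0 _ _ _] _] := lip_gt0.
have [|m e] := @past_versionP 0%N (fun o => Lambda_of Phi (y 0%N o)).
  apply: (composition_version (P := P) (c := lip l)
    (phi := fun u _ _ _ => Lambda_of Phi u) _ _ (my 0%N) (my 0%N) (my 0%N)).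
    by move=> u _ _ i; exact: measurable_cst.
  apply: aeW => o u v z ub vb zb; apply: (le_trans (hlip.1 u ub)).
  have := mulr_ge0 (ltW l0) (enorm_ge0 (v - vb)); have := mulr_ge0 (ltW l0) (enorm_ge0 (z - zb)).
  lra.
split => //; rewrite /initial_along; set g := past_version _ _ in m e *.
have mg : vmeasurable g by exact: (past_vmeasurable mw m).
have s0 : vsqi P (cst (Lambda_of Phi 0) : T -> 'cV[R]_n) by exact: vsqi_cst.
have mD : vmeasurable (fun o => g o - Lambda_of Phi 0).
  by move=> i; under eq_fun do rewrite !mxE; exact: measurable_funB.
have hD : {ae P, forall o, enorm (g o - Lambda_of Phi 0) <=
    lip l * enorm (y 0%N o) + 0 * enorm (y 0%N o) + 0 * enorm (y 0%N o)}.
  apply: filterS e => o <-; rewrite !mul0r !addr0.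
  by have := hlip.1 (y 0%N o) 0; rewrite subr0.
have [sD _] := ae_lipschitz3 mD (sy 0%N) (sy 0%N) (sy 0%N) (ltW l0) (lexx _) (lexx _) hD.
have := vsqiD sD s0.
by rewrite (_ : (fun o => _) = g) //; apply/funext => o; rewrite subrK.
Qed.

Lemma state_map_mem : H (state_map x y).
Proof.
have [Hb _] := b_alongP; have [Hs _] := sigma_alongP; have [ma sa _] := initial_alongP.
exact: forward_mem.
Qed.

Lemma state_mapE : {ae P, forall o, state_map x y 0%N o = Lambda_of Phi (y 0%N o)} /\
  forall k, {ae P, forall o, state_map x y k.+1 o =
    at_theta P w (b_of Phi k) x y k o + w k o *: at_theta P w (sigma_of Phi k) x y k o}.
Proof.
have [_ eb] := b_alongP; have [_ es] := sigma_alongP; have [_ _ ea] := initial_alongP.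
split; first by apply: filterS ea => o ->.
by move=> k; apply: filterS2 (eb k) (es k) => o /= -> ->.
Qed.
End Along.

End OneSystem.
End Operators.

(** * Elementary inequalities *)

Section RealInequalities.
Context {R : realType}.

Lemma contraction_arith (e L nb ns nx : R) : 0 < e -> e * (4 * L) <= 1 ->
  nb <= L * nx -> ns <= L * nx -> 0 <= nx -> e * (nb + ns) <= 2^-1 * nx.
Proof.
move=> e0 eL hb hs n0; have a1 := ler_wpM2l (ltW e0) (lerD hb hs).
have a2 := ler_wpM2r n0 eL; lra.
Qed.

Lemma backward_contraction_arith (r c nF a b n : R) : r * (6 * c) < 1 -> 0 <= c ->
  0 <= n -> a + b <= r * n -> nF <= 2 * c * a + 2 * c * b -> nF <= 2^-1 * n.
Proof.
move=> rc c0 n0 ab hF; have c2 : 0 <= 2 * c by rewrite mulr_ge0.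
have a1 := ler_wpM2l c2 ab; have a2 := ler_wpM2r n0 (ltW rc); lra.
Qed.

Lemma forward_lipschitz_arith (e r L0 c3 c4 c5 c6 c7 va nb ns a b n : R) :
  0 < e -> e * r = 1 -> 0 <= c3 -> 0 <= c4 -> 0 <= c5 -> 0 <= c6 -> 0 <= c7 ->
  0 <= a -> 0 <= b -> 0 <= n -> a + b <= r * n -> va <= L0 * n ->
  nb <= 2 * c3 * a + 2 * c4 * b -> ns <= 2 * c5 * a + 2 * c6 * b ->
  va + e * (nb + ns) <= (L0 + 2 * (c3 + c4 + c5 + c6) + c7) * n.
Proof.
move=> e0 er p3 p4 p5 p6 p7 a0 b0 n0 ab hva hb hs; set c := 2 * (c3 + c4 + c5 + c6).
have c0 : 0 <= c by rewrite mulr_ge0 // !addr_ge0.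
have bs : nb + ns <= c * (r * n).
  apply: (@le_trans _ _ (c * (a + b))); last exact: ler_wpM2l.
  have := mulr_ge0 p3 b0; have := mulr_ge0 p4 a0.
  have := mulr_ge0 p5 b0; have := mulr_ge0 p6 a0; rewrite /c; lra.
have a1 := ler_wpM2l (ltW e0) bs.
have a2 : e * (c * (r * n)) = c * n * (e * r) by ring.
rewrite er mulr1 in a2.
have a3 := mulr_ge0 p7 n0; lra.
Qed.

Lemma monotone_arith (e m kap vL S V Q : R) : 0 < m -> 0 <= V -> 0 <= Q ->
  kap <= 1 -> e * kap <= 2^-1 -> vL <= - (m * V) -> S <= - (m / 2 * Q) ->
  vL + S <= - (m * kap * (V + e * Q)).
Proof.
move=> m0 V0 Q0 k1 k2 hL hS.
have b1 := ler_wpM2r V0 k1; have b2 := ler_wpM2r Q0 k2; rewrite mul1r in b1.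
have b3 := ler_wpM2l (ltW m0) (lerD b1 b2); lra.
Qed.

Lemma dominated_sqr (q a b : R) : 0 < q -> 0 <= a -> a <= q^-1 * b ->
  q ^+ 3 * a ^+ 2 <= q * b ^+ 2.
Proof.
move=> q0 a0; rewrite ler_pdivlMl // => h.
have -> : q ^+ 3 * a ^+ 2 = q * (q * a) ^+ 2 by ring.
apply: ler_wpM2l; first exact: ltW.
by rewrite lerXn2r ?nnegrE ?mulr_ge0 ?(ltW q0) // (le_trans _ h) // mulr_ge0 // ltW.
Qed.

Lemma half_sum_arith (m S a b c : R) : S <= - c -> m * a <= c -> m * b <= c ->
  S <= - (m / 2 * (a + b)).
Proof. by move=> h1 h2 h3; lra. Qed.

Lemma half_arith (e L kap : R) : 0 < e -> kap <= 2 * L -> e * (4 * L) <= 1 ->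
  e * kap <= 2^-1.
Proof. by move=> e0 /(ler_wpM2l (ltW e0)) h1 h2; lra. Qed.

Lemma stability_arith (S n r1 r2 z1 z2 p q a b : R) : n <= S * (r1 + r2) ->
  z1 = 0 -> z2 = 0 -> r1 <= 2 * z1 + 2 * p -> r2 <= 2 * z2 + 2 * q -> p = a -> q = b -> 0 <= S ->
  n <= 2 * S * (a + b).
Proof.
move=> h -> -> h1 h2 <- <- S0; rewrite mulr0 add0r in h1 h2; apply: (le_trans h).
have := ler_wpM2l S0 (lerD h1 h2); lra.
Qed.

Lemma unique_arith (S nx ny r1 r2 z1 z1' z2 z2' : R) : nx + ny <= S * (r1 + r2) ->
  z1 = 0 -> z1' = 0 -> z2 = 0 -> z2' = 0 ->
  r1 <= 2 * z1 + 2 * z1' -> r2 <= 2 * z2 + 2 * z2' -> 0 <= S ->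
  0 <= nx -> 0 <= ny -> nx = 0 /\ ny = 0.
Proof.
move=> h -> -> -> -> h1 h2 S0 x0 y0; rewrite mulr0 addr0 in h1 h2.
have := ler_wpM2l S0 (lerD h1 h2); split; lra.
Qed.

Lemma null_sum_arith (r a b z : R) : a + b <= r * z -> z = 0 ->
  0 <= a -> 0 <= b -> a = 0 /\ b = 0.
Proof. by move=> h zE a0 b0; rewrite zE mulr0 in h; split; lra. Qed.

Lemma scale_le (S q a b : R) : 0 <= S -> a <= q * b -> S * a <= S * q * b.
Proof. by move=> S0 h; rewrite -mulrA; exact: ler_wpM2l. Qed.

Lemma rescale_arith (e r u v A B F : R) : 0 <= e -> e * r = 1 -> e <= u ->
  r <= v -> 0 <= u -> 0 <= v -> 0 <= A -> 0 <= B -> 0 <= F ->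
  A + e * B + F <= (1 + u + v) * (B + e * F + A).
Proof.
move=> e0 er eu rv u0 v0 A0 B0 F0; have E0 := mulr_ge0 e0 F0.
have b1 := ler_wpM2r B0 eu.
have b2 : F <= v * (e * F).
  rewrite -[leLHS]mul1r -er [e * r]mulrC -mulrA; exact: ler_wpM2r.
move: (e * F) E0 b2 => G G0 b2.
have := mulr_ge0 u0 G0; have := mulr_ge0 u0 A0; have := mulr_ge0 v0 B0.
have := mulr_ge0 v0 A0; lra.
Qed.

End RealInequalities.

(** * The system as a monotone pair *)

Section Estimates.
Context {d : measure_display} {T : measurableType d} {R : realType} {n : nat}.
Variables (P : probability T R) (w : nat -> T -> R) (rho : R).
Hypothesis nw : normalized_martingale_difference P w.
Variables (Phi : coefficients R T n) (l : lipschitz_constants R).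
Hypothesis hA1 : A1 P w Phi rho l.
Hypotheses (rho_low : 4 * lip1 l ^+ 2 < expR rho)
  (rho_up : expR rho * (6 * lip2 l ^+ 2) < 1).
Local Notation process := (nat -> T -> 'cV[R]_n).
Local Notation H := (@H2 _ _ _ n P w rho).
Local Notation ip := (@ipr _ _ _ n P rho).
Local Notation N g := (ip g g).
Implicit Types x y b s g h : process.

Lemma vip_subrr (a : T -> 'cV[R]_n) :
  vip P (fun o => a o - a o) (fun o => a o - a o) = 0.
Proof.
rewrite /vip; under [X in expect _ X]eq_fun do rewrite subrr inner0l.
by rewrite /expect Rintegral_cst // mul0r.
Qed.

Local Opaque b_along sigma_along f_along initial_along y_pred z_pred vip ipr.

Let hH : hilbert_form H ip := H2_hilbert P rho (noise_measurable nw).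
Let hlip := let: And4 _ _ _ h := hA1 in h.
Local Notation bA := (b_along P w Phi).
Local Notation sA := (sigma_along P w Phi).
Local Notation fA := (f_along P w Phi).
Local Notation aA := (initial_along P w Phi).
Local Notation yP := (y_pred P w).
Local Notation zP := (z_pred P w).

Lemma ipr_energy g : N g = rsum (energy P rho g). Proof. by []. Qed.

Lemma process_lipschitz1 (D X : process) (al : R) : H D -> H X ->
  (forall k, {ae P, forall o, enorm (D k o) <= al * enorm (X k o)}) ->
  N D <= al ^+ 2 * N X.
Proof.
move=> [_ sD eD] [_ sX eX] h.
apply: (@le_trans _ _ (rsum (fun k => al ^+ 2 * energy P rho X k))); last first.
  by rewrite (ipr_energy X) (rsumZ (al ^+ 2) eX).
rewrite (ipr_energy D).
apply: (le_rsum eD (rsummableZ (a := al ^+ 2) eX)) => k.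
rewrite /energy mulrCA; apply: ler_wpM2l; first exact/ltW/weight_gt0.
exact: ae_lipschitz1.
Qed.

Lemma process_lipschitz2 (D X Y : process) (al be : R) : H D -> H X -> H Y ->
  0 <= al -> 0 <= be ->
  (forall k, {ae P, forall o, enorm (D k o) <= al * enorm (X k o) + be * enorm (Y k o)}) ->
  N D <= 2 * al ^+ 2 * N X + 2 * be ^+ 2 * N Y.
Proof.
move=> [_ sD eD] [_ sX eX] [_ sY eY] al0 be0 h.
set a := 2 * al ^+ 2; set c := 2 * be ^+ 2.
have aX := rsummableZ (a := a) eX; have cY := rsummableZ (a := c) eY.
apply: (@le_trans _ _ (rsum (fun k => a * energy P rho X k + c * energy P rho Y k))); last first.
  by rewrite (ipr_energy X) (ipr_energy Y) (rsumD aX cY) (rsumZ a eX) (rsumZ c eY).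
rewrite (ipr_energy D); apply: (le_rsum eD (rsummableD aX cY)) => k.
apply: (@le_trans _ _ (weight rho k * (a * vip P (X k) (X k) + c * vip P (Y k) (Y k)))).
  by apply: ler_wpM2l; [exact/ltW/weight_gt0|exact: ae_lipschitz2].
by rewrite le_eqVlt; apply/orP; left; apply/eqP; rewrite /energy; ring.
Qed.

Section Pairings.
Variables (D X E Y F Z U V : process).
Hypotheses (HD : H D) (HX : H X) (HE : H E) (HY : H Y) (HF : H F) (HZ : H Z).

Lemma rsum_pairings (e : R) :
  let u := fun k => weight rho k * (vip P (D k) (X k) + e * vip P (E k) (Y k)
       + e * vip P (F k) (Z k)) in
  rsummable u /\ rsum u = ip D X + e * (ip E Y + ip F Z).
Proof.
move=> u; have s1 := pairing_summable HD HX; have s2 := pairing_summable HE HY.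
have s3 := pairing_summable HF HZ; have := rsum_combine e s1 s2 s3.
rewrite (_ : (fun k => _) = u) //; apply/funext => k; rewrite /u /pairing.
by rewrite !mulrDr !(mulrCA e).
Qed.

Hypotheses (HU : H U) (HV : H V).

Lemma rsum_pairings_le (e q : R) (D' E' F' U' V' : process) :
  (forall k, {ae P, forall o,
     [/\ E k o = E' k o, F k o = F' k o & D k o = D' k o]}) ->
  (forall k, {ae P, forall o, U k o = U' k o /\ V k o = V' k o}) ->
  (forall k, {ae P, forall o,
     inner (D' k o) (X k o) + e * inner (E' k o) (Y k o) + e * inner (F' k o) (Z k o)
     <= - (q * (enorm (U' k o) ^+ 2 + enorm (V' k o) ^+ 2))}) ->
  rsum (fun k => weight rho k * (vip P (D k) (X k) + e * vip P (E k) (Y k)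
       + e * vip P (F k) (Z k))) <= - (q * (N U + N V)).
Proof.
move=> eD eU_ h; have [sum _] := rsum_pairings e.
have [_ sU eU] := HU; have [_ sV eV] := HV; have eUV := rsummableD eU eV.
apply: (@le_trans _ _ (rsum (fun k => - q * (energy P rho U k + energy P rho V k)))); last first.
  by rewrite (ipr_energy U) (ipr_energy V) (rsumZ (- q) eUV) (rsumD eU eV) mulNr.
apply: (le_rsum sum (rsummableZ (a := - q) eUV)) => k.
rewrite /energy -mulrDr mulrCA; apply: ler_wpM2l; first exact/ltW/weight_gt0.
have [_ sD _] := HD; have [_ sE _] := HE; have [_ sF _] := HF.
have [_ sX _] := HX; have [_ sY _] := HY; have [_ sZ _] := HZ.
have i1 := vip_integr (sD k) (sX k); have i2 := vip_integr (sE k) (sY k).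
have i3 := vip_integr (sF k) (sZ k).
have iU := vip_integr (sU k) (sU k); have iV := vip_integr (sV k) (sV k).
have j2 := integrZ e i2; have j3 := integrZ e i3.
rewrite -(expectZ e i2) -(expectZ e i3) -(expectD i1 j2) -(expectD (integrD i1 j2) j3).
rewrite -(expectD iU iV) -(expectZ (- q) (integrD iU iV)).
apply: ae_le_expect; [exact: integrD (integrD i1 j2) j3|exact: integrZ (integrD iU iV)|].
apply: filterS3 (eD k) (eU_ k) (h k) => o [-> -> ->] [-> ->].
by rewrite !enorm_sqr mulNr.
Qed.
End Pairings.

Section Pairs.
Variables (x y xb yb : process).
Hypotheses (Hx : H x) (Hy : H y) (Hxb : H xb) (Hyb : H yb).

Lemma along_sub k : {ae P, forall o,
  [/\ (bA x y - bA xb yb) k o = b_of Phi k (x k o) (yP y k o) (zP y k o) o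
        - b_of Phi k (xb k o) (yP yb k o) (zP yb k o) o,
      (sA x y - sA xb yb) k o = sigma_of Phi k (x k o) (yP y k o) (zP y k o) o
        - sigma_of Phi k (xb k o) (yP yb k o) (zP yb k o) o &
      (fA x y - fA xb yb) k o = f_of Phi k.+1 (x k o) (yP y k o) (zP y k o) o
        - f_of Phi k.+1 (xb k o) (yP yb k o) (zP yb k o) o]}.
Proof.
have [_ b1] := b_alongP nw hA1 Hx Hy; have [_ b2] := b_alongP nw hA1 Hxb Hyb.
have [_ s1] := sigma_alongP nw hA1 Hx Hy; have [_ s2] := sigma_alongP nw hA1 Hxb Hyb.
have [_ f1] := f_alongP nw hA1 Hx Hy; have [_ f2] := f_alongP nw hA1 Hxb Hyb.
apply: filterS3 (filterI (b1 k) (b2 k)) (filterI (s1 k) (s2 k)) (filterI (f1 k) (f2 k)).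
move=> o [eb1 eb2] [es1 es2] [ef1 ef2]; split.
- by rewrite [LHS](_ : _ = bA x y k o - bA xb yb k o) // -eb1 -eb2.
- by rewrite [LHS](_ : _ = sA x y k o - sA xb yb k o) // -es1 -es2.
- by rewrite [LHS](_ : _ = fA x y k o - fA xb yb k o) // -ef1 -ef2.
Qed.

Lemma along_sub_mem : [/\ H (bA x y - bA xb yb), H (sA x y - sA xb yb) &
  H (fA x y - fA xb yb)].
Proof.
have [b1 _] := b_alongP nw hA1 Hx Hy; have [b2 _] := b_alongP nw hA1 Hxb Hyb.
have [s1 _] := sigma_alongP nw hA1 Hx Hy; have [s2 _] := sigma_alongP nw hA1 Hxb Hyb.
have [f1 _] := f_alongP nw hA1 Hx Hy; have [f2 _] := f_alongP nw hA1 Hxb Hyb.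
by split; exact: (hilbert_memB hH).
Qed.

Lemma initial_sub : [/\ vgmeas (past w 0) (fun o => aA y o - aA yb o),
  vsqi P (fun o => aA y o - aA yb o) &
  {ae P, forall o, aA y o - aA yb o = Lambda_of Phi (y 0%N o) - Lambda_of Phi (yb 0%N o)}].
Proof.
have [m1 s1 e1] := initial_alongP nw hA1 Hy.
have [m2 s2 e2] := initial_alongP nw hA1 Hyb.
split; [|exact: vsqiB|by apply: filterS2 e1 e2 => o -> ->].
by move=> i; under eq_fun do rewrite !mxE; apply: measurable_funB; [exact: m1|exact: m2].
Qed.

Lemma state_map_sub : state_map P w Phi x y - state_map P w Phi xb yb
  = forward w (fun o => aA y o - aA yb o) (bA x y - bA xb yb) (sA x y - sA xb yb).
Proof. exact: forwardB. Qed.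
Local Opaque state_map.

Lemma state_map_sub_norm :
  N (state_map P w Phi x y - state_map P w Phi xb yb)
  = vip P (fun o => aA y o - aA yb o) (fun o => aA y o - aA yb o)
    + expR (- rho) * (N (bA x y - bA xb yb) + N (sA x y - sA xb yb)).
Proof.
have [Db Ds _] := along_sub_mem; have [ma sa _] := initial_sub.
by rewrite state_map_sub (forward_norm nw ma sa Db Ds).
Qed.

Lemma pred_sub : [/\ predictors P w (y - yb) (yP y - yP yb) (zP y - zP yb),
  H (yP y - yP yb), H (zP y - zP yb) &
  N (yP y - yP yb) + N (zP y - zP yb) <= expR rho * N (y - yb)].
Proof.
have hp := predictorsB nw (predictors_pred nw Hy) (predictors_pred nw Hyb).
have [? ? ?] := predictors_bessel nw (hilbert_memB hH Hy Hyb) hp.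
by split.
Qed.

(** The adjoint identity behind the monotonicity of the system: the forward
    map is paired with [y] exactly as the coefficients are paired with the
    predictors of [y] in the monotonicity condition. *)
Lemma state_map_pairing :
  ip (fA x y - fA xb yb) (x - xb)
  + ip (state_map P w Phi x y - state_map P w Phi xb yb) (y - yb)
  = vip P (fun o => aA y o - aA yb o) (fun o => y 0%N o - yb 0%N o)
  + rsum (fun k => weight rho k *
      (vip P ((fA x y - fA xb yb) k) ((x - xb) k)
       + expR (- rho) * vip P ((bA x y - bA xb yb) k) ((yP y - yP yb) k)
       + expR (- rho) * vip P ((sA x y - sA xb yb) k) ((zP y - zP yb) k))).
Proof.
have [Db Ds Df] := along_sub_mem; have [ma sa _] := initial_sub.
have [hp Hyp Hzp _] := pred_sub.
have Hdx := hilbert_memB hH Hx Hxb; have Hdy := hilbert_memB hH Hy Hyb.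
rewrite state_map_sub (forward_pairing nw ma sa Db Ds Hdy hp) addrCA; congr (_ + _).
by have [_ ->] := rsum_pairings Df Hdx Db Hyp Ds Hzp (expR (- rho)).
Qed.

Lemma pairing_bound (X Y X' Y' : process) (q : R) : H X -> H Y ->
  (forall k, {ae P, forall o, X k o = X' k o /\ Y k o = Y' k o}) ->
  (forall k, {ae P, forall o,
     inner (f_of Phi k.+1 (x k o) (yP y k o) (zP y k o) o
        - f_of Phi k.+1 (xb k o) (yP yb k o) (zP yb k o) o) (x k o - xb k o)
     + expR (- rho) * inner (b_of Phi k (x k o) (yP y k o) (zP y k o) o
        - b_of Phi k (xb k o) (yP yb k o) (zP yb k o) o) (yP y k o - yP yb k o)
     + expR (- rho) * inner (sigma_of Phi k (x k o) (yP y k o) (zP y k o) o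
        - sigma_of Phi k (xb k o) (yP yb k o) (zP yb k o) o) (zP y k o - zP yb k o)
     <= - (q * (enorm (X' k o) ^+ 2 + enorm (Y' k o) ^+ 2))}) ->
  rsum (fun k => weight rho k *
      (vip P ((fA x y - fA xb yb) k) ((x - xb) k)
       + expR (- rho) * vip P ((bA x y - bA xb yb) k) ((yP y - yP yb) k)
       + expR (- rho) * vip P ((sA x y - sA xb yb) k) ((zP y - zP yb) k)))
  <= - (q * (N X + N Y)).
Proof.
move=> HX HY eXY h; have [Db Ds Df] := along_sub_mem.
have [hp Hyp Hzp _] := pred_sub; have Hdx := hilbert_memB hH Hx Hxb.
exact: (rsum_pairings_le Df Hdx Db Hyp Ds Hzp HX HY along_sub eXY h).
Qed.
End Pairs.

(** One constant for both mixed dependences: of the forward map on [y], through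
    [lip] and [lip3] to [lip6], and of [f] on [x], through [lip7]. *)
Definition pair_lipschitz : R :=
  lip l ^+ 2 + 2 * (lip3 l ^+ 2 + lip4 l ^+ 2 + lip5 l ^+ 2 + lip6 l ^+ 2)
  + lip7 l ^+ 2.

Let lips := lip_gt0 hA1.

Lemma lip_b_state k : {ae P, forall o u v t ub,
  enorm (b_of Phi k u v t o - b_of Phi k ub v t o) <= lip1 l * enorm (u - ub)}.
Proof.
apply: filterS (hlip.2 k) => o h u v t ub; have [+ _ _] := h u v t ub v t.
by rewrite !subrr enorm0 ?mulr0 !addr0.
Qed.

Lemma lip_b_pred k : {ae P, forall o u v t vb tb,
  enorm (b_of Phi k u v t o - b_of Phi k u vb tb o) <=
    lip3 l * enorm (v - vb) + lip4 l * enorm (t - tb)}.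
Proof.
apply: filterS (hlip.2 k) => o h u v t vb tb; have [+ _ _] := h u v t u vb tb.
by rewrite subrr enorm0 mulr0 add0r.
Qed.

Lemma lip_sigma_state k : {ae P, forall o u v t ub,
  enorm (sigma_of Phi k u v t o - sigma_of Phi k ub v t o) <= lip1 l * enorm (u - ub)}.
Proof.
apply: filterS (hlip.2 k) => o h u v t ub; have [_ + _] := h u v t ub v t.
by rewrite !subrr enorm0 ?mulr0 !addr0.
Qed.

Lemma lip_sigma_pred k : {ae P, forall o u v t vb tb,
  enorm (sigma_of Phi k u v t o - sigma_of Phi k u vb tb o) <=
    lip5 l * enorm (v - vb) + lip6 l * enorm (t - tb)}.
Proof.
apply: filterS (hlip.2 k) => o h u v t vb tb; have [_ + _] := h u v t u vb tb.
by rewrite subrr enorm0 mulr0 add0r.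
Qed.

Lemma lip_f_state k : {ae P, forall o u v t ub,
  enorm (f_of Phi k.+1 u v t o - f_of Phi k.+1 ub v t o) <= lip7 l * enorm (u - ub)}.
Proof.
apply: filterS (hlip.2 k) => o h u v t ub; have [_ _ +] := h u v t ub v t.
by rewrite !subrr enorm0 ?mulr0 !addr0 mulr0 addr0.
Qed.

Lemma lip_f_pred k : {ae P, forall o u v t vb tb,
  enorm (f_of Phi k.+1 u v t o - f_of Phi k.+1 u vb tb o) <=
    lip2 l * enorm (v - vb) + lip2 l * enorm (t - tb)}.
Proof.
apply: filterS (hlip.2 k) => o h u v t vb tb; have [_ _ +] := h u v t u vb tb.
by rewrite subrr enorm0 mulr0 add0r mulrDr.
Qed.

(** This is where [4 * lip1 l ^+ 2 < expR rho] is used: two increments with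
    Lipschitz constant [lip1 l] and weight [expR (- rho)] give the ratio
    [2 * lip1 l ^+ 2 * expR (- rho)]. *)
Lemma state_map_contracting x xb y : H x -> H xb -> H y ->
  N (state_map P w Phi x y - state_map P w Phi xb y) <= 2^-1 * N (x - xb).
Proof.
move=> Hx Hxb Hy; have [[l0 l1 l2 l3] [l4 l5 l6 l7]] := lips.
have Hdx := hilbert_memB hH Hx Hxb; have n0 := ip_ge0 hH Hdx.
rewrite state_map_sub_norm // vip_subrr add0r.
have [Db Ds _] := along_sub_mem Hx Hy Hxb Hy.
have hb : N (bA x y - bA xb y) <= lip1 l ^+ 2 * N (x - xb).
  apply: (process_lipschitz1 Db Hdx) => k.
  apply: filterS2 (along_sub Hx Hy Hxb Hy k) (lip_b_state k) => o [-> _ _] h; exact: h.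
have hs : N (sA x y - sA xb y) <= lip1 l ^+ 2 * N (x - xb).
  apply: (process_lipschitz1 Ds Hdx) => k.
  apply: filterS2 (along_sub Hx Hy Hxb Hy k) (lip_sigma_state k) => o [_ -> _] h; exact: h.
have er : expR (- rho) * expR rho = 1 by rewrite -expRD addNr expR0.
have e0 := expR_gt0 (- rho).
have a2 : expR (- rho) * (4 * lip1 l ^+ 2) <= 1.
  by rewrite -[leRHS]er; apply: ler_wpM2l; exact: ltW.
exact: (contraction_arith e0 a2 hb hs n0).
Qed.

(** This is where [expR rho * (6 * lip2 l ^+ 2) < 1] is used: by the Bessel
    inequality the ratio is [2 * lip2 l ^+ 2 * expR rho]. *)
Lemma f_along_contracting x y yb : H x -> H y -> H yb ->
  N (fA x y - fA x yb) <= 2^-1 * N (y - yb).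
Proof.
move=> Hx Hy Hyb; have [[l0 l1 l2 l3] [l4 l5 l6 l7]] := lips.
have [_ _ Df] := along_sub_mem Hx Hy Hx Hyb; have [_ Hyp Hzp hb] := pred_sub Hy Hyb.
have n0 := ip_ge0 hH (hilbert_memB hH Hy Hyb).
have h : N (fA x y - fA x yb) <=
    2 * lip2 l ^+ 2 * N (yP y - yP yb) + 2 * lip2 l ^+ 2 * N (zP y - zP yb).
  apply: (process_lipschitz2 Df Hyp Hzp (ltW l2) (ltW l2)) => k.
  apply: filterS2 (along_sub Hx Hy Hx Hyb k) (lip_f_pred k) => o [_ _ ->] h; exact: h.
exact: (backward_contraction_arith rho_up (sqr_ge0 _) n0 hb h).
Qed.

Lemma state_map_lipschitz x y yb : H x -> H y -> H yb ->
  N (state_map P w Phi x y - state_map P w Phi x yb) <= pair_lipschitz * N (y - yb).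
Proof.
move=> Hx Hy Hyb; have [[l0 l1 l2 l3] [l4 l5 l6 l7]] := lips.
have Hdy := hilbert_memB hH Hy Hyb; have n0 := ip_ge0 hH Hdy.
rewrite state_map_sub_norm //.
have [Db Ds _] := along_sub_mem Hx Hy Hx Hyb; have [ma sa ea] := initial_sub Hy Hyb.
have [_ Hyp Hzp hp] := pred_sub Hy Hyb.
have [_ sdy _] := Hdy.
have ha : vip P (fun o => aA y o - aA yb o) (fun o => aA y o - aA yb o)
    <= lip l ^+ 2 * N (y - yb).
  apply: (@le_trans _ _ (lip l ^+ 2 * vip P ((y - yb) 0%N) ((y - yb) 0%N))).
    apply: (ae_lipschitz1 sa (sdy 0%N)); apply: filterS ea => o ->; exact: hlip.1.
  apply: ler_wpM2l; first exact: sqr_ge0.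
  by have := energy_le_ipr 0 Hdy; rewrite /energy weight0 mul1r.
have hb : N (bA x y - bA x yb) <=
    2 * lip3 l ^+ 2 * N (yP y - yP yb) + 2 * lip4 l ^+ 2 * N (zP y - zP yb).
  apply: (process_lipschitz2 Db Hyp Hzp (ltW l3) (ltW l4)) => k.
  apply: filterS2 (along_sub Hx Hy Hx Hyb k) (lip_b_pred k) => o [-> _ _] h; exact: h.
have hs : N (sA x y - sA x yb) <=
    2 * lip5 l ^+ 2 * N (yP y - yP yb) + 2 * lip6 l ^+ 2 * N (zP y - zP yb).
  apply: (process_lipschitz2 Ds Hyp Hzp (ltW l5) (ltW l6)) => k.
  apply: filterS2 (along_sub Hx Hy Hx Hyb k) (lip_sigma_pred k) => o [_ -> _] h; exact: h.
have er : expR (- rho) * expR rho = 1 by rewrite -expRD addNr expR0.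
have p1 := ip_ge0 hH Hyp; have p2 := ip_ge0 hH Hzp.
exact: (forward_lipschitz_arith (expR_gt0 _) er (sqr_ge0 _) (sqr_ge0 _) (sqr_ge0 _)
  (sqr_ge0 _) (sqr_ge0 _) p1 p2 n0 hp ha hb hs).
Qed.

Lemma f_along_lipschitz x xb y : H x -> H xb -> H y ->
  N (fA x y - fA xb y) <= pair_lipschitz * N (x - xb).
Proof.
move=> Hx Hxb Hy; have [_ _ Df] := along_sub_mem Hx Hy Hxb Hy.
have Hdx := hilbert_memB hH Hx Hxb; have n0 := ip_ge0 hH Hdx.
have h : N (fA x y - fA xb y) <= lip7 l ^+ 2 * N (x - xb).
  apply: (process_lipschitz1 Df Hdx) => k.
  apply: filterS2 (along_sub Hx Hy Hxb Hy k) (lip_f_state k) => o [_ _ ->] h; exact: h.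
apply: (le_trans h); apply: (ler_wpM2r n0); rewrite /pair_lipschitz lerDr.
by rewrite addr_ge0 ?sqr_ge0 // mulr_ge0 // !addr_ge0 ?sqr_ge0.
Qed.

Section Monotone.
Variables (m : nat) (mu nu : R) (M : 'M[R]_(m, n)).
Variables (A B C : nat -> T -> 'M[R]_(m, n)) (cA cB cC cM : R).
Hypothesis hA2 : A2 P w Phi mu nu M A B C rho cA cB cC cM.

(** The weight [expR (- rho)] of the increments of [b] and [sigma] in the norm of
    the forward map could be large; the second factor of the minimum offsets it,
    since [expR (- rho) * (2 * lip1 l ^+ 2)] is at most [1/2]. *)
Definition monotonicity_constant : R :=
  if 0 < mu then mu ^+ 3 * Num.min 1 (2 * lip1 l ^+ 2) else nu ^+ 3.

Lemma initial_pairing y yb q : H y -> H yb ->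
  (forall u v : 'cV[R]_n, inner (Lambda_of Phi u - Lambda_of Phi v) (u - v) <=
     - (q * enorm (Lambda_of Phi u - Lambda_of Phi v) ^+ 2)) ->
  vip P (fun o => aA y o - aA yb o) (fun o => y 0%N o - yb 0%N o)
  <= - (q * vip P (fun o => aA yb o - aA y o) (fun o => aA yb o - aA y o)).
Proof.
move=> Hy Hyb hq; have [_ sa ea] := initial_sub Hy Hyb.
have [_ sa' _] := initial_sub Hyb Hy.
have [_ sy _] := Hy; have [_ syb _] := Hyb; have sdy := vsqiB (sy 0%N) (syb 0%N).
have ia := vip_integr sa' sa'.
rewrite -mulNr -(expectZ _ ia); apply: ae_le_expect; [exact: vip_integr|exact: integrZ|].
apply: filterS ea => o h; rewrite -enorm_sqr -[aA yb o - _]opprB h.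
apply: (le_trans (hq _ _)).
by rewrite mulNr !enorm_sqr innerNl innerC innerNl opprK.
Qed.

(** Domination turns the term [B * (v - vb) + C * (t - tb)] subtracted in the
    monotonicity condition into the increments of [b] and [sigma] that it
    dominates; each of the two takes half of it. *)
Lemma pointwise_monotone1 : 0 < mu -> nu = 0 -> forall k,
  {ae P, forall o u v t ub vb tb,
    inner (f_of Phi k.+1 u v t o - f_of Phi k.+1 ub vb tb o) (u - ub)
    + expR (- rho) * inner (b_of Phi k u v t o - b_of Phi k ub vb tb o) (v - vb)
    + expR (- rho) * inner (sigma_of Phi k u v t o - sigma_of Phi k ub vb tb o) (t - tb)
    <= - (mu ^+ 3 / 2 * (enorm (b_of Phi k u vb tb o - b_of Phi k u v t o) ^+ 2
        + enorm (sigma_of Phi k u vb tb o - sigma_of Phi k u v t o) ^+ 2))}.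
Proof.
move=> mu0 nu0 k; have [_ _ [_ _ domh] [_ monoG]] := hA2.
apply: filterS2 (monoG k) (domh mu0 k) => o h1 h2 u v t ub vb tb.
have [d1 d2] := h2 u vb tb v t.
apply: half_sum_arith (dominated_sqr mu0 (enorm_ge0 _) d1) (dominated_sqr mu0 (enorm_ge0 _) d2).
apply: (le_trans (h1 u v t ub vb tb)).
rewrite nu0 mul0r oppr0 add0r lerN2 le_eqVlt; apply/orP; left; apply/eqP.
by rewrite -[vb - _]opprB -[tb - _]opprB !mulmxN -opprD enorm_opp.
Qed.

Lemma pointwise_monotone2 : mu = 0 -> 0 < nu -> forall k,
  {ae P, forall o u v t ub vb tb,
    inner (f_of Phi k.+1 u v t o - f_of Phi k.+1 ub vb tb o) (u - ub)
    + expR (- rho) * inner (b_of Phi k u v t o - b_of Phi k ub vb tb o) (v - vb)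
    + expR (- rho) * inner (sigma_of Phi k u v t o - sigma_of Phi k ub vb tb o) (t - tb)
    <= - (nu ^+ 3 * enorm (f_of Phi k.+1 ub v t o - f_of Phi k.+1 u v t o) ^+ 2)}.
Proof.
move=> mu0 nu0 k; have [_ _ [_ domf _] [_ monoG]] := hA2.
apply: filterS2 (monoG k) (domf nu0 k) => o h1 h2 u v t ub vb tb.
apply: (le_trans (h1 u v t ub vb tb)); rewrite mu0 mul0r subr0 lerN2.
apply: (le_trans (dominated_sqr nu0 (enorm_ge0 _) (h2 ub u v t))).
by rewrite -[ub - _]opprB mulmxN enorm_opp.
Qed.

(** The adjoint identity reduces both cases to pointwise inequalities between the
    coefficients. In the first case, the increment of the forward map in [y] is
    made of the increments of the initial map, [b] and [sigma], all of them
    dominated; in the second, only [f] is. *)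
Lemma system_monotone :
  (forall x y xb yb, H x -> H y -> H xb -> H yb ->
    ip (fA x y - fA xb yb) (x - xb)
    + ip (state_map P w Phi x y - state_map P w Phi xb yb) (y - yb)
      <= - (monotonicity_constant *
            N (state_map P w Phi x yb - state_map P w Phi x y))) \/
  (forall x y xb yb, H x -> H y -> H xb -> H yb ->
    ip (fA x y - fA xb yb) (x - xb)
    + ip (state_map P w Phi x y - state_map P w Phi xb yb) (y - yb)
      <= - (monotonicity_constant * N (fA xb y - fA x y))).
Proof.
have [cases _ [domL _ _] [monoL _]] := hA2.
have [[l0 l1 l2 l3] [l4 l5 l6 l7]] := lips.
case: cases => [[mu0 nu0]|[mu0 nu0]]; rewrite /monotonicity_constant; [left|right];
  move=> x y xb yb Hx Hy Hxb Hyb; rewrite state_map_pairing //.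
- rewrite mu0.
  have hL : vip P (fun o => aA y o - aA yb o) (fun o => y 0%N o - yb 0%N o)
      <= - (mu ^+ 3 * vip P (fun o => aA yb o - aA y o) (fun o => aA yb o - aA y o)).
    apply: (initial_pairing Hy Hyb) => u v; apply: (le_trans (monoL u v)); rewrite lerN2.
    exact: (dominated_sqr mu0 (enorm_ge0 _) (domL mu0 u v)).
  have [Db Ds _] := along_sub_mem Hx Hyb Hx Hy.
  rewrite (state_map_sub_norm Hx Hyb Hx Hy).
  have t0 : 0 < 2 * lip1 l ^+ 2 by rewrite mulr_gt0 // exprn_gt0.
  have k1 : Num.min 1 (2 * lip1 l ^+ 2) <= 1 by rewrite ge_min lexx.
  have k2 : Num.min 1 (2 * lip1 l ^+ 2) <= 2 * lip1 l ^+ 2 by rewrite ge_min lexx orbT.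
  have er : expR (- rho) * expR rho = 1 by rewrite -expRD addNr expR0.
  have e0 := expR_gt0 (- rho).
  have k3 : expR (- rho) * Num.min 1 (2 * lip1 l ^+ 2) <= 2^-1.
    have : expR (- rho) * (4 * lip1 l ^+ 2) <= 1.
      by rewrite -[leRHS]er; apply: ler_wpM2l; exact: ltW.
    exact: half_arith e0 k2.
  apply: (monotone_arith (exprn_gt0 3 mu0) (vip_ge0 P _) _ k1 k3 hL).
    by apply: addr_ge0; [exact: (ip_ge0 hH Db)|exact: (ip_ge0 hH Ds)].
  apply: (pairing_bound Hx Hy Hxb Hyb Db Ds
    (X' := fun k o => b_of Phi k (x k o) (yP yb k o) (zP yb k o) o
                      - b_of Phi k (x k o) (yP y k o) (zP y k o) o)
    (Y' := fun k o => sigma_of Phi k (x k o) (yP yb k o) (zP yb k o) o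
                      - sigma_of Phi k (x k o) (yP y k o) (zP y k o) o)) => k.
    by apply: filterS (along_sub Hx Hyb Hx Hy k) => o [h1 h2 _]; split.
  apply: filterS (pointwise_monotone1 mu0 nu0 k) => o h.
  exact: (h (x k o) (yP y k o) (zP y k o) (xb k o) (yP yb k o) (zP yb k o)).
- rewrite -mu0 ltxx.
  have hL : vip P (fun o => aA y o - aA yb o) (fun o => y 0%N o - yb 0%N o)
      <= - (0 * vip P (fun o => aA yb o - aA y o) (fun o => aA yb o - aA y o)).
    apply: (initial_pairing Hy Hyb) => u v; apply: (le_trans (monoL u v)).
    by rewrite mu0 !mul0r.
  rewrite mul0r oppr0 in hL.
  have [_ _ Df] := along_sub_mem Hxb Hy Hx Hy; have H0 := hilbert_mem0 hH.
  have N0 : N (0 : process) = 0.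
    by have := ipZl hH 0 H0 H0; rewrite scale0r mul0r.
  have hG := pairing_bound Hx Hy Hxb Hyb (q := nu ^+ 3) Df H0
    (X' := fun k o => f_of Phi k.+1 (xb k o) (yP y k o) (zP y k o) o
                      - f_of Phi k.+1 (x k o) (yP y k o) (zP y k o) o)
    (Y' := fun _ _ => 0).
  rewrite N0 addr0 in hG; rewrite -[leRHS]add0r; apply: (lerD hL); apply: hG => k.
    by apply: filterS (along_sub Hxb Hy Hx Hy k) => o [_ _ h]; split.
  apply: filterS (pointwise_monotone2 mu0 nu0 k) => o h.
  rewrite enorm0 expr0n /= addr0.
  exact: (h (x k o) (yP y k o) (zP y k o) (xb k o) (yP yb k o) (zP yb k o)).
Qed.

Theorem system_monotone_pair : monotone_pair (H := H) (ip := ip) monotonicity_constant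
  pair_lipschitz (state_map P w Phi) fA.
Proof.
split.
- by move=> x y Hx Hy; exact: (state_map_mem nw hA1).
- by move=> x y Hx Hy; have [] := f_alongP nw hA1 Hx Hy.
- by move=> *; exact: state_map_contracting.
- by move=> *; exact: f_along_contracting.
- by move=> *; exact: state_map_lipschitz.
- by move=> *; exact: f_along_lipschitz.
- exact: system_monotone.
Qed.
End Monotone.
End Estimates.

(** * Solutions *)

Section Solutions.
Context {d : measure_display} {T : measurableType d} {R : realType} {n : nat}.
Variables (P : probability T R) (w : nat -> T -> R) (rho : R).
Hypothesis nw : normalized_martingale_difference P w.
Local Notation process := (nat -> T -> 'cV[R]_n).
Local Notation H := (@H2 _ _ _ n P w rho).
Local Notation ip := (@ipr _ _ _ n P rho).
Local Notation N g := (ip g g).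
Implicit Types x y b s g h : process.
Let mw := noise_measurable nw.
Let hH : hilbert_form H ip := H2_hilbert P rho mw.

Lemma state_map_sub_forward (Phi : coefficients R T n) x y a b s :
  state_map P w Phi x y - forward w a b s =
  forward w (fun o => initial_along P w Phi y o - a o)
    (b_along P w Phi x y - b) (sigma_along P w Phi x y - s).
Proof. exact: forwardB. Qed.

Local Opaque b_along sigma_along f_along initial_along y_pred z_pred vip ipr.
Local Opaque state_map.

Lemma norm_sub_ae x g : H x -> H g ->
  (forall k, {ae P, forall o, x k o = g k o}) <-> N (x - g) = 0.
Proof.
move=> Hx Hg; have Hd := hilbert_memB hH Hx Hg; split=> [e|e k].
  apply: (ip_ae_eq0 rho); first by case: Hd.
  move=> k; apply: filterS (e k) => o h.
  by rewrite [LHS](_ : _ = x k o - g k o) // h subrr.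
apply: filterS (ipr_eq0 Hd e k) => o h; apply/eqP; rewrite -subr_eq0; apply/eqP.
exact: h.
Qed.

Section OneSystem.
Variables (Phi : coefficients R T n) (l : lipschitz_constants R).
Hypothesis hA1 : A1 P w Phi rho l.
Local Notation G := (state_map P w Phi).
Local Notation F := (f_along P w Phi).

(** The equations hold almost surely between the coefficients, hence between
    their adapted versions, which are the ones that belong to the Hilbert space. *)
Lemma is_solutionP x y : is_solution P w rho Phi x y <->
  [/\ H x, H y, forall k, {ae P, forall o, x k o = G x y k o} &
      forall k, {ae P, forall o, y k o = (- F x y) k o}].
Proof.
split=> [[/(L2rhoP P rho mw) Hx /(L2rhoP P rho mw) Hy x0 sol]|[Hx Hy ex ey]].
- have [e0 eS] := state_mapE nw hA1 Hx Hy; have [_ eF] := f_alongP nw hA1 Hx Hy.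
  split => // k; last first.
    by apply: filterS2 (sol k) (eF k) => o [_ ->] h; rewrite [RHS](_ : _ = - F x y k o) // -h.
  case: k => [|k]; first by apply: filterS2 x0 e0 => o -> ->.
  by apply: filterS2 (sol k) (eS k) => o [-> _] ->.
- have [e0 eS] := state_mapE nw hA1 Hx Hy; have [_ eF] := f_alongP nw hA1 Hx Hy.
  split; [exact/(L2rhoP P rho mw)|exact/(L2rhoP P rho mw)| |].
    by apply: filterS2 (ex 0%N) e0 => o -> ->.
  move=> k; apply: filterS3 (filterI (ex k.+1) (ey k)) (eS k) (eF k) => o [h1 h2] h3 h4.
  by split; [rewrite h1 h3|rewrite h2 [LHS](_ : _ = - F x y k o) // -h4].
Qed.

Variables (c L : R).
Hypotheses (c0 : 0 < c) (L0 : 0 <= L).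
Hypothesis pair : monotone_pair (H := H) (ip := ip) c L G F.
Local Notation SC := (stability_constant c L).

Lemma solution_residuals x y : is_solution P w rho Phi x y <->
  [/\ H x, H y, N (residual1 G x y) = 0 & N (residual2 F x y) = 0].
Proof.
split=> [/is_solutionP [Hx Hy ex ey]|[Hx Hy ex ey]].
  have HG := pair_memG pair Hx Hy; have HF := pair_memF pair Hx Hy.
  split => //; first exact/(norm_sub_ae Hx HG).
  have := (norm_sub_ae Hy (hilbert_memN hH HF)).1 ey.
  by rewrite opprK.
have HG := pair_memG pair Hx Hy; have HF := pair_memF pair Hx Hy.
apply/is_solutionP; split => //; first exact/(norm_sub_ae Hx HG).
by apply: (norm_sub_ae Hy (hilbert_memN hH HF)).2; rewrite opprK.
Qed.

Lemma solution_exists : exists x y, is_solution P w rho Phi x y.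
Proof.
have [x [y hxy]] := monotone_pair_solution hH c0 L0 pair.
by exists x, y; apply/solution_residuals.
Qed.

(** A pair [(xb, yb)] driven by the data [a], [b], [s] and [f] has as residuals the
    forward map and the process given by the differences between the data and
    the coefficients along the pair. *)
Lemma solution_stability x y xb yb (a : T -> 'cV[R]_n) b s f :
  is_solution P w rho Phi x y -> H xb -> H yb ->
  vgmeas (past w 0) a -> vsqi P a -> H b -> H s -> H f ->
  (forall k, {ae P, forall o, xb k o = forward w a b s k o}) ->
  (forall k, {ae P, forall o, yb k o = (- f) k o}) ->
  N (x - xb) + N (y - yb) <= 2 * SC *
    (vip P (fun o => initial_along P w Phi yb o - a o)
       (fun o => initial_along P w Phi yb o - a o)
     + expR (- rho) * (N (b_along P w Phi xb yb - b) + N (sigma_along P w Phi xb yb - s))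
     + N (F xb yb - f)).
Proof.
move=> /solution_residuals [Hx Hy r1 r2] Hxb Hyb ma sa Hb Hs Hf exb eyb.
have R1 := residual1_mem hH pair Hx Hy; have R2 := residual2_mem hH pair Hx Hy.
have R1b := residual1_mem hH pair Hxb Hyb; have R2b := residual2_mem hH pair Hxb Hyb.
have h1 := normB_le2 hH R1 R1b; have h2 := normB_le2 hH R2 R2b.
have HG := pair_memG pair Hxb Hyb; have HF := pair_memF pair Hxb Hyb.
have [Hbb _] := b_alongP nw hA1 Hxb Hyb; have [Hsb _] := sigma_alongP nw hA1 Hxb Hyb.
have [mab sab _] := initial_alongP nw hA1 Hyb.
have e2 : N (residual2 F xb yb) = N (F xb yb - f).
  apply: (ip_ae_eq rho); first by case: R2b.
    by case: (hilbert_memB hH HF Hf).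
  move=> k; apply: filterS (eyb k) => o h.
  rewrite [LHS](_ : _ = yb k o + F xb yb k o) // h.
  by rewrite [RHS](_ : _ = F xb yb k o - f k o) // addrC.
have Hfw := forward_mem nw ma sa Hb Hs.
have e1 : N (residual1 G xb yb) =
    vip P (fun o => initial_along P w Phi yb o - a o)
       (fun o => initial_along P w Phi yb o - a o)
     + expR (- rho) * (N (b_along P w Phi xb yb - b) + N (sigma_along P w Phi xb yb - s)).
  transitivity (N (G xb yb - forward w a b s)).
    rewrite (norm_subC hH HG Hfw); apply: (ip_ae_eq rho); first by case: R1b.
      by case: (hilbert_memB hH Hfw HG).
    move=> k; apply: filterS (exb k) => o h.
    rewrite [LHS](_ : _ = xb k o - G xb yb k o) // h //.
  have mD : vgmeas (past w 0) (fun o => initial_along P w Phi yb o - a o).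
    by move=> i; under eq_fun do rewrite !mxE; apply: measurable_funB; [exact: mab|exact: ma].
  rewrite state_map_sub_forward.
  exact: (forward_norm nw mD (vsqiB sab sa) (hilbert_memB hH Hbb Hb) (hilbert_memB hH Hsb Hs)).
have S0 := ltW (stability_constant_gt0 c0 L0).
have h := monotone_pair_stability hH c0 L0 pair Hx Hy Hxb Hyb.
exact: (stability_arith h r1 r2 h1 h2 e1 e2 S0).
Qed.

Lemma solution_unique x y x' y' : is_solution P w rho Phi x y ->
  is_solution P w rho Phi x' y' ->
  forall k, {ae P, forall o, x k o = x' k o /\ y k o = y' k o}.
Proof.
move=> /solution_residuals [Hx Hy r1 r2] /solution_residuals [Hx' Hy' r1' r2'].
have h := monotone_pair_stability hH c0 L0 pair Hx Hy Hx' Hy'.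
have R1 := residual1_mem hH pair Hx Hy; have R2 := residual2_mem hH pair Hx Hy.
have R1b := residual1_mem hH pair Hx' Hy'; have R2b := residual2_mem hH pair Hx' Hy'.
have h1 := normB_le2 hH R1 R1b; have h2 := normB_le2 hH R2 R2b.
have nx := ip_ge0 hH (hilbert_memB hH Hx Hx'); have ny := ip_ge0 hH (hilbert_memB hH Hy Hy').
have S0 := ltW (stability_constant_gt0 c0 L0).
have [zx zy] := unique_arith h r1 r1' r2 r2' h1 h2 S0 nx ny.
move=> k; apply: filterS2 ((norm_sub_ae Hx Hx').2 zx k) ((norm_sub_ae Hy Hy').2 zy k).
by move=> o -> ->.
Qed.

(** The predictors are chosen versions, hence only almost surely zero. *)
Lemma pred_zero k : {ae P, forall o, y_pred P w (0 : process) k o = 0 /\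
  z_pred P w (0 : process) k o = 0}.
Proof.
have H0 := hilbert_mem0 hH.
have [Hy Hz h] := predictors_bessel nw H0 (predictors_pred nw H0).
have N0 : N (0 : process) = 0 by have := ipZl hH 0 H0 H0; rewrite scale0r mul0r.
have [zy zz] := null_sum_arith h N0 (ip_ge0 hH Hy) (ip_ge0 hH Hz).
exact: filterS2 (ipr_eq0 Hy zy k) (ipr_eq0 Hz zz k).
Qed.

Hypotheses (rho_low : 4 * lip1 l ^+ 2 < expR rho)
  (rho_up : expR rho * (6 * lip2 l ^+ 2) < 1).
Hypothesis complP : measure_is_complete P.

(** Stability weighs the data of [b] and [sigma] with [expR (- rho)] and those of
    [f] with [1], whereas the size of the data does the opposite; [data_factor]
    bounds [expR (- rho)] and [expR rho], with no dependence on [rho]. *)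
Definition data_factor : R := 1 + (4 * lip1 l ^+ 2)^-1 + (6 * lip2 l ^+ 2)^-1.

Lemma data_factor_bound (A B F0 : R) : 0 <= A -> 0 <= B -> 0 <= F0 ->
  A + expR (- rho) * B + F0 <= data_factor * (B + expR (- rho) * F0 + A).
Proof.
move=> A0 B0 F00; have [[_ l1 l2 _] _] := lip_gt0 hA1.
have p1 : 0 < 4 * lip1 l ^+ 2 by rewrite mulr_gt0 // exprn_gt0.
have p2 : 0 < 6 * lip2 l ^+ 2 by rewrite mulr_gt0 // exprn_gt0.
have i1 : expR (- rho) <= (4 * lip1 l ^+ 2)^-1.
  by rewrite expRN lef_pV2 ?posrE ?expR_gt0 // ltW.
have i2 : expR rho <= (6 * lip2 l ^+ 2)^-1.
  by rewrite -[leRHS]mul1r ler_pdivlMr // ltW.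
have er : expR (- rho) * expR rho = 1 by rewrite -expRD addNr expR0.
by apply: (rescale_arith (expR_ge0 _) er i1 i2) => //; rewrite invr_ge0 ltW.
Qed.

(** Both estimates of the theorem are instances: the pair [(0, 0)] is driven by
    vanishing data, and a solution of another system by the coefficients of that
    system along it. *)
Lemma solution_data_stability x y xb yb (a gL : T -> 'cV[R]_n) b s f (gb gs gf : process) :
  is_solution P w rho Phi x y -> H xb -> H yb ->
  vgmeas (past w 0) a -> vsqi P a -> H b -> H s -> H f ->
  (forall k, {ae P, forall o, xb k o = forward w a b s k o}) ->
  (forall k, {ae P, forall o, yb k o = (- f) k o}) ->
  (forall k, {ae P, forall o, gb k o = at_theta P w (b_of Phi k) xb yb k o - b k o}) ->
  (forall k, {ae P, forall o, gs k o = at_theta P w (sigma_of Phi k) xb yb k o - s k o}) ->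
  (forall k, {ae P, forall o, gf k o = at_theta P w (f_of Phi k.+1) xb yb k o - f k o}) ->
  {ae P, forall o, gL o = Lambda_of Phi (yb 0%N o) - a o} ->
  (rho_norm2 P rho (fun k o => x k o - xb k o)%R
   + rho_norm2 P rho (fun k o => y k o - yb k o)%R
   <= (2 * SC * data_factor)%:E * data_size P rho gb gs gf gL)%E.
Proof.
move=> sol Hxb Hyb ma sa Hb Hs Hf exb eyb egb egs egf egL.
have [Hx Hy _ _] := (is_solutionP x y).1 sol.
have [Hbb eb] := b_alongP nw hA1 Hxb Hyb; have [Hsb es] := sigma_alongP nw hA1 Hxb Hyb.
have [Hfb ef] := f_alongP nw hA1 Hxb Hyb; have [mab sab ea] := initial_alongP nw hA1 Hyb.
have Db := hilbert_memB hH Hbb Hb; have Ds := hilbert_memB hH Hsb Hs.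
have Df := hilbert_memB hH Hfb Hf; have Da := vsqiB sab sa.
have -> := data_sizeE complP Db Ds Df Da _ _ _ _.
- rewrite (rho_norm2E (hilbert_memB hH Hx Hxb)) (rho_norm2E (hilbert_memB hH Hy Hyb)).
  rewrite -EFinD -EFinM lee_fin.
  apply: (le_trans (solution_stability sol Hxb Hyb ma sa Hb Hs Hf exb eyb)).
  apply: scale_le; first by rewrite mulr_ge0 // ltW // stability_constant_gt0.
  apply: data_factor_bound; first exact: vip_ge0.
    by apply: addr_ge0; [exact: (ip_ge0 hH Db)|exact: (ip_ge0 hH Ds)].
  exact: (ip_ge0 hH Df).
- by move=> k; apply: filterS2 (egb k) (eb k) => o -> ->.
- by move=> k; apply: filterS2 (egs k) (es k) => o -> ->.
- by move=> k; apply: filterS2 (egf k) (ef k) => o -> ->.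
- by apply: filterS2 egL ea => o -> ->.
Qed.

Lemma solution_size_bound x y : is_solution P w rho Phi x y ->
  (rho_norm2 P rho x + rho_norm2 P rho y
   <= (2 * SC * data_factor)%:E * data_size0 P rho Phi)%E.
Proof.
move=> sol; have H0 := hilbert_mem0 hH.
have e0 (g : process) : rho_norm2 P rho g = rho_norm2 P rho (fun k o => g k o - (0 : process) k o).
  by congr rho_norm2; apply/funext => k; apply/funext => o; rewrite subr0.
rewrite (e0 x) (e0 y).
apply: (solution_data_stability (a := fun=> 0) (b := 0) (s := 0) (f := 0) sol H0 H0) => //.
- exact: vsqi_cst.
- by move=> k; apply: aeW => o; case: k => [|k] //=; rewrite scaler0 addr0.
- by move=> k; apply: aeW => o; rewrite oppr0.
- by move=> k; apply: filterS (pred_zero k) => o [ey ez]; rewrite /at_theta ey ez subr0.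
- by move=> k; apply: filterS (pred_zero k) => o [ey ez]; rewrite /at_theta ey ez subr0.
- by move=> k; apply: filterS (pred_zero k) => o [ey ez]; rewrite /at_theta ey ez subr0.
- by apply: aeW => o; rewrite subr0.
Qed.
End OneSystem.

Lemma solution_forward (Phi : coefficients R T n) (l : lipschitz_constants R) x y :
  A1 P w Phi rho l -> is_solution P w rho Phi x y ->
  [/\ vgmeas (past w 0) (initial_along P w Phi y), vsqi P (initial_along P w Phi y) &
    (forall k, {ae P, forall o, x k o = forward w (initial_along P w Phi y)
      (b_along P w Phi x y) (sigma_along P w Phi x y) k o})].
Proof.
move=> hA1 /(is_solutionP hA1) [Hx Hy ex _].
by have [m s _] := initial_alongP nw hA1 Hy; split.
Qed.
End Solutions.

Section Constants.
Context {R : realType}.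
Implicit Types (l : lipschitz_constants R) (mu nu : R).

Lemma monotonicity_constant_gt0 l mu nu : 0 < lip1 l -> A2_cases mu nu ->
  0 < monotonicity_constant l mu nu.
Proof.
move=> l1; rewrite /monotonicity_constant => -[[mu0 _]|[-> nu0]].
  by rewrite mu0 mulr_gt0 ?exprn_gt0 // lt_min ltr01 /= mulr_gt0 // exprn_gt0.
by rewrite ltxx exprn_gt0.
Qed.

Lemma pair_lipschitz_ge0 l : 0 <= pair_lipschitz l.
Proof.
by rewrite /pair_lipschitz !addr_ge0 ?sqr_ge0 // mulr_ge0 // !addr_ge0 ?sqr_ge0.
Qed.

Definition estimate_constant l mu nu : R :=
  2 * stability_constant (monotonicity_constant l mu nu) (pair_lipschitz l)
    * data_factor l.

Lemma estimate_constant_gt0 l mu nu : lipschitz_constants_pos l -> A2_cases mu nu ->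
  0 < estimate_constant l mu nu.
Proof.
move=> [[_ l1 l2 _] _] cases; apply: mulr_gt0.
  apply: mulr_gt0 => //.
  exact: (stability_constant_gt0 (monotonicity_constant_gt0 l1 cases) (pair_lipschitz_ge0 l)).
by rewrite /data_factor !addr_gt0 // invr_gt0 mulr_gt0 // exprn_gt0.
Qed.

Lemma discount_bounds l rho : lipschitz_constants_pos l ->
  ln (4 * lip1 l ^+ 2) < rho < - ln (6 * lip2 l ^+ 2) ->
  4 * lip1 l ^+ 2 < expR rho /\ expR rho * (6 * lip2 l ^+ 2) < 1.
Proof.
move=> [[_ l1 l2 _] _] /andP[h1 h2].
have p1 : 0 < 4 * lip1 l ^+ 2 by rewrite mulr_gt0 // exprn_gt0.
have p2 : 0 < 6 * lip2 l ^+ 2 by rewrite mulr_gt0 // exprn_gt0.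
split; first by rewrite -[ltLHS](lnK p1) ltr_expR.
rewrite -[X in _ * X](lnK p2) -expRD -[ltRHS]expR0 ltr_expR.
by rewrite -ltrBrDr sub0r.
Qed.
End Constants.

(* K is chosen right after the Lipschitz constants, mu, nu and the bounds of
   A, B, C, M, hence depends on nothing else. *)
Theorem theorem3p1 (R : realType) (l : lipschitz_constants R)
    (mu nu cA cB cC cM : R) :
  exists2 K : R, 0 < K &
  forall (d : measure_display) (T : measurableType d) (P : probability T R)
    (w : nat -> T -> R) (n m : nat) (rho : R) (Phi : coefficients R T n)
    (M : 'M[R]_(m, n)) (A B C : nat -> T -> 'M[R]_(m, n)),
  measure_is_complete P ->
  normalized_martingale_difference P w ->
  A1 P w Phi rho l ->
  A2 P w Phi mu nu M A B C rho cA cB cC cM ->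
  ln (4 * lip1 l ^+ 2) < - ln (6 * lip2 l ^+ 2) ->
  ln (4 * lip1 l ^+ 2) < rho < - ln (6 * lip2 l ^+ 2) ->
  [/\ exists x y, is_solution P w rho Phi x y,
      forall x y x' y',
        is_solution P w rho Phi x y -> is_solution P w rho Phi x' y' ->
        forall k, {ae P, forall o, x k o = x' k o /\ y k o = y' k o},
      forall x y, is_solution P w rho Phi x y ->
        (rho_norm2 P rho x + rho_norm2 P rho y
          <= K%:E * data_size0 P rho Phi)%E &
      forall (Phib : coefficients R T n) (lb : lipschitz_constants R)
        (mub nub cAb cBb cCb cMb : R) (mb : nat) (Mb : 'M[R]_(mb, n))
        (Ab Bb Cb : nat -> T -> 'M[R]_(mb, n)),
      A1 P w Phib rho lb ->
      A2 P w Phib mub nub Mb Ab Bb Cb rho cAb cBb cCb cMb ->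
      forall x y xb yb,
        is_solution P w rho Phi x y -> is_solution P w rho Phib xb yb ->
        (rho_norm2 P rho (fun k o => x k o - xb k o)%R
         + rho_norm2 P rho (fun k o => y k o - yb k o)%R
          <= K%:E * data_gap P w rho Phi Phib xb yb)%E].
Proof.
have [[pos cases]|no] := pselect (lipschitz_constants_pos l /\ A2_cases mu nu); last first.
  (* With such constants no system satisfies the hypotheses. *)
  exists 1 => // d T P w n m rho Phi M A B C _ _ [_ _ pos _] [cases _ _ _].
  by case: no.
exists (estimate_constant l mu nu); first exact: estimate_constant_gt0.
move=> d T P w n m rho Phi M A B C complP nw hA1 hA2 _ /(discount_bounds pos) [low up].
have c0 : 0 < monotonicity_constant l mu nu.
  by have [[_ l1 _ _] _] := pos; exact: monotonicity_constant_gt0.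
have L0 := pair_lipschitz_ge0 l.
have pair := system_monotone_pair nw hA1 low up hA2.
split.
- exact: (solution_exists nw hA1 c0 L0 pair).
- exact: (solution_unique nw hA1 c0 L0 pair).
- exact: (solution_size_bound nw hA1 c0 L0 pair low up complP).
move=> Phib lb _ _ _ _ _ _ _ _ _ _ _ hA1b _ x y xb yb sol solb.
have [Hxb Hyb _ ey] := (is_solutionP nw hA1b xb yb).1 solb.
have [ma sa ex] := solution_forward nw hA1b solb.
have [Hb eb] := b_alongP nw hA1b Hxb Hyb; have [Hs es] := sigma_alongP nw hA1b Hxb Hyb.
have [Hf ef] := f_alongP nw hA1b Hxb Hyb; have [_ _ ea] := initial_alongP nw hA1b Hyb.
apply: (solution_data_stability nw hA1 c0 L0 pair low up complP sol Hxb Hyb ma sa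
  Hb Hs Hf ex ey).
- by move=> k; apply: filterS (eb k) => o ->.
- by move=> k; apply: filterS (es k) => o ->.
- by move=> k; apply: filterS (ef k) => o ->.
- by apply: filterS ea => o ->.
Qed.
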